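(* Let $f\in L^\infty(\mathbb R;\mathbb C)$ with $f\ge 0$ satisfy: (i) $f(x)=f(|x|)$ for a.e. $x\in\mathbb R$; (ii) there exist $\rho>1$ and $C>0$ such that $|f(x)|\le C\langle x\rangle^{-\rho}$ for a.e. $x\in\mathbb R$; (iii) there exists $\delta>0$ such that $f=1$ on $(-\delta,\delta)$. Let $H_0:=Q$ and let $H$ be a selfadjoint operator in $\mathcal H=L^2(\mathbb R)$ such that the wave operators $W_\pm:=\mathrm{s\text{-}}\lim_{t\to\pm\infty}\mathrm e^{itH}\mathrm e^{-itH_0}$ exist and are complete, and such that every operator $T\in\mathscr B(\mathcal H^{-s'},\mathcal H)$ with $s'>1/2$ is locally $H$-smooth on $\mathbb R\setminus\sigma_{\rm pp}(H)$. Let $s>1$ and let $\varphi\in\mathscr D_s$ be such that $S\varphi\in\mathscr D_s$ and $$\int_{-\infty}^0\mathrm dt\,\|(W_--1)\mathrm e^{-itH_0}\varphi\|<\infty,\qquad \int_0^{\infty}\mathrm dt\,\|(W_+-1)\mathrm e^{-itH_0}S\varphi\|<\infty .$$ Then the limit $\lim_{r\to\infty}\tau_r^{\rm in}(\varphi)$ exists and $$\lim_{r\to\infty}\tau^{\rm in}_r(\varphi)=\langle\varphi,S^*[P,S]\varphi\rangle .$$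
   Context: $\mathcal H:=L^2(\mathbb R)$ with scalar product $\langle\cdot,\cdot\rangle$ (antilinear in the first argument) and norm $\|\cdot\|$; $Q$ is the operator of multiplication by $x$, $P=-i\,\mathrm d/\mathrm dx$, $\langle x\rangle:=(1+|x|^2)^{1/2}$. For $s\in\mathbb R$, $\mathcal H^s$ is the usual Sobolev space on $\mathbb R$, i.e. the completion of the Schwartz space for the norm $\|\langle P\rangle^s\varphi\|$. $\mathscr B(\mathcal H_1,\mathcal H_2)$ is the set of bounded operators from $\mathcal H_1$ to $\mathcal H_2$. Completeness of $W_\pm$ means that their ranges equal the absolutely continuous subspace of $H$; then the scattering operator $S:=W_+^*W_-$ is unitary. $\sigma_{\rm pp}(H)$ is the set of eigenvalues of $H$. An operator $T$ is locally $H$-smooth on a set $\Omega\subset\mathbb R$ if for each compact $K\subset\Omega$ there is $C_K>0$ such that $\int_{\mathbb R}\mathrm dt\,\|T\mathrm e^{-itH}E^H(K)\psi\|^2\le C_K\|\psi\|^2$ for all $\psi\in\mathcal H$, where $E^H$ is the spectral measure of $H$. For $s\ge 0$, $$\mathscr D_s:=\{\varphi\in\mathcal H^s\mid \chi_J(Q)\varphi=\varphi\text{ for some compact set }J\subset\mathbb R\setminus\sigma_{\rm pp}(H)\}.$$ For $r>0$, $$T^0_r(\varphi):=\int_{\mathbb R}\mathrm dt\,\langle \mathrm e^{-itH_0}\varphi,f(P/r)\mathrm e^{-itH_0}\varphi\rangle,\qquad T_r(\varphi):=\int_{\mathbb R}\mathrm dt\,\langle \mathrm e^{-itH}W_-\varphi,f(P/r)\mathrm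 e^{-itH}W_-\varphi\rangle,$$ $$\tau_r^{\rm in}(\varphi):=T_r(\varphi)-T_r^0(\varphi).$$ The commutator is $[P,S]\varphi:=PS\varphi-SP\varphi$, which makes sense since $\varphi,S\varphi\in\mathcal H^s\subset\mathcal H^1=\mathcal D(P)$. *)

(* Defs.v *)
From HB Require Import structures.
From mathcomp Require Import all_boot all_order all_algebra.
From mathcomp Require Import all_classical all_reals all_analysis.
From mathcomp Require Import measurable_realfun ess_sup_inf complex ring.

Set Implicit Arguments.
Unset Strict Implicit.
Unset Printing Implicit Defensive.

Import Order.TTheory GRing.Theory Num.Theory.
Import numFieldNormedType.Exports.

Local Open Scope classical_set_scope.
Local Open Scope ring_scope.
Local Open Scope quotient_scope.
Local Open Scope complex_scope.

Notation Rez := complex.Re.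
Notation Imz := complex.Im.

Section ComplexFunctions.
Context {d : measure_display} {T : measurableType d} {R : realType}.
Implicit Types (f : T -> R[i]) (D : set T).

Definition abs2 (z : R[i]) : R := Rez z ^+ 2 + Imz z ^+ 2.

Definition cmeasurable f : Prop :=
  measurable_fun setT (fun x => Rez (f x)) /\
  measurable_fun setT (fun x => Imz (f x)).

Definition cintegrable (mu : set T -> \bar R) D f : Prop :=
  mu.-integrable D (fun x => (Rez (f x))%:E) /\
  mu.-integrable D (fun x => (Imz (f x))%:E).

(* The value is meaningful under [cintegrable mu D f]. *)
Definition cintegral (mu : set T -> \bar R) D f : R[i] :=
  fine (\int[mu]_(x in D) (Rez (f x))%:E)%E +i*
  fine (\int[mu]_(x in D) (Imz (f x))%:E)%E.

End ComplexFunctions.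

Section L2.
Context {d : measure_display} {T : measurableType d} {R : realType}.
Variable mu : {measure set T -> \bar R}.

Definition sq_integrable (f : T -> R[i]) : Prop :=
  cmeasurable f /\ (\int[mu]_x (abs2 (f x))%:E < +oo)%E.

Definition sq_int_pred : {pred T -> R[i]} := [pred f | `[< sq_integrable f >]].

Lemma measurable_abs2 (f : T -> R[i]) : cmeasurable f ->
  measurable_fun setT (EFin \o (fun x => abs2 (f x))).
Proof.
move=> [mr mi]; apply/measurable_EFinP/measurable_funD;
  exact: measurable_funX.
Qed.

Lemma abs2_ge0 (z : R[i]) : 0 <= abs2 z.
Proof. by rewrite addr_ge0 // sqr_ge0. Qed.

Lemma abs2_comb (a u v : R[i]) :
  abs2 (a * u + v) <= (2 * abs2 a) * abs2 u + 2 * abs2 v.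
Proof.
case: a u v => [a b] [u1 u2] [v1 v2]; rewrite /abs2 /=.
rewrite -subr_ge0.
set w1 := a * u1 - b * u2; set w2 := a * u2 + b * u1.
suff -> : 2 * (a ^+ 2 + b ^+ 2) * (u1 ^+ 2 + u2 ^+ 2)
   + 2 * (v1 ^+ 2 + v2 ^+ 2) - ((w1 + v1) ^+ 2 + (w2 + v2) ^+ 2)
   = (w1 - v1) ^+ 2 + (w2 - v2) ^+ 2 by rewrite addr_ge0 // sqr_ge0.
by rewrite /w1 /w2; ring.
Qed.

Lemma sq_int_submod_closed : submod_closed sq_int_pred.
Proof.
split=> [|a f g].
  apply/asboolP; split; first by split; exact: measurable_cst.
  under eq_integral do rewrite /abs2 /= expr0n addr0.
  by rewrite integral0 ltry.
move=> /asboolP[mf fi] /asboolP[mg gi]; apply/asboolP.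
have mfg : cmeasurable (a *: f + g).
  case: a mf mg => a b [mf1 mf2] [mg1 mg2].
  have E x : (((a +i* b) *: f + g) x) =
     (a * Rez (f x) - b * Imz (f x) + Rez (g x)) +i*
     (a * Imz (f x) + b * Rez (f x) + Imz (g x)).
    rewrite /= [LHS]/GRing.add /= /GRing.scale /= /GRing.mul /=.
    by case: (f x) (g x) => [? ?] [? ?].
  split; under eq_fun do rewrite E /=.
  - apply: measurable_funD => //; apply: measurable_funB;
      exact: measurable_funM.
  - apply: measurable_funD => //; apply: measurable_funD;
      exact: measurable_funM.
split=> //.
have H1 : (\int[mu]_x ((2 * abs2 a)%:E * (abs2 (f x))%:E) < +oo)%E.
  rewrite ge0_integralZl//; last 3 first.
  - exact: measurable_abs2.
  - by move=> x _; rewrite lee_fin abs2_ge0.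
  - by rewrite lee_fin mulr_ge0 // abs2_ge0.
  by rewrite lte_mul_pinfty // lee_fin mulr_ge0 // abs2_ge0.
have H2 : (\int[mu]_x (2%:E * (abs2 (g x))%:E) < +oo)%E.
  rewrite ge0_integralZl//; last 2 first.
  - exact: measurable_abs2.
  - by move=> x _; rewrite lee_fin abs2_ge0.
  by rewrite lte_mul_pinfty.
apply: (@le_lt_trans _ _ (\int[mu]_x ((2 * abs2 a)%:E * (abs2 (f x))%:E
    + 2%:E * (abs2 (g x))%:E))%E).
  apply: ge0_le_integral => //.
  - by move=> x _; rewrite lee_fin abs2_ge0.
  - exact: measurable_abs2.
  - by apply: emeasurable_funD; apply: measurable_funeM; exact: measurable_abs2.
  - by move=> x _; rewrite -!EFinM -EFinD lee_fin; exact: abs2_comb.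
rewrite ge0_integralD//.
- by rewrite lte_add_pinfty.
- by move=> x _; rewrite -EFinM lee_fin !mulr_ge0 // abs2_ge0.
- by apply: measurable_funeM; exact: measurable_abs2.
- by move=> x _; rewrite -EFinM lee_fin !mulr_ge0 // abs2_ge0.
- by apply: measurable_funeM; exact: measurable_abs2.
Qed.

HB.instance Definition _ :=
  GRing.isSubmodClosed.Build R[i] (T -> R[i]) sq_int_pred
    (GRing.submod_closed_semi sq_int_submod_closed).

Definition Lfun2 : Type := {f : T -> R[i] | f \in sq_int_pred}.

HB.instance Definition _ := [isSub of Lfun2 for @sval _ _].
HB.instance Definition _ := [Choice of Lfun2 by <:].
HB.instance Definition _ := [SubChoice_isSubLmodule of Lfun2 by <:].

Definition null_pred : {pred Lfun2} :=
  [pred f : Lfun2 | `[< \forall x \ae mu, val f x = 0 >]].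

Lemma null_zmod_closed : zmod_closed null_pred.
Proof.
split=> [|f g /asboolP f0 /asboolP g0]; apply/asboolP; first exact: aeW.
apply: filterS2 f0 g0 => x f0 g0.
by rewrite raddfB -[LHS]/(val f x - val g x) f0 g0 subr0.
Qed.

HB.instance Definition _ := GRing.isZmodClosed.Build Lfun2 null_pred
  null_zmod_closed.

Definition L2 : Type := Quotient.quot null_pred.

HB.instance Definition _ := GRing.Zmodule.on L2.
HB.instance Definition _ := EqQuotient.on L2.

Definition L2_scale (a : R[i]) (u : L2) : L2 := \pi_L2 (a *: repr u).

Lemma L2_piE (f g : Lfun2) :
  (\forall x \ae mu, val f x = val g x) -> \pi_L2 f = \pi_L2 g.
Proof.
move=> fg; apply/eqP; rewrite -Quotient.idealrBE; apply/asboolP.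
apply: filterS fg => x fg.
by rewrite raddfB -[LHS]/(val f x - val g x) fg subrr.
Qed.

Lemma L2_eq_repr (f : Lfun2) : \forall x \ae mu, val (repr (\pi_L2 f)) x = val f x.
Proof.
have : \pi_L2 (repr (\pi_L2 f)) == \pi_L2 f by rewrite reprK.
rewrite -Quotient.idealrBE => /asboolP; apply: filterS => x.
by rewrite raddfB -[LHS]/(val _ x - val f x) => /eqP; rewrite subr_eq0 => /eqP.
Qed.

Lemma L2_scale_pi a f : L2_scale a (\pi_L2 f) = \pi_L2 (a *: f).
Proof.
apply: L2_piE; apply: filterS (L2_eq_repr f) => x fx.
by rewrite !linearZ -[LHS]/(a * val _ x) fx.
Qed.

Lemma L2_addE f g : \pi_L2 f + \pi_L2 g = \pi_L2 (f + g).
Proof. by rewrite !piE. Qed.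

Lemma L2_scalerA a b v : L2_scale a (L2_scale b v) = L2_scale (a * b) v.
Proof. by elim/quotW: v => v; rewrite (L2_scale_pi b) !L2_scale_pi scalerA. Qed.

Lemma L2_scale1r : left_id 1 L2_scale.
Proof. by elim/quotW=> v; rewrite L2_scale_pi scale1r. Qed.

Lemma L2_scalerDr : right_distributive L2_scale +%R.
Proof.
move=> a; elim/quotW=> u; elim/quotW=> v.
by rewrite L2_addE !L2_scale_pi L2_addE scalerDr.
Qed.

Lemma L2_scalerDl v : {morph L2_scale^~ v : a b / a + b}.
Proof.
by elim/quotW: v => v a b /=; rewrite !L2_scale_pi L2_addE scalerDl.
Qed.

HB.instance Definition _ := GRing.Zmodule_isLmodule.Build R[i] L2
  L2_scalerA L2_scale1r L2_scalerDr L2_scalerDl.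

End L2.

Section L2Hilbert.
Context {d : measure_display} {T : measurableType d} {R : realType}.
Variable mu : {measure set T -> \bar R}.

Definition L2fun (u : L2 mu) : T -> R[i] := val (repr u).

(* The class of [f]; by convention 0 when [f] is not square integrable. *)
Definition toL2 (f : T -> R[i]) : L2 mu := \pi_(L2 mu) (insubd 0 f).

(* Antilinear in the first argument. *)
Definition inner (u v : L2 mu) : R[i] :=
  cintegral mu setT (fun x => conjc (L2fun u x) * L2fun v x).

Definition norm2 (u : L2 mu) : R :=
  Num.sqrt (fine (\int[mu]_x (abs2 (L2fun u x))%:E)%E).

End L2Hilbert.

Section Operators.
Context {R : realType}.

Notation leb := (@lebesgue_measure R).
Notation H := (L2 leb).

Implicit Types (u v w : H).

Definition expi (t : R) : R[i] := cos t +i* sin t.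

Definition strong_lim (F : set_system R) (U : R -> H -> H) (W : H -> H) : Prop :=
  forall u, norm2 (U t u - W u) @[t --> F] --> (0 : R).

(* [xget] selects the unique [w] representing the functional
   [fun u => inner (T u) v]; it exists for bounded [T]. *)
Definition adj (T : H -> H) (v : H) : H :=
  xget 0 [set w | forall u, inner (T u) v = inner u w].

(* g(Q), Q being multiplication by the variable. *)
Definition mulQ (g : R -> R[i]) (u : H) : H := toL2 leb (fun x => g x * L2fun u x).

Definition chiQ (J : set R) : H -> H := mulQ (fun x => (\1_J x)%:C).

(* e^{-itQ}. *)
Definition exp_itQ (t : R) : H -> H := mulQ (fun x => expi (- (t * x))).

(* sgn = -1: Fourier transform; sgn = 1: its inverse. *)
Definition fourier_trunc (sgn : R) (u : H) (n : nat) : H :=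
  toL2 leb (fun k => (Num.sqrt (2 * pi))^-1%:C *
    cintegral leb `[- n%:R, n%:R] (fun x => expi (sgn * (k * x)) * L2fun u x)).

(* The L^2-limit of the truncated integrals, which exists by Plancherel. *)
Definition fourier_sgn (sgn : R) (u : H) : H :=
  xget 0 [set v | norm2 (fourier_trunc sgn u n - v) @[n --> \oo] --> (0 : R)].

Definition fourier : H -> H := fourier_sgn (-1).

Definition fourier_inv : H -> H := fourier_sgn 1.

(* g(P), for P = -i d/dx, which F conjugates to multiplication by k. *)
Definition funP (g : R -> R[i]) (u : H) : H := fourier_inv (mulQ g (fourier u)).

Definition jap (x : R) : R := Num.sqrt (1 + x ^+ 2).

Definition sob_measure (s : R) (A : set R) : \bar R :=
  (\int[leb]_(k in A) (jap k `^ (2 * s))%:E)%E.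

Lemma measurable_jap (s : R) (D : set R) :
  measurable_fun D (EFin \o (fun k : R => jap k `^ (2 * s))).
Proof.
apply/measurable_EFinP.
apply: (@measurableT_comp _ _ _ _ _ _ (fun x : R => x `^ (2 * s))).
  exact: measurable_powR.
apply: (@measurableT_comp _ _ _ _ _ _ (@Num.sqrt R)).
  by apply: continuous_measurable_fun; exact: sqrt_continuous.
by apply: measurable_funD => //; exact: measurable_funX.
Qed.

Let sob_measure0 s : sob_measure s set0 = 0%E.
Proof. by rewrite /sob_measure integral_set0. Qed.

Let sob_measure_ge0 s A : (0 <= sob_measure s A)%E.
Proof. by apply: integral_ge0 => x _; rewrite lee_fin powR_ge0. Qed.

Let sob_measure_sigma_additive s : semi_sigma_additive (sob_measure s).
Proof.
move=> F mF tF mUF; rewrite /sob_measure ge0_integral_bigcup//; last 2 first.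
- exact: measurable_jap.
- by move=> x _; rewrite lee_fin powR_ge0.
apply: is_cvg_ereal_nneg_natsum_cond => n _ _.
by apply: integral_ge0 => x _; rewrite lee_fin powR_ge0.
Qed.

HB.instance Definition _ s := isMeasure.Build _ _ _ (sob_measure s)
  (sob_measure0 s) (sob_measure_ge0 s) (@sob_measure_sigma_additive s).

(* The completion of the Schwartz space for |<P>^s . |, realized through the
   Fourier transform as L^2(<k>^{2s} dk). *)
Definition sobolev (s : R) : Type := L2 (sob_measure s).

Definition in_sobolev (s : R) : set H :=
  [set u | sq_integrable (sob_measure s) (L2fun (fourier u))].

(* The canonical map from H to [sobolev s], an embedding for [s <= 0]. *)
Definition to_sobolev (s : R) (u : H) : sobolev s :=
  toL2 (sob_measure s) (L2fun (fourier u)).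

Definition bounded_op (s : R) (T : sobolev s -> H) : Prop :=
  exists C : R, forall u : sobolev s, norm2 (T u) <= C * norm2 u.

Record operator := Operator { dom : set H ; app :> H -> H }.

(* Pu = v means u' = i v, u being absolutely continuous. *)
Definition is_momentum u v : Prop :=
  exists g : R -> R[i], (\forall x \ae leb, g x = L2fun u x) /\
    forall a b : R, a <= b -> g b - g a = (0 +i* 1)%C * cintegral leb `[a, b] (L2fun v).

Definition momentum : operator := {|
  dom := [set u | exists v, is_momentum u v];
  app := fun u => xget 0 (is_momentum u) |}.

Definition linear_op (A : operator) : Prop :=
  forall (a : R[i]) u v, dom A u -> dom A v ->
    dom A (a *: u + v) /\ A (a *: u + v) = a *: A u + A v.

Definition densely_defined (A : operator) : Prop :=
  forall u (e : R), 0 < e -> exists2 v, dom A v & norm2 (u - v) < e.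

(* The last clause says that A and its adjoint have the same graph. *)
Definition selfadjoint (A : operator) : Prop :=
  [/\ linear_op A, densely_defined A &
      forall v w, (forall u, dom A u -> inner v (A u) = inner w u) <->
                  (dom A v /\ A v = w)].

Definition eigenvalues (A : operator) : set R :=
  [set l | exists u, [/\ u != 0, dom A u & A u = l%:C *: u]].

Definition projection_valued_measure (E : set R -> {linear H -> H}) : Prop :=
  [/\ forall u, E setT u = u,
      forall A B u, measurable A -> measurable B -> E (A `&` B) u = E A (E B u),
      forall A u v, measurable A -> inner (E A u) v = inner u (E A v) &
      forall F : (set R)^nat, (forall n, measurable (F n)) -> trivIset setT F ->
        forall u, norm2 (\sum_(i < n) E (F i) u - E (\bigcup_i F i) u)
          @[n --> \oo] --> (0 : R)].

(* <u, E(B) u>. *)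
Definition spectral_dist (E : set R -> {linear H -> H}) u (B : set R) : \bar R :=
  (norm2 (E B u) ^+ 2)%:E.

Definition spectral_measure_of (A : operator) (E : set R -> {linear H -> H}) :
    Prop :=
  [/\ projection_valued_measure E,
      forall u, dom A u <->
        (\int[spectral_dist E u]_l (l ^+ 2)%:E < +oo)%E &
      forall u, dom A u ->
        inner u (A u) = cintegral (spectral_dist E u) setT (fun l => l%:C)].

(* T = g(A), for a bounded function g and the spectral measure E of A; by
   polarization the diagonal of the form determines T. *)
Definition is_function_of (E : set R -> {linear H -> H}) (g : R -> R[i])
    (T : {linear H -> H}) : Prop :=
  forall u, inner u (T u) = cintegral (spectral_dist E u) setT g.

(* U t = e^{-itA}. *)
Definition is_propagator (E : set R -> {linear H -> H}) (U : R -> {linear H -> H}) :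
    Prop :=
  forall t, is_function_of E (fun l => expi (- (t * l))) (U t).

Definition ac_subspace (E : set R -> {linear H -> H}) : set H :=
  [set u | spectral_dist E u `<< leb].

Definition locally_smooth (E : set R -> {linear H -> H}) (U : R -> {linear H -> H})
    (T : H -> H) (Omega : set R) : Prop :=
  forall K : set R, compact K -> K `<=` Omega ->
    exists2 C : R, 0 < C & forall u,
      (\int[leb]_t (norm2 (T (U t (E K u))) ^+ 2)%:E <= (C * norm2 u ^+ 2)%:E)%E.

(* W = s-lim e^{itH} e^{-itQ}, for U t = e^{-itH}. *)
Definition is_wave_operator (U : R -> {linear H -> H}) (F : set_system R) (W : H -> H) :
    Prop :=
  strong_lim F (fun t u => U (- t) (exp_itQ t u)) W.

Definition scattering (Wp Wm : H -> H) (u : H) : H := adj Wp (Wm u).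

Definition DD (A : operator) (s : R) : set H :=
  [set u | in_sobolev s u /\
     exists J : set R, [/\ compact J, J `<=` ~` eigenvalues A & chiQ J u = u]].

(* The integrand of a sojourn time, for the evolution V. *)
Definition localization (f : R -> R[i]) (r : R) (V : R -> H -> H) u (t : R) :
    R[i] :=
  inner (V t u) (funP (fun k => f (k / r)) (V t u)).

Definition sojourn (f : R -> R[i]) (r : R) (V : R -> H -> H) u : R[i] :=
  cintegral leb setT (localization f r V u).

(* The evolution t |-> e^{-itH} W_-. *)
Definition full_evolution (U : R -> {linear H -> H}) (Wm : H -> H) : R -> H -> H :=
  fun t u => U t (Wm u).

Definition tau_in (f : R -> R[i]) (U : R -> {linear H -> H}) (Wm : H -> H) (r : R) u :
    R[i] :=
  sojourn f r (full_evolution U Wm) u - sojourn f r exp_itQ u.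

Definition commutator (A B : H -> H) u : H := A (B u) - B (A u).

End Operators.

(* Main.v *)
Require Import Defs.
From HB Require Import structures.
From mathcomp Require Import all_boot all_order all_algebra.
From mathcomp Require Import all_classical all_reals all_analysis.
From mathcomp Require Import measurable_realfun complex ring lra.

Set Implicit Arguments.
Unset Strict Implicit.
Unset Printing Implicit Defensive.

Import Order.TTheory GRing.Theory Num.Theory.
Import numFieldNormedType.Exports.

Local Open Scope classical_set_scope.
Local Open Scope ring_scope.
Local Open Scope quotient_scope.
Local Open Scope complex_scope.

(* Let F be the Fourier transform.  F maps e^{-itQ} to translation by t and f(P/r) to
   multiplication by f(k/r), so that for a weight p, by Tonelli,

     int p(t) <e^{-itQ} u, f(P/r) e^{-itQ} u> dt = int K_r(l) |F u(l)|^2 dl,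
     K_r(l) = int p(t) f((l - t)/r) dt.

   When p is the indicator of [0, +oo[ and f = 1 near 0, K_r(l) - K_r(0) tends to l as r -> oo
   and is dominated by |l|; hence, for |u| = |w|,

     int_{t > 0} (<e^{-itQ} w, f(P/r) e^{-itQ} w> - <e^{-itQ} u, f(P/r) e^{-itQ} u>) dt
       -> <w, P w> - <u, P u>.

   By intertwining, e^{-itH} W_- phi = W_- e^{-itQ} phi = W_+ e^{-itQ} S phi.  The two
   integrability conditions say that this is L^1(dt)-close to e^{-itQ} phi for t < 0 and to
   e^{-itQ} S phi for t > 0.  The form of f(P/r) is Lipschitz on spheres, uniformly in r, and tends
   to the squared norm, which is the same for the three evolutions; by dominated convergence
   these replacements cost nothing in the limit.  What remains of tau_r is the difference above
   with u = phi and w = S phi, and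
   <S phi, P S phi> - <phi, P phi> = <phi, S^* [P, S] phi> by unitarity of S. *)

(** * Complex-valued integrals *)

(** Each half-line integral taken alone grows like [r], through the term [K_r(0) |u|^2]; only the
    equality of the norms of [phi] and [S phi] makes the difference converge. Hence [K_r(0)] is
    split off before passing to the limit, and what is left is dominated by the first moment of
    [|F u|^2], which the Sobolev condition supplies.

    Several obstacles shape the rest. The Fourier transform is a chosen L2 limit of truncated
    integrals, so nothing is known about it before Plancherel, which is proved by damping with
    [exp(- e |k|)]: the damping makes Fubini applicable and is removed by monotone convergence. The
    propagator is given only through its diagonal forms; the group law behind intertwining is
    rebuilt from them. The momentum is defined by absolute continuity and has to be matched with
    multiplication by [k]. The symbol [f] obeys its bounds only almost everywhere and is exchanged
    for a function that obeys them everywhere. Finally [e^{-itH} W_-] has no explicit formula, so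
    measurability in [t] is deduced from continuity. *)

Section ComplexModulus.
Context {R : realType}.
Implicit Types (z w : R[i]).

(** The modulus as an element of [R]: the norm of [R[i]] takes its values in [R[i]], whereas
    integrals, bounds and limits are taken over the reals. *)
Definition cnorm z : R := Num.sqrt (abs2 z).

Lemma normcE_cnorm z : `|z| = (cnorm z)%:C.
Proof. by rewrite normc_def. Qed.

Lemma cnorm_ge0 z : 0 <= cnorm z.
Proof. exact: sqrtr_ge0. Qed.

Lemma sqr_cnorm z : cnorm z ^+ 2 = abs2 z.
Proof. by rewrite sqr_sqrtr // abs2_ge0. Qed.

Lemma cnormM z w : cnorm (z * w) = cnorm z * cnorm w.
Proof.
by apply: (@complexI R); rewrite rmorphM /= -!normcE_cnorm normrM.
Qed.

Lemma cnormD z w : cnorm (z + w) <= cnorm z + cnorm w.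
Proof. by rewrite -lecR rmorphD /= -!normcE_cnorm ler_normD. Qed.

Lemma cnormN z : cnorm (- z) = cnorm z.
Proof. by apply: (@complexI R); rewrite -!normcE_cnorm normrN. Qed.

Lemma cnorm_conj z : cnorm (conjc z) = cnorm z.
Proof. by case: z => a b; rewrite /cnorm /abs2 /= sqrrN. Qed.

Lemma cnorm0 : cnorm 0 = 0.
Proof. by rewrite /cnorm /abs2 /= expr0n addr0 sqrtr0. Qed.

Lemma cnorm_real (x : R) : cnorm x%:C = `|x|.
Proof. by rewrite /cnorm /abs2 /= expr0n addr0 sqrtr_sqr. Qed.

Lemma cnorm_eq0 z : cnorm z = 0 -> z = 0.
Proof. by move=> z0; apply/eqP; rewrite -normr_eq0 normcE_cnorm z0. Qed.

Lemma Re_le_cnorm z : `|Rez z| <= cnorm z.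
Proof. by rewrite -sqrtr_sqr ler_wsqrtr // lerDl sqr_ge0. Qed.

Lemma Im_le_cnorm z : `|Imz z| <= cnorm z.
Proof. by rewrite -sqrtr_sqr ler_wsqrtr // lerDr sqr_ge0. Qed.

Lemma cnorm_le_ReIm z : cnorm z <= `|Rez z| + `|Imz z|.
Proof.
case: z => a b /=; rewrite -[leRHS]ger0_norm ?addr_ge0 // -sqrtr_sqr.
rewrite ler_wsqrtr // /abs2 /= sqrrD !real_normK ?num_real //.
by rewrite addrAC lerDl mulrn_wge0 // mulr_ge0.
Qed.

Lemma mul_conj_abs2 z : conjc z * z = (abs2 z)%:C.
Proof.
by case: z => a b; rewrite /abs2 /=; apply/eqP; rewrite eq_complex /=;
  apply/andP; split; apply/eqP; ring.
Qed.

Lemma abs2M z w : abs2 (z * w) = abs2 z * abs2 w.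
Proof. by case: z w => a b [c d]; rewrite /abs2 /=; ring. Qed.

Lemma abs2N z : abs2 (- z) = abs2 z.
Proof. by rewrite -!sqr_cnorm cnormN. Qed.

Lemma conjcD z w : conjc (z + w) = conjc z + conjc w.
Proof. exact: (rmorphD (@conjc R)). Qed.
Lemma conjcN z : conjc (- z) = - conjc z.
Proof. exact: (rmorphN (@conjc R)). Qed.
Lemma conjcM z w : conjc (z * w) = conjc z * conjc w.
Proof. exact: (rmorphM (@conjc R)). Qed.

Lemma conj_real (x : R) : conjc (x%:C) = x%:C :> R[i].
Proof. by rewrite /= oppr0. Qed.

Lemma abs2_real (x : R) : abs2 x%:C = x ^+ 2.
Proof. by rewrite /abs2 /= expr0n addr0. Qed.

Lemma abs2_0 : abs2 (0 : R[i]) = 0.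
Proof. by rewrite -sqr_cnorm cnorm0 expr0n. Qed.

Lemma abs2_eq0 z : abs2 z = 0 -> z = 0.
Proof. by move=> z0; apply: cnorm_eq0; rewrite /cnorm z0 sqrtr0. Qed.

Lemma abs2D_le z w : abs2 (z + w) <= 2 * abs2 z + 2 * abs2 w.
Proof.
by have := abs2_comb 1 z w; rewrite mul1r abs2_real expr1n mulr1.
Qed.

Lemma complexE_ReIm z : z = Rez z +i* Imz z.
Proof. by case: z. Qed.

Lemma ReD z w : Rez (z + w) = Rez z + Rez w.
Proof. by case: z w => [? ?] [? ?]. Qed.
Lemma ImD z w : Imz (z + w) = Imz z + Imz w.
Proof. by case: z w => [? ?] [? ?]. Qed.
Lemma ReN z : Rez (- z) = - Rez z.
Proof. by case: z. Qed.
Lemma ImN z : Imz (- z) = - Imz z.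
Proof. by case: z. Qed.
Lemma ReM z w : Rez (z * w) = Rez z * Rez w - Imz z * Imz w.
Proof. by case: z w => [? ?] [? ?]. Qed.
Lemma ImM z w : Imz (z * w) = Rez z * Imz w + Imz z * Rez w.
Proof. by case: z w => [? ?] [? ?]. Qed.
Lemma Re_conj z : Rez (conjc z) = Rez z.
Proof. by case: z. Qed.
Lemma Im_conj z : Imz (conjc z) = - Imz z.
Proof. by case: z. Qed.

Lemma abs2_expi (t : R) : abs2 (expi t) = 1.
Proof. by rewrite /abs2 /= cos2Dsin2. Qed.

Lemma cnorm_expi (t : R) : cnorm (expi t) = 1.
Proof. by rewrite /cnorm abs2_expi sqrtr1. Qed.

Lemma expiD (s t : R) : expi (s + t) = expi s * expi t.
Proof.
apply/eqP; rewrite eq_complex /= cosD sinD; apply/andP; split => //.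
by rewrite addrC.
Qed.

Lemma expiN (t : R) : expi (- t) = conjc (expi t).
Proof. by rewrite /expi cosN sinN. Qed.

Lemma expi0 : expi (0 : R) = 1.
Proof. by rewrite /expi cos0 sin0. Qed.

End ComplexModulus.

Section ComplexIntegral.
Context {d : measure_display} {T : measurableType d} {R : realType}.
Implicit Types (f g : T -> R[i]).

Lemma cmeasurable_cst (c : R[i]) : cmeasurable (fun _ : T => c).
Proof. by split; exact: measurable_cst. Qed.

Lemma cmeasurable_real (h : T -> R) :
  measurable_fun setT h -> cmeasurable (fun x => (h x)%:C).
Proof. by move=> mh; split => //=; exact: measurable_cst. Qed.

Lemma cmeasurableD f g :
  cmeasurable f -> cmeasurable g -> cmeasurable (fun x => f x + g x).
Proof.
move=> [f1 f2] [g1 g2]; split.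
- by under eq_fun do rewrite ReD; exact: measurable_funD.
- by under eq_fun do rewrite ImD; exact: measurable_funD.
Qed.

Lemma cmeasurableN f : cmeasurable f -> cmeasurable (fun x => - f x).
Proof.
move=> [f1 f2]; split.
- by under eq_fun do rewrite ReN; exact: measurable_funN.
- by under eq_fun do rewrite ImN; exact: measurable_funN.
Qed.

Lemma cmeasurableB f g :
  cmeasurable f -> cmeasurable g -> cmeasurable (fun x => f x - g x).
Proof. by move=> mf mg; apply: cmeasurableD => //; exact: cmeasurableN. Qed.

Lemma cmeasurableM f g :
  cmeasurable f -> cmeasurable g -> cmeasurable (fun x => f x * g x).
Proof.
move=> [f1 f2] [g1 g2]; split.
- under eq_fun do rewrite ReM.
  by apply: measurable_funB; exact: measurable_funM.
- under eq_fun do rewrite ImM.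
  by apply: measurable_funD; exact: measurable_funM.
Qed.

Lemma cmeasurable_conj f : cmeasurable f -> cmeasurable (fun x => (conjc (f x))).
Proof.
move=> [f1 f2]; split; first by under eq_fun do rewrite Re_conj.
by under eq_fun do rewrite Im_conj; exact: measurable_funN.
Qed.

Lemma measurable_fun_abs2 f : cmeasurable f ->
  measurable_fun setT (fun x => abs2 (f x)).
Proof. by move=> [mr mi]; apply/measurable_funD; exact: measurable_funX. Qed.

Lemma measurable_fun_sqrt (h : T -> R) : measurable_fun setT h ->
  measurable_fun setT (fun x => Num.sqrt (h x)).
Proof.
move=> mh; apply: (@measurableT_comp _ _ _ _ _ _ (@Num.sqrt R)) => //.
by apply: continuous_measurable_fun; exact: sqrt_continuous.
Qed.

Lemma measurable_fun_cnorm f : cmeasurable f ->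
  measurable_fun setT (fun x => cnorm (f x)).
Proof. by move=> mf; apply: measurable_fun_sqrt; exact: measurable_fun_abs2. Qed.

Lemma cmeasurable_indic (A : set T) : measurable A ->
  cmeasurable (fun x => (\1_A x)%:C : R[i]).
Proof. by move=> mA; apply: cmeasurable_real; exact: measurable_indic. Qed.

Lemma cmeasurable_expi (h : T -> R) : measurable_fun setT h ->
  cmeasurable (fun x => expi (h x)).
Proof.
move=> mh; split => /=.
- apply: (@measurableT_comp _ _ _ _ _ _ (@cos R)) => //.
  by apply: continuous_measurable_fun; exact: continuous_cos.
- apply: (@measurableT_comp _ _ _ _ _ _ (@sin R)) => //.
  by apply: continuous_measurable_fun; exact: continuous_sin.
Qed.

Variable mu : {measure set T -> \bar R}.

Lemma integrable_ge0P (h : T -> R) : (forall x, 0 <= h x) ->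
  measurable_fun setT h -> (\int[mu]_x (h x)%:E < +oo)%E ->
  mu.-integrable setT (EFin \o h).
Proof.
move=> h0 mh hoo; apply/integrableP; split; first exact/measurable_EFinP.
by under eq_integral do rewrite /= ger0_norm //.
Qed.

Lemma le_cintegrable f (h : T -> R) : mu.-integrable setT (EFin \o h) ->
  cmeasurable f -> (forall x, cnorm (f x) <= h x) ->
  cintegrable mu setT f.
Proof.
move=> hi [f1 f2] fh; split.
- apply: le_integrable hi => //; first exact/measurable_EFinP.
  move=> x _ /=; rewrite lee_fin (le_trans (Re_le_cnorm _)) //.
  by rewrite (le_trans (fh x)) // ler_norm.
- apply: le_integrable hi => //; first exact/measurable_EFinP.
  move=> x _ /=; rewrite lee_fin (le_trans (Im_le_cnorm _)) //.
  by rewrite (le_trans (fh x)) // ler_norm.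
Qed.

Lemma cintegrable_cmeasurable f : cintegrable mu setT f -> cmeasurable f.
Proof.
by move=> [/integrableP[/measurable_EFinP ? _] /integrableP[/measurable_EFinP ? _]].
Qed.

Lemma cintegrable_cnorm f : cintegrable mu setT f ->
  mu.-integrable setT (EFin \o (fun x => cnorm (f x))).
Proof.
move=> fi; have mf := cintegrable_cmeasurable fi; move: fi => [f1 f2].
have := integrableD measurableT (integrable_abse f1) (integrable_abse f2).
apply: le_integrable => //; first exact/measurable_EFinP/measurable_fun_cnorm.
move=> x _ /=; rewrite lee_fin ger0_norm ?cnorm_ge0 // ger0_norm ?addr_ge0 //.
exact: cnorm_le_ReIm.
Qed.

Lemma eq_cintegral f g : (forall x, f x = g x) ->
  cintegral mu setT f = cintegral mu setT g.
Proof. by move=> fg; congr cintegral; apply/funext. Qed.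

Lemma ae_eq_cintegral f g : cmeasurable f -> cmeasurable g ->
  (\forall x \ae mu, f x = g x) -> cintegral mu setT f = cintegral mu setT g.
Proof.
move=> [f1 f2] [g1 g2] fg; rewrite /cintegral; congr (fine _ +i* fine _);
  apply: ae_eq_integral => //; try exact/measurable_EFinP;
  by apply: filterS fg => x -> _.
Qed.

Lemma ae_cintegrable f g : cmeasurable g ->
  (\forall x \ae mu, f x = g x) -> cintegrable mu setT f -> cintegrable mu setT g.
Proof.
move=> [g1 g2] fg [/integrableP[f1 fi1] /integrableP[f2 fi2]].
split; apply/integrableP; split; try exact/measurable_EFinP.
- rewrite (ae_eq_integral (fun x => `|(Rez (f x))%:E|%E)) //.
  + by apply: measurableT_comp => //; exact/measurable_EFinP.
  + by apply: measurableT_comp.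
  + by apply: filterS fg => x -> _.
- rewrite (ae_eq_integral (fun x => `|(Imz (f x))%:E|%E)) //.
  + by apply: measurableT_comp => //; exact/measurable_EFinP.
  + by apply: measurableT_comp.
  + by apply: filterS fg => x -> _.
Qed.

Lemma cintegrableD f g : cintegrable mu setT f -> cintegrable mu setT g ->
  cintegrable mu setT (fun x => f x + g x).
Proof.
move=> [f1 f2] [g1 g2]; split.
- under eq_fun do rewrite ReD EFinD; exact: integrableD.
- under eq_fun do rewrite ImD EFinD; exact: integrableD.
Qed.

Lemma cintegralD f g : cintegrable mu setT f -> cintegrable mu setT g ->
  cintegral mu setT (fun x => f x + g x) =
  cintegral mu setT f + cintegral mu setT g.
Proof.
move=> [f1 f2] [g1 g2]; apply/eqP; rewrite eq_complex /=.
apply/andP; split; apply/eqP.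
- rewrite -fineD ?integrable_fin_num // -integralD_EFin //.
  by congr fine; apply: eq_integral => x _ /=; rewrite ReD EFinD.
- rewrite -fineD ?integrable_fin_num // -integralD_EFin //.
  by congr fine; apply: eq_integral => x _ /=; rewrite ImD EFinD.
Qed.

Lemma cintegrableZ (c : R[i]) f : cintegrable mu setT f ->
  cintegrable mu setT (fun x => c * f x).
Proof.
move=> fi; have hi := integrableZl measurableT (cnorm c) (cintegrable_cnorm fi).
apply: (le_cintegrable (h := fun x => cnorm c * cnorm (f x)) hi) => [|x].
- apply: cmeasurableM; [exact: cmeasurable_cst|exact: cintegrable_cmeasurable fi].
- by rewrite cnormM.
Qed.

Lemma cintegralZ (c : R[i]) f : cintegrable mu setT f ->
  cintegral mu setT (fun x => c * f x) = c * cintegral mu setT f.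
Proof.
case: c => a b [f1 f2]; apply/eqP; rewrite eq_complex /=.
have Z k (h : T -> R) : mu.-integrable setT (EFin \o h) ->
    mu.-integrable setT (EFin \o (fun x => k * h x)).
  by move=> hi; apply: eq_integrable (integrableZl measurableT k hi).
have ZE k (h : T -> R) : mu.-integrable setT (EFin \o h) ->
    fine (\int[mu]_x (k * h x)%:E) = k * fine (\int[mu]_x (h x)%:E).
  move=> hi; under eq_integral do rewrite EFinM.
  by rewrite integralZl // fineM // integrable_fin_num.
apply/andP; split; apply/eqP.
- rewrite -!ZE // -fineB ?integrable_fin_num //; try exact: Z.
  rewrite -integralB_EFin //; try exact: Z.
  by congr fine; apply: eq_integral => x _; rewrite ReM /= EFinB.
- rewrite -!ZE // -fineD ?integrable_fin_num //; try exact: Z.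
  rewrite -integralD_EFin //; try exact: Z.
  by congr fine; apply: eq_integral => x _; rewrite ImM /= EFinD.
Qed.

Lemma cintegrableN f : cintegrable mu setT f ->
  cintegrable mu setT (fun x => - f x).
Proof. by move=> /(cintegrableZ (- 1)); under eq_fun do rewrite mulN1r. Qed.

Lemma cintegralN f : cintegrable mu setT f ->
  cintegral mu setT (fun x => - f x) = - cintegral mu setT f.
Proof.
by move=> fi; rewrite -mulN1r -cintegralZ //; apply: eq_cintegral => x; rewrite mulN1r.
Qed.

Lemma cintegrableB f g : cintegrable mu setT f -> cintegrable mu setT g ->
  cintegrable mu setT (fun x => f x - g x).
Proof. by move=> fi gi; apply: cintegrableD => //; exact: cintegrableN. Qed.

Lemma cintegralB f g : cintegrable mu setT f -> cintegrable mu setT g ->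
  cintegral mu setT (fun x => f x - g x) =
  cintegral mu setT f - cintegral mu setT g.
Proof.
by move=> fi gi; rewrite cintegralD //; [rewrite cintegralN|exact: cintegrableN].
Qed.

Lemma cintegrable_conj f : cintegrable mu setT f ->
  cintegrable mu setT (fun x => (conjc (f x))).
Proof.
move=> [f1 f2]; split; first by under eq_fun do rewrite Re_conj.
by under eq_fun do rewrite Im_conj; exact: integrableN f2.
Qed.

Lemma cintegral_conj f : cintegrable mu setT f ->
  cintegral mu setT (fun x => (conjc (f x))) = conjc (cintegral mu setT f).
Proof.
move=> [f1 f2]; rewrite /cintegral /=; congr (fine _ +i* _).
- by apply: eq_integral => x _; rewrite Re_conj.
- rewrite -fineN; congr fine; rewrite -integralN /=; last exact: integrable_add_def.
  by apply: eq_integral => x _; rewrite Im_conj.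
Qed.

Lemma cintegral_real (h : T -> R) :
  cintegral mu setT (fun x => (h x)%:C) = (\int[mu]_x h x)%:C.
Proof. by rewrite /cintegral /= integral0. Qed.

Lemma cintegrable_real (h : T -> R) :
  mu.-integrable setT (EFin \o h) -> cintegrable mu setT (fun x => (h x)%:C).
Proof. by move=> hi; split => //=; exact: integrable0. Qed.

Lemma Re_cintegral f : Rez (cintegral mu setT f) = \int[mu]_x Rez (f x).
Proof. by []. Qed.

(* Rotate the integral onto the positive axis. *)
Lemma cnorm_cintegral f : cintegrable mu setT f ->
  cnorm (cintegral mu setT f) <= \int[mu]_x cnorm (f x).
Proof.
move=> fi; set z := cintegral mu setT f.
have [z0|z0] := eqVneq (cnorm z) 0.
  by rewrite z0; apply: Rintegral_ge0 => x _; exact: cnorm_ge0.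
have zp : 0 < cnorm z by rewrite lt_neqAle eq_sym z0 cnorm_ge0.
rewrite -(@ler_pM2l _ (cnorm z)) // -expr2 sqr_cnorm.
rewrite -RintegralZl //; last exact: cintegrable_cnorm.
have -> : abs2 z = Rez (conjc z * z) by rewrite mul_conj_abs2.
rewrite -(cintegralZ ((conjc z))) // Re_cintegral; apply: le_Rintegral => //.
- exact: (cintegrableZ ((conjc z)) fi).1.
- by have := integrableZl measurableT (cnorm z) (cintegrable_cnorm fi).
- move=> x _; rewrite -(cnorm_conj z) -cnormM.
  exact: le_trans (ler_norm _) (Re_le_cnorm _).
Qed.

Lemma cintegral_mkcond (D : set T) f : measurable D ->
  cintegral mu D f = cintegral mu setT (fun x => (\1_D x)%:C * f x).
Proof.
move=> mD; rewrite /cintegral; congr (fine _ +i* fine _).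
- rewrite integral_mkcond; apply: eq_integral => x _.
  by rewrite ReM /= mul0r subr0 /patch indicE; case: ifPn => xD; rewrite ?mul1r ?mul0r.
- rewrite integral_mkcond; apply: eq_integral => x _.
  by rewrite ImM /= mul0r addr0 /patch indicE; case: ifPn => xD; rewrite ?mul1r ?mul0r.
Qed.

Lemma cintegrableM_bounded (K : T -> R[i]) f (M : R) : cmeasurable K ->
  (forall x, cnorm (K x) <= M) -> cintegrable mu setT f ->
  cintegrable mu setT (fun x => K x * f x).
Proof.
move=> mK KM fi.
have hi := integrableZl measurableT M (cintegrable_cnorm fi).
apply: (le_cintegrable (h := fun x => M * cnorm (f x)) hi) => [|x].
- by apply: cmeasurableM => //; exact: cintegrable_cmeasurable fi.
- by rewrite cnormM ler_wpM2r ?cnorm_ge0.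
Qed.

End ComplexIntegral.

Section ComplexDominatedConvergence.
Context {d : measure_display} {T : measurableType d} {R : realType}.
Variable mu : {measure set T -> \bar R}.

Lemma Rintegral_dominated_cvg (f_ : (T -> R)^nat) (f h : T -> R) :
  (forall n, measurable_fun setT (f_ n)) -> measurable_fun setT f ->
  (\forall x \ae mu, f_ n x @[n --> \oo] --> f x) ->
  mu.-integrable setT (EFin \o h) -> (forall n x, `|f_ n x| <= h x) ->
  (\int[mu]_x f_ n x) @[n --> \oo] --> \int[mu]_x f x.
Proof.
move=> mf_ mf cf hi fh.
have [] := @dominated_convergence _ _ _ mu setT measurableT
  (fun n => EFin \o f_ n) (EFin \o f) (EFin \o h) _ _ _ hi _.
- by move=> n; exact/measurable_EFinP.
- exact/measurable_EFinP.
- by apply: filterS cf => x cfx _; apply: cvg_EFin; [exact: nearW|exact: cfx].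
- by apply: aeW => x n _ /=; rewrite lee_fin.
- move=> fi _; move=> cv; apply: fine_cvg; rewrite fineK ?integrable_fin_num //.
Qed.

End ComplexDominatedConvergence.

(** * Fubini for complex integrands and bounded kernels *)

Section ComplexFubini.
Context {d1 d2 : measure_display} {T1 : measurableType d1}
  {T2 : measurableType d2} {R : realType}.
Variables (m1 : {sigma_finite_measure set T1 -> \bar R})
  (m2 : {sigma_finite_measure set T2 -> \bar R}).

Lemma cmeasurable_fst (f : T1 -> R[i]) : cmeasurable f ->
  cmeasurable (fun z : T1 * T2 => f z.1).
Proof. by move=> [f1 f2]; split; [exact: (measurableT_comp f1 measurable_fst)|exact: (measurableT_comp f2 measurable_fst)]. Qed.

Lemma cmeasurable_snd (f : T2 -> R[i]) : cmeasurable f ->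
  cmeasurable (fun z : T1 * T2 => f z.2).
Proof. by move=> [f1 f2]; split; [exact: (measurableT_comp f1 measurable_snd)|exact: (measurableT_comp f2 measurable_snd)]. Qed.

(** Every slice, not only almost every one, is assumed integrable, because [cintegral] applies
    [fine] to each inner integral; [fineK] removes it before the extended-real theorem is used. *)
Lemma cintegral_fubini (F : T1 * T2 -> R[i]) :
  cintegrable (m1 \x m2)%E setT F ->
  (forall x, cintegrable m2 setT (fun y => F (x, y))) ->
  (forall y, cintegrable m1 setT (fun x => F (x, y))) ->
  cintegral m1 setT (fun x => cintegral m2 setT (fun y => F (x, y))) =
  cintegral m2 setT (fun y => cintegral m1 setT (fun x => F (x, y))).
Proof.
move=> [F1 F2] Fx Fy; rewrite /cintegral /=; congr (fine _ +i* fine _).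
- under eq_integral => x _ do rewrite fineK ?(integrable_fin_num _ (Fx x).1) //.
  under [RHS]eq_integral => y _ do rewrite fineK ?(integrable_fin_num _ (Fy y).1) //.
  exact: (Fubini F1).
- under eq_integral => x _ do rewrite fineK ?(integrable_fin_num _ (Fx x).2) //.
  under [RHS]eq_integral => y _ do rewrite fineK ?(integrable_fin_num _ (Fy y).2) //.
  exact: (Fubini F2).
Qed.

Lemma integrable_tensor (u : T1 -> R) (v : T2 -> R) :
  m1.-integrable setT (EFin \o u) -> m2.-integrable setT (EFin \o v) ->
  (m1 \x m2)%E.-integrable setT (fun z => (u z.1 * v z.2)%:E).
Proof.
move=> ui vi.
have mu1 : measurable_fun setT u by case/integrableP : ui => /measurable_EFinP.
have mv1 : measurable_fun setT v by case/integrableP : vi => /measurable_EFinP.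
have muv : measurable_fun setT (fun z : T1 * T2 => (u z.1 * v z.2)%:E).
  apply/measurable_EFinP/measurable_funM.
  - exact: measurableT_comp mu1 measurable_fst.
  - exact: measurableT_comp mv1 measurable_snd.
apply/integrable12ltyP => //=.
have E x : (\int[m2]_y `|u x * v y|%:E = `|u x|%:E * \int[m2]_y `|v y|%:E)%E.
  under eq_integral do rewrite normrM EFinM.
  by rewrite integralZl //; exact: integrable_abse vi.
under eq_integral do rewrite E.
rewrite -[(\int[m2]_y _)%E]fineK; last first.
  by apply: integrable_fin_num => //; exact: integrable_abse vi.
rewrite integralZr //; last exact: integrable_abse ui.
rewrite -[(\int[m1]_y _)%E]fineK; last first.
  by apply: integrable_fin_num => //; exact: integrable_abse ui.
by rewrite -EFinM ltry.
Qed.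

(** The positive and negative parts have measurable partial integrals by Tonelli, and both the
    difference in [integralE] and [fine] preserve measurability. Integrability plays no part, so the
    slices may diverge. *)
Lemma measurable_Rintegral_snd (F : T1 * T2 -> R) : measurable_fun setT F ->
  measurable_fun setT (fun y => \int[m1]_x F (x, y)).
Proof.
move=> mF; apply: measurableT_comp => //.
under eq_fun do rewrite integralE.
apply: emeasurable_funB.
- have mp : measurable_fun setT (fun z => (F z)%:E)^\+%E.
    by apply: measurable_funepos; exact/measurable_EFinP.
  have p0 z : (0 <= (fun z => (F z)%:E)^\+ z)%E by exact: funepos_ge0.
  apply: (eq_measurable_fun _ _ (measurable_fun_fubini_tonelli_G (m1 := m1) _ mp p0)).
  by move=> y _; apply: eq_integral => x _; rewrite !funeposE.
- have mn : measurable_fun setT (fun z => (F z)%:E)^\-%E.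
    by apply: measurable_funeneg; exact/measurable_EFinP.
  have n0 z : (0 <= (fun z => (F z)%:E)^\- z)%E by exact: funeneg_ge0.
  apply: (eq_measurable_fun _ _ (measurable_fun_fubini_tonelli_G (m1 := m1) _ mn n0)).
  by move=> y _; apply: eq_integral => x _; rewrite !funenegE.
Qed.

Lemma cmeasurable_cintegral_snd (F : T1 * T2 -> R[i]) : cmeasurable F ->
  cmeasurable (fun y => cintegral m1 setT (fun x => F (x, y))).
Proof. by move=> [F1 F2]; split; [exact: (measurable_Rintegral_snd F1)|exact: (measurable_Rintegral_snd F2)]. Qed.

Section kernel.
Variables (K : T1 * T2 -> R[i]) (u : T1 -> R[i]) (v : T2 -> R[i]) (M : R).
Hypotheses (mK : cmeasurable K) (KM : forall z, cnorm (K z) <= M).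
Hypotheses (ui : cintegrable m1 setT u) (vi : cintegrable m2 setT v).

Let mKu y : cmeasurable (fun x => K (x, y)).
Proof.
have m : measurable_fun setT (fun x : T1 => (x, y)) by exact: measurable_pair2.
by case: mK => K1 K2; split; [exact: (measurableT_comp K1 m)|exact: (measurableT_comp K2 m)].
Qed.

Let mKv x : cmeasurable (fun y => K (x, y)).
Proof.
have m : measurable_fun setT (fun y : T2 => (x, y)) by exact: measurable_pair1.
by case: mK => K1 K2; split; [exact: (measurableT_comp K1 m)|exact: (measurableT_comp K2 m)].
Qed.

Lemma cintegrable_kernel :
  cintegrable (m1 \x m2)%E setT (fun z => K z * (u z.1 * v z.2)).
Proof.
apply: (cintegrableM_bounded mK KM).
have hi := integrable_tensor (cintegrable_cnorm ui) (cintegrable_cnorm vi).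
apply: (le_cintegrable (h := fun z => cnorm (u z.1) * cnorm (v z.2)) hi).
- apply: cmeasurableM.
  + exact/cmeasurable_fst/(cintegrable_cmeasurable ui).
  + exact/cmeasurable_snd/(cintegrable_cmeasurable vi).
- by move=> z; rewrite cnormM.
Qed.

(** With a bounded kernel and integrable [u] and [v], all slices are integrable and the hypotheses
    of [cintegral_fubini] come for free. In the applications [K] is an oscillating exponential. *)
Lemma cintegral_kernel_fubini :
  cintegral m1 setT (fun x => u x * cintegral m2 setT (fun y => K (x, y) * v y)) =
  cintegral m2 setT (fun y => cintegral m1 setT (fun x => K (x, y) * u x) * v y).
Proof.
have iKv x : cintegrable m2 setT (fun y => K (x, y) * v y).
  by apply: (cintegrableM_bounded (mKv x)) => // y; exact: KM.
have iKu y : cintegrable m1 setT (fun x => K (x, y) * u x).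
  by apply: (cintegrableM_bounded (mKu y)) => // x; exact: KM.
transitivity (cintegral m1 setT (fun x =>
    cintegral m2 setT (fun y => K (x, y) * (u x * v y)))).
  apply: eq_cintegral => x; rewrite -cintegralZ //.
  by apply: eq_cintegral => y; ring.
rewrite (cintegral_fubini cintegrable_kernel) /=.
- apply: eq_cintegral => y; rewrite mulrC -cintegralZ //.
  by apply: eq_cintegral => x; ring.
- move=> x; have := cintegrableZ (u x) (iKv x).
  by congr cintegrable; apply/funext => y; ring.
- move=> y; have := cintegrableZ (v y) (iKu y).
  by congr cintegrable; apply/funext => x; ring.
Qed.

End kernel.

End ComplexFubini.

(** * The Hilbert space of square-integrable functions *)

Section L2Space.
Context {d : measure_display} {T : measurableType d} {R : realType}.
Variable mu : {measure set T -> \bar R}.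
Implicit Types (u v w : L2 mu) (f g : T -> R[i]).

Lemma L2fun_sq u : sq_integrable mu (L2fun u).
Proof. by rewrite /L2fun; case: (repr u) => f /= /asboolP. Qed.

Lemma cmeasurable_L2fun u : cmeasurable (L2fun u).
Proof. by have [] := L2fun_sq u. Qed.

Lemma toL2E f : sq_integrable mu f -> \forall x \ae mu, L2fun (toL2 mu f) x = f x.
Proof.
move=> sf; rewrite /toL2 /L2fun.
have E : val (insubd (0 : Lfun2 mu) f) = f by rewrite insubdK //; apply/asboolP.
by apply: filterS (L2_eq_repr (insubd (0 : Lfun2 mu) f)) => x; rewrite E.
Qed.

Lemma L2fun_inj u v : (\forall x \ae mu, L2fun u x = L2fun v x) -> u = v.
Proof. by move=> uv; rewrite -[u]reprK -[v]reprK; exact: L2_piE. Qed.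

Lemma ae_eq_trans f g h : (\forall x \ae mu, f x = g x) ->
  (\forall x \ae mu, g x = h x) -> \forall x \ae mu, f x = h x :> R[i].
Proof. by move=> fg gh; apply: filterS2 fg gh => x -> ->. Qed.

Lemma ae_eq_sym f g : (\forall x \ae mu, f x = g x) ->
  \forall x \ae mu, g x = f x.
Proof. by apply: filterS => x ->. Qed.

Lemma eq_toL2 f g : sq_integrable mu f -> sq_integrable mu g ->
  (\forall x \ae mu, f x = g x) -> toL2 mu f = toL2 mu g.
Proof.
move=> sf sg fg; apply: L2fun_inj.
apply: ae_eq_trans (toL2E sf) _; apply: ae_eq_trans fg _.
exact/ae_eq_sym/toL2E.
Qed.

Lemma integral_abs2_ae f g : cmeasurable f -> cmeasurable g ->
  (\forall x \ae mu, f x = g x) ->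
  (\int[mu]_x (abs2 (f x))%:E = \int[mu]_x (abs2 (g x))%:E)%E.
Proof.
move=> mf mg fg; apply: ge0_ae_eq_integral => //.
- exact/measurable_EFinP/measurable_fun_abs2.
- exact/measurable_EFinP/measurable_fun_abs2.
- by move=> x _; rewrite lee_fin abs2_ge0.
- by move=> x _; rewrite lee_fin abs2_ge0.
- by apply: filterS fg => x -> _.
Qed.

Lemma le_sq_integrable f g (M : R) : cmeasurable f ->
  (forall x, cnorm (f x) <= M * cnorm (g x)) ->
  sq_integrable mu g -> sq_integrable mu f.
Proof.
move=> mf fg [mg gi]; split => //.
apply: (@le_lt_trans _ _ ((M ^+ 2)%:E * \int[mu]_x (abs2 (g x))%:E)%E).
  rewrite -ge0_integralZl_EFin //; last 3 first.
  - by move=> x _; rewrite lee_fin abs2_ge0.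
  - exact/measurable_EFinP/measurable_fun_abs2.
  - exact: sqr_ge0.
  apply: ge0_le_integral => //.
  - by move=> x _; rewrite lee_fin abs2_ge0.
  - exact/measurable_EFinP/measurable_fun_abs2.
  - by apply: measurable_funeM; exact/measurable_EFinP/measurable_fun_abs2.
  - move=> x _; rewrite -EFinM lee_fin -!sqr_cnorm -exprMn.
    by rewrite lerXn2r ?nnegrE ?cnorm_ge0 // (le_trans (cnorm_ge0 _) (fg x)).
by rewrite lte_mul_pinfty // lee_fin sqr_ge0.
Qed.

Lemma sq_integrableD f g : sq_integrable mu f -> sq_integrable mu g ->
  sq_integrable mu (fun x => f x + g x).
Proof.
move=> /asboolP sf /asboolP sg.
have [_ /(_ 1 f g sf sg)/asboolP] := sq_int_submod_closed mu.
rewrite scale1r; congr sq_integrable; exact/funext.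
Qed.

Lemma sq_integrableM_bounded (K : T -> R[i]) f (M : R) : cmeasurable K ->
  (forall x, cnorm (K x) <= M) -> sq_integrable mu f ->
  sq_integrable mu (fun x => K x * f x).
Proof.
move=> mK KM sf; apply: (le_sq_integrable (M := M)) (sf) => [|x].
  by apply: cmeasurableM => //; case: sf.
by rewrite cnormM ler_wpM2r ?cnorm_ge0.
Qed.

Lemma sq_integrableZ (c : R[i]) f : sq_integrable mu f ->
  sq_integrable mu (fun x => c * f x).
Proof.
by apply: (sq_integrableM_bounded (M := cnorm c)) => //; exact: cmeasurable_cst.
Qed.

Lemma integrable_abs2 f : sq_integrable mu f ->
  mu.-integrable setT (EFin \o (fun x => abs2 (f x))).
Proof.
move=> [mf fi]; apply: integrable_ge0P => //; first by move=> x; exact: abs2_ge0.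
exact: measurable_fun_abs2.
Qed.

Lemma sq_integrable_mul f g : sq_integrable mu f -> sq_integrable mu g ->
  cintegrable mu setT (fun x => f x * g x).
Proof.
move=> sf sg.
have hi := integrableD measurableT (integrable_abs2 sf) (integrable_abs2 sg).
apply: (le_cintegrable (h := fun x => abs2 (f x) + abs2 (g x)) hi).
  by apply: cmeasurableM; [case: sf|case: sg].
move=> x; rewrite cnormM -!sqr_cnorm.
have := sqr_ge0 (cnorm (f x) - cnorm (g x)).
have := mulr_ge0 (cnorm_ge0 (f x)) (cnorm_ge0 (g x)).
nra.
Qed.

Lemma sq_integrable_conj f : sq_integrable mu f ->
  sq_integrable mu (fun x => (conjc (f x))).
Proof.
move=> sf; apply: (le_sq_integrable (M := 1)) (sf) => [|x].
  by apply: cmeasurable_conj; case: sf.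
by rewrite cnorm_conj mul1r.
Qed.

Lemma sq_integrable_inner f g : sq_integrable mu f -> sq_integrable mu g ->
  cintegrable mu setT (fun x => conjc (f x) * g x).
Proof. by move=> sf sg; apply: sq_integrable_mul => //; exact: sq_integrable_conj. Qed.

(** [L2fun] is an arbitrary representative of a class; this allows an inner product to be computed
    with any measurable representatives. *)
Lemma L2fun_ae u v f g : (\forall x \ae mu, L2fun u x = f x) ->
  (\forall x \ae mu, L2fun v x = g x) -> cmeasurable f -> cmeasurable g ->
  inner u v = cintegral mu setT (fun x => conjc (f x) * g x).
Proof.
move=> uf vg mf mg; apply: ae_eq_cintegral.
- by apply: cmeasurableM; [apply: cmeasurable_conj|]; exact: cmeasurable_L2fun.
- by apply: cmeasurableM => //; exact: cmeasurable_conj.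
- by apply: filterS2 uf vg => x -> ->.
Qed.

Lemma L2funZD (a : R[i]) u v :
  \forall x \ae mu, L2fun (a *: u + v) x = a * L2fun u x + L2fun v x.
Proof.
have := L2_eq_repr (a *: repr u + repr v).
rewrite -L2_addE -L2_scale_pi !reprK; apply: filterS => x.
rewrite /L2fun -[X in _ = X]/((a \*: val (repr u) + val (repr v)) x).
by [].
Qed.

Lemma L2funD u v : \forall x \ae mu, L2fun (u + v) x = L2fun u x + L2fun v x.
Proof. by have := L2funZD 1 u v; rewrite scale1r; apply: filterS => x; rewrite mul1r. Qed.

Lemma L2fun0 : \forall x \ae mu, L2fun (0 : L2 mu) x = 0.
Proof.
have := L2funZD (-1) 0 0; rewrite scaler0 addr0; apply: filterS => x ->.
by rewrite mulN1r addNr.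
Qed.

Lemma L2funZ (a : R[i]) u : \forall x \ae mu, L2fun (a *: u) x = a * L2fun u x.
Proof.
by have := L2funZD a u 0; rewrite addr0; apply: filterS2 L2fun0 => x -> ->; rewrite addr0.
Qed.

Lemma L2funN u : \forall x \ae mu, L2fun (- u) x = - L2fun u x.
Proof. by have := L2funZ (-1) u; rewrite scaleN1r; apply: filterS => x ->; rewrite mulN1r. Qed.

Lemma L2funB u v : \forall x \ae mu, L2fun (u - v) x = L2fun u x - L2fun v x.
Proof. by have := L2funD u (- v); apply: filterS2 (L2funN v) => x -> ->. Qed.

Lemma innerP (a : R[i]) u v w : inner u (a *: v + w) = a * inner u v + inner u w.
Proof.
have iv x := sq_integrable_inner (L2fun_sq u) (L2fun_sq x).
rewrite /inner -cintegralZ // -cintegralD //; last exact: cintegrableZ.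
apply: ae_eq_cintegral.
- by apply: cmeasurableM; [apply: cmeasurable_conj|]; exact: cmeasurable_L2fun.
- by apply: cintegrable_cmeasurable; apply: cintegrableD (iv w); exact: cintegrableZ.
- by apply: filterS (L2funZD a v w) => x ->; ring.
Qed.

Lemma innerC u v : inner v u = conjc (inner u v).
Proof.
rewrite /inner -cintegral_conj; last exact/sq_integrable_inner/L2fun_sq/L2fun_sq.
by apply: eq_cintegral => x; rewrite conjcM conjcK mulrC.
Qed.

Lemma innerDr u v w : inner u (v + w) = inner u v + inner u w.
Proof. by have := innerP 1 u v w; rewrite scale1r mul1r. Qed.

Lemma inner0r u : inner u 0 = 0.
Proof. by have := innerP (-1) u 0 0; rewrite scaler0 addr0 mulN1r addNr. Qed.

Lemma innerZr (a : R[i]) u v : inner u (a *: v) = a * inner u v.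
Proof. by have := innerP a u v 0; rewrite inner0r !addr0. Qed.

Lemma innerNr u v : inner u (- v) = - inner u v.
Proof. by rewrite -scaleN1r innerZr mulN1r. Qed.

Lemma innerBr u v w : inner u (v - w) = inner u v - inner u w.
Proof. by rewrite innerDr innerNr. Qed.

Lemma innerDl u v w : inner (v + w) u = inner v u + inner w u.
Proof. by rewrite innerC innerDr conjcD -!innerC. Qed.

Lemma innerZl (a : R[i]) u v : inner (a *: v) u = conjc a * inner v u.
Proof. by rewrite innerC innerZr conjcM -innerC. Qed.

Lemma innerNl u v : inner (- v) u = - inner v u.
Proof. by rewrite innerC innerNr conjcN -innerC. Qed.

Lemma innerBl u v w : inner (v - w) u = inner v u - inner w u.
Proof. by rewrite innerDl innerNl. Qed.

Lemma inner0l u : inner 0 u = 0.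
Proof. by rewrite innerC inner0r conjc0. Qed.

Lemma inner_suml (I : Type) (r : seq I) (P : pred I) (F : I -> L2 mu) u :
  inner (\sum_(i <- r | P i) F i) u = \sum_(i <- r | P i) inner (F i) u.
Proof.
by elim/big_rec2: _ => [|i y x _ <-]; rewrite ?inner0l // innerDl.
Qed.

Lemma inner_sumr (I : Type) (r : seq I) (P : pred I) (F : I -> L2 mu) u :
  inner u (\sum_(i <- r | P i) F i) = \sum_(i <- r | P i) inner u (F i).
Proof.
by elim/big_rec2: _ => [|i y x _ <-]; rewrite ?inner0r // innerDr.
Qed.

Lemma norm2_ge0 u : 0 <= norm2 u.
Proof. exact: sqrtr_ge0. Qed.

Lemma sqr_norm2 u : norm2 u ^+ 2 = \int[mu]_x abs2 (L2fun u x).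
Proof.
rewrite sqr_sqrtr // fine_ge0 //.
by apply: integral_ge0 => x _; rewrite lee_fin abs2_ge0.
Qed.

Lemma EFin_sqr_norm2 u : ((norm2 u ^+ 2)%:E = \int[mu]_x (abs2 (L2fun u x))%:E)%E.
Proof.
rewrite sqr_norm2 fineK // integrable_fin_num //.
exact: integrable_abs2 (L2fun_sq u).
Qed.

Lemma inner_norm2 u : inner u u = (norm2 u ^+ 2)%:C.
Proof.
rewrite sqr_norm2 -cintegral_real.
by apply: eq_cintegral => x; rewrite mul_conj_abs2.
Qed.

Lemma norm2_toL2 f : sq_integrable mu f ->
  ((norm2 (toL2 mu f) ^+ 2)%:E = \int[mu]_x (abs2 (f x))%:E)%E.
Proof.
move=> sf; rewrite EFin_sqr_norm2; apply: integral_abs2_ae; last exact: toL2E.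
- exact: cmeasurable_L2fun.
- by case: sf.
Qed.

Lemma norm2_0 : norm2 (0 : L2 mu) = 0.
Proof.
by apply/eqP; rewrite -sqrf_eq0; apply/eqP/(@complexI R); rewrite -inner_norm2 inner0r.
Qed.

Lemma norm2_eq0 u : norm2 u = 0 -> u = 0.
Proof.
move=> u0; apply: L2fun_inj.
have /ae_eq_integral_abs : (\int[mu]_x `|(abs2 (L2fun u x))%:E| = 0)%E.
  under eq_integral do rewrite gee0_abs ?lee_fin ?abs2_ge0 //.
  by rewrite -EFin_sqr_norm2 u0 expr0n.
move=> /(_ measurableT) H; have {H} : ae_eq mu setT (fun x => (abs2 (L2fun u x))%:E) (cst 0%E).
  apply: H; exact/measurable_EFinP/measurable_fun_abs2/cmeasurable_L2fun.
by apply: filterS2 L2fun0 => x -> /(_ I) []; exact: abs2_eq0.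
Qed.

Lemma norm2Z (a : R[i]) u : norm2 (a *: u) = cnorm a * norm2 u.
Proof.
apply/eqP; rewrite -(@eqrXn2 _ 2) ?mulr_ge0 ?norm2_ge0 ?cnorm_ge0 //.
apply/eqP/(@complexI R); rewrite -inner_norm2 innerZl innerZr inner_norm2.
by rewrite mulrA mul_conj_abs2 -rmorphM exprMn sqr_cnorm.
Qed.

Lemma norm2N u : norm2 (- u) = norm2 u.
Proof.
by rewrite -scaleN1r norm2Z cnormN -[1]/(1%:C) cnorm_real normr1 mul1r.
Qed.

Lemma norm2BC u v : norm2 (u - v) = norm2 (v - u).
Proof. by rewrite -norm2N opprB. Qed.

Lemma sqr_norm2D u v :
  norm2 (u + v) ^+ 2 = norm2 u ^+ 2 + 2 * Rez (inner u v) + norm2 v ^+ 2.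
Proof.
have -> : norm2 (u + v) ^+ 2 = Rez (inner (u + v) (u + v)) by rewrite inner_norm2.
rewrite innerDl !innerDr !inner_norm2 (innerC u v) !ReD Re_conj /=; ring.
Qed.

Lemma sqr_norm2B u v :
  norm2 (u - v) ^+ 2 = norm2 u ^+ 2 - 2 * Rez (inner u v) + norm2 v ^+ 2.
Proof. by rewrite sqr_norm2D innerNr ReN norm2N; ring. Qed.

(* Expand [|v|u|^2 - <v,u> v|^2]. *)
Lemma cauchy_schwarz u v : cnorm (inner u v) <= norm2 u * norm2 v.
Proof.
have [v0|v0] := eqVneq (norm2 v) 0.
  by rewrite (norm2_eq0 v0) inner0r cnorm0 norm2_0 mulr0.
have vp : 0 < norm2 v by rewrite lt_neqAle eq_sym v0 norm2_ge0.
rewrite -(@ler_pXn2r _ 2) ?nnegrE ?mulr_ge0 ?norm2_ge0 ?cnorm_ge0 //.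
have := sqr_ge0 (norm2 ((norm2 v ^+ 2)%:C *: u - (inner v u) *: v)).
rewrite sqr_norm2B !norm2Z innerZl innerZr. rewrite conj_real (innerC v u).
rewrite cnorm_real ger0_norm ?sqr_ge0 // (mulrC (inner v u)) mul_conj_abs2.
rewrite cnorm_conj ReM [Rez _%:C]/= [Rez _%:C]/= [Imz _%:C]/= mul0r subr0 -sqr_cnorm.
set a := cnorm _; set b := norm2 u; set c := norm2 v => h.
rewrite -subr_ge0 -(@pmulr_rge0 _ (c ^+ 2)) ?exprn_gt0 //.
by apply: le_trans h _; rewrite le_eqVlt; apply/orP; left; apply/eqP; ring.
Qed.

Lemma Re_inner_le u v : Rez (inner u v) <= norm2 u * norm2 v.
Proof.
apply: le_trans (cauchy_schwarz u v).
exact: le_trans (ler_norm _) (Re_le_cnorm _).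
Qed.

Lemma norm2D u v : norm2 (u + v) <= norm2 u + norm2 v.
Proof.
rewrite -(@ler_pXn2r _ 2) ?nnegrE ?addr_ge0 ?norm2_ge0 // sqr_norm2D sqrrD.
by rewrite lerD2r lerD2l mulr_natl lerMn2r Re_inner_le.
Qed.

Lemma norm2_dist u v w : norm2 (u - w) <= norm2 (u - v) + norm2 (v - w).
Proof. by rewrite -[u - w](subrKA v) norm2D. Qed.

Lemma norm2_lipschitz u v : `|norm2 u - norm2 v| <= norm2 (u - v).
Proof.
rewrite ler_distl; apply/andP; split.
- by rewrite lerBlDr -{1}(subrK u v) -(norm2BC v u) addrC norm2D.
- by rewrite -{1}(subrK v u) addrC norm2D.
Qed.

Lemma inner_ext v w : (forall u, inner u v = inner u w) -> v = w.
Proof.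
move=> vw; apply/eqP; rewrite -subr_eq0; apply/eqP/norm2_eq0/eqP.
by rewrite -sqrf_eq0; apply/eqP/(@complexI R); rewrite -inner_norm2 innerBr vw subrr.
Qed.

Definition imu : R[i] := (0 +i* 1)%C.

Lemma conjc_imu : conjc imu = - imu.
Proof. by apply/eqP; rewrite eq_complex /= oppr0 !eqxx. Qed.

Lemma imu_sqr : imu * imu = -1.
Proof.
by apply/eqP; rewrite eq_complex; apply/andP; split; apply/eqP; rewrite /imu /=; ring.
Qed.

Lemma cnorm_imu : cnorm imu = 1.
Proof. by rewrite /cnorm /abs2 /= expr0n expr1n add0r sqrtr1. Qed.

Section polarization.
Variable T' : {linear L2 mu -> L2 mu}.

Lemma polarization u v : let q w := inner w (T' w) in
  4 * inner u (T' v) = q (u + v) - q (u - v)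
    - imu * (q (u + imu *: v) - q (u - imu *: v)).
Proof.
rewrite /= !linearD !linearN !linearZ /=.
rewrite !(innerDl, innerDr, innerNl, innerNr, innerZl, innerZr, conjc_imu).
(* What remains is polynomial in the four entries and the unit, and uses only that the unit squares
   to -1. *)
move: (inner u (T' u)) (inner u (T' v)) (inner v (T' u)) (inner v (T' v)).
have := imu_sqr; move: imu => i ii a b c e.
by ring: ii.
Qed.

(** Polarization and the parallelogram law turn the bound on the diagonal into one on all matrix
    entries. No symmetry of [T'] is assumed, whence the factor 2. *)
Lemma quadratic_form_bound (e : R) :
  (forall u, cnorm (inner u (T' u)) <= e * norm2 u ^+ 2) ->
  forall v, norm2 (T' v) <= 2 * e * norm2 v.
Proof.
move=> qe v.
have e0 : norm2 v != 0 -> 0 <= e.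
  move=> v0; rewrite -(@pmulr_lge0 _ (norm2 v ^+ 2)).
    exact: le_trans (cnorm_ge0 _) (qe v).
  by rewrite exprn_gt0 // lt_neqAle eq_sym v0 norm2_ge0.
have [v0|v0] := eqVneq (norm2 v) 0.
  by rewrite (norm2_eq0 v0) linear0 norm2_0 mulr0.
have {}e0 := e0 v0; have vp : 0 < norm2 v by rewrite lt_neqAle eq_sym v0 norm2_ge0.
have [T0|T0] := eqVneq (norm2 (T' v)) 0.
  by rewrite T0 !mulr_ge0 // norm2_ge0.
have Tp : 0 < norm2 (T' v) by rewrite lt_neqAle eq_sym T0 norm2_ge0.
have B u : cnorm (inner u (T' v)) <= e * (norm2 u ^+ 2 + norm2 v ^+ 2).
  have H : cnorm (4 * inner u (T' v)) <= e * norm2 (u + v) ^+ 2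
      + e * norm2 (u - v) ^+ 2 + (e * norm2 (u + imu *: v) ^+ 2
      + e * norm2 (u - imu *: v) ^+ 2).
    rewrite polarization; apply: le_trans (cnormD _ _) _.
    rewrite cnormN cnormM cnorm_imu mul1r.
    by apply: lerD; (apply: le_trans (cnormD _ _) _); rewrite cnormN lerD.
  move: H; rewrite cnormM (sqr_norm2D u v) (sqr_norm2B u v).
  rewrite (sqr_norm2D u (imu *: v)) (sqr_norm2B u (imu *: v)).
  rewrite norm2Z cnorm_imu mul1r.
  have -> : cnorm (4 : R[i]) = 4.
    by rewrite -(rmorph_nat (real_complex R)) cnorm_real ger0_norm.
  lra.
(* Testing [B] with the multiple of [T' v] that has the norm of [v] balances its two squares. *)
set c := norm2 v / norm2 (T' v).
have := B (c%:C *: T' v).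
rewrite innerZl conj_real inner_norm2 -rmorphM /= cnorm_real norm2Z cnorm_real.
have c0 : 0 <= c by rewrite divr_ge0 // ltW.
have T1 := norm2_ge0 (T' v).
rewrite !ger0_norm ?mulr_ge0 ?sqr_ge0 ?invr_ge0 ?(ltW vp) //.
have -> : c * norm2 (T' v) ^+ 2 = norm2 v * norm2 (T' v) by rewrite /c; field.
have -> : c * norm2 (T' v) = norm2 v by rewrite /c; field.
have -> : e * (norm2 v ^+ 2 + norm2 v ^+ 2) = norm2 v * (2 * e * norm2 v) by ring.
by rewrite ler_pM2l.
Qed.

End polarization.

(** Over complex scalars the diagonal determines the operator. The functional calculus is given only
    on the diagonal, so identities about [U t] are derived from this. *)
Lemma quadratic_form_ext (T1 T2 : {linear L2 mu -> L2 mu}) :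
  (forall u, inner u (T1 u) = inner u (T2 u)) -> T1 =1 T2.
Proof.
move=> T12 v; apply: inner_ext => u.
have four0 : (4 : R[i]) != 0 by rewrite pnatr_eq0.
by apply: (mulfI four0); rewrite !polarization !T12.
Qed.

End L2Space.

Section L2Isometries.
Context {d d' : measure_display} {T : measurableType d} {T' : measurableType d'}
  {R : realType}.
Variables (mu : {measure set T -> \bar R}) (nu : {measure set T' -> \bar R}).

Lemma Re_inner_polar d0 (T0 : measurableType d0) (m : {measure set T0 -> \bar R})
    (u v : L2 m) :
  Rez (inner u v) = (norm2 (u + v) ^+ 2 - norm2 u ^+ 2 - norm2 v ^+ 2) / 2.
Proof. by rewrite sqr_norm2D; field. Qed.

Lemma Im_inner_Re d0 (T0 : measurableType d0) (m : {measure set T0 -> \bar R})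
    (u v : L2 m) : Imz (inner u v) = Rez (inner (imu *: u) v).
Proof. by rewrite innerZl conjc_imu ReM ReN ImN /=; ring. Qed.

(** Norms determine the real part of an inner product, and the imaginary part is a real part after
    multiplying the first argument by the unit. *)
Lemma isometry_inner (V : L2 mu -> L2 nu) : linear V ->
  (forall u, norm2 (V u) = norm2 u) ->
  forall u v, inner (V u) (V v) = inner u v.
Proof.
move=> lV nV.
have VD u v : V (u + v) = V u + V v by have := lV 1 u v; rewrite !scale1r.
have V0 : V 0 = 0.
  by have := lV (-1) 0 0; rewrite scaler0 addr0 scaleN1r addNr.
have VZ a u : V (a *: u) = a *: V u by have := lV a u 0; rewrite !addr0 V0 addr0.
have VRe u v : Rez (inner (V u) (V v)) = Rez (inner u v).
  by rewrite !Re_inner_polar -VD !nV.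
move=> u v; rewrite [LHS]complexE_ReIm [RHS]complexE_ReIm.
by rewrite !Im_inner_Re -VZ !VRe.
Qed.

End L2Isometries.

(** * Limits in norm and limits of inner products *)

Section HilbertLimits.
Context {R : realType}.

Lemma cvg_cnormP (I : Type) (F : set_system I) {FF : Filter F} (z_ : I -> R[i])
    (z : R[i]) :
  (z_ t : R[i]^o) @[t --> F] --> (z : R[i]^o) <->
  cnorm (z_ t - z) @[t --> F] --> (0 : R).
Proof.
split=> h.
- apply/cvgrPdist_lt => e e0; have ec0 : (0 : R[i]) < e%:C by rewrite ltcR.
  have /cvgrPdist_lt/(_ _ ec0) := h; apply: filterS => t.
  have -> : `|(z : R[i]^o) - z_ t| = (cnorm (z - z_ t))%:C by exact: normcE_cnorm.
  by rewrite sub0r normrN ger0_norm ?cnorm_ge0 // ltcR -cnormN opprB.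
(* The order of [R[i]] is partial: a positive element is real, so the imaginary part [e']
   vanishes. *)
- apply/cvgrPdist_lt => -[e e']; rewrite ltcE /= => /andP[/eqP -> e0].
  have /cvgrPdist_lt/(_ _ e0) := h; apply: filterS => t.
  have -> : `|(z : R[i]^o) - z_ t| = (cnorm (z - z_ t))%:C by exact: normcE_cnorm.
  by rewrite sub0r normrN ger0_norm ?cnorm_ge0 // ltcR -cnormN opprB.
Qed.

Lemma squeeze0 (I : Type) (F : set_system I) {FF : Filter F} (f g : I -> R) :
  (forall t, 0 <= f t <= g t) ->
  g t @[t --> F] --> (0 : R) -> f t @[t --> F] --> (0 : R).
Proof.
move=> fg g0; apply: (@squeeze_cvgr _ _ _ _ (fun=> 0) g) => //; last exact: cvg_cst.
exact: nearW.
Qed.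

Lemma squeeze_dist (I : Type) (F : set_system I) {FF : Filter F} (f g : I -> R) (l : R) :
  (forall t, `|f t - l| <= g t) ->
  g t @[t --> F] --> (0 : R) -> f t @[t --> F] --> l.
Proof.
move=> fg g0; apply/cvgrPdist_lt => e e0; have /cvgrPdist_lt/(_ _ e0) := g0.
apply: filterS => t; rewrite sub0r normrN distrC; apply: le_lt_trans.
exact: le_trans (fg t) (ler_norm _).
Qed.

Context {d : measure_display} {T : measurableType d}.
Variable mu : {measure set T -> \bar R}.
Variables (I : Type) (F : set_system I).
Context {FF : ProperFilter F}.
Implicit Types (U V : I -> L2 mu) (u v : L2 mu).

Lemma cvg_norm2 U u : norm2 (U t - u) @[t --> F] --> (0 : R) ->
  norm2 (U t) @[t --> F] --> norm2 u.
Proof. by apply: squeeze_dist => t; exact: norm2_lipschitz. Qed.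

Lemma cvg_innerr U u v : norm2 (U t - u) @[t --> F] --> (0 : R) ->
  (inner v (U t) : R[i]^o) @[t --> F] --> (inner v u : R[i]^o).
Proof.
move=> h; apply/cvg_cnormP.
apply: (@squeeze0 _ _ _ _ (fun t => norm2 v * norm2 (U t - u))) => [t|].
  by rewrite cnorm_ge0 -innerBr cauchy_schwarz.
by rewrite -(mulr0 (norm2 v)); apply: cvgM _ h; exact: cvg_cst.
Qed.

Lemma norm2_lim_unique U u v : norm2 (U t - u) @[t --> F] --> (0 : R) ->
  norm2 (U t - v) @[t --> F] --> (0 : R) -> u = v.
Proof.
move=> hu hv; apply/eqP; rewrite -subr_eq0; apply/eqP/norm2_eq0.
have : norm2 (u - v) @[t --> F] --> (0 : R).
  apply: (@squeeze0 _ _ _ _ (fun t => norm2 (U t - u) + norm2 (U t - v))) => [t|].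
    by rewrite norm2_ge0 -(norm2BC u) norm2_dist.
  by rewrite -(addr0 0); exact: cvgD.
by move=> /(cvg_lim (@Rhausdorff R)) <-; apply/esym/cvg_lim; [exact: Rhausdorff|exact: cvg_cst].
Qed.

Lemma cvg_norm2_linear (a : R[i]) U V u v :
  norm2 (U t - u) @[t --> F] --> (0 : R) ->
  norm2 (V t - v) @[t --> F] --> (0 : R) ->
  norm2 (a *: U t + V t - (a *: u + v)) @[t --> F] --> (0 : R).
Proof.
move=> hu hv.
apply: (@squeeze0 _ _ _ _ (fun t => cnorm a * norm2 (U t - u) + norm2 (V t - v))) => [t|].
  rewrite norm2_ge0 -norm2Z scalerBr opprD addrACA; exact: norm2D.
have -> : (0 : R) = cnorm a * 0 + 0 by rewrite mulr0 addr0.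
apply: cvgD => //.
by apply: cvgM hu; exact: cvg_cst.
Qed.

End HilbertLimits.

(** * Completeness of L2 *)

Section Completeness.
Context {d : measure_display} {T : measurableType d} {R : realType}.
Variable mu : {measure set T -> \bar R}.

Lemma fatou_bound (f_ : nat -> T -> R) (f : T -> R) (B : \bar R) :
  (forall n, measurable_fun setT (f_ n)) -> measurable_fun setT f ->
  (forall n x, 0 <= f_ n x) -> (forall x, 0 <= f x) ->
  (\forall x \ae mu, f_ n x @[n --> \oo] --> f x) ->
  (\forall n \near \oo, (\int[mu]_x (f_ n x)%:E <= B)%E) ->
  (\int[mu]_x (f x)%:E <= B)%E.
Proof.
move=> mf_ mf f_0 f0 cf le.
have mE n : measurable_fun setT (EFin \o f_ n) by exact/measurable_EFinP.
have := fatou mu measurableT mE (fun n x _ => f_0 n x).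
have -> : (\int[mu]_x limn_einf (fun n => (EFin \o f_ n) x) = \int[mu]_x (f x)%:E)%E.
  apply: ge0_ae_eq_integral => //.
  - apply: measurableT_comp => //; apply: measurable_fun_limn_esup => n.
    exact: measurableT_comp (mE n).
  - exact/measurable_EFinP.
  - move=> x _; rewrite limn_einf_lim; apply: lime_ge; first exact: is_cvg_einfs.
    by apply: nearW => n; apply: le_ereal_inf_tmp => _ [m _ <-]; rewrite lee_fin.
  - by move=> x _; rewrite lee_fin.
  - apply: filterS cf => x cx _.
    have cE : (f_ n x)%:E @[n --> \oo] --> (f x)%:E by apply: cvg_EFin; [exact: nearW|exact: cx].
    by rewrite (cvg_limn_einf_sup cE).1.
move=> h; apply: le_trans h _.
have [N _ leN] := le.
rewrite limn_einf_lim; apply: lime_le; first exact: is_cvg_einfs.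
(* The index [maxn n N] belongs to the [n]-th tail, so it bounds the infimum, and lies beyond [N],
   where the bound [B] holds. *)
apply: nearW => n; apply: (le_trans _ (leN (maxn n N) _)); last exact: leq_maxr.
by apply: ereal_inf_lbound; exists (maxn n N) => //=; exact: leq_maxl.
Qed.

Lemma cvg_abs2 (z_ : nat -> R[i]) (z : R[i]) :
  Rez (z_ n) @[n --> \oo] --> Rez z -> Imz (z_ n) @[n --> \oo] --> Imz z ->
  abs2 (z_ n) @[n --> \oo] --> abs2 z.
Proof. by move=> h1 h2; rewrite /abs2; apply: cvgD; exact: cvgM. Qed.

(** Weighted by [4 ^+ j], the squared increments still have summable integrals, [4^j 16^-j = 4^-j].
    Their sum is therefore finite almost everywhere, where the increments are [O(2^-j)] and the
    sequence converges. *)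
Lemma ae_cvg_of_summable (v : nat -> T -> R[i]) :
  (forall j, cmeasurable (v j)) ->
  (forall j, (\int[mu]_x (abs2 (v j.+1 x - v j x))%:E <= ((16^-1) ^+ j)%:E)%E) ->
  \forall x \ae mu, cvgn (fun j => Rez (v j x)) /\ cvgn (fun j => Imz (v j x)).
Proof.
move=> mv dv; pose D j x := (4 ^+ j * abs2 (v j.+1 x - v j x))%:E.
have D0 j x : (0 <= D j x)%E by rewrite lee_fin mulr_ge0 ?exprn_ge0 ?abs2_ge0.
have mD j : measurable_fun setT (D j).
  apply/measurable_EFinP/measurable_funM => //.
  exact/measurable_fun_abs2/cmeasurableB.
have DI : (\int[mu]_x (\sum_(j <oo) D j x) < +oo)%E.
  rewrite integral_nneseries //.
  apply: (@le_lt_trans _ _ (\sum_(j <oo) ((4^-1) ^+ j)%:E)%E).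
    apply: lee_nneseries => [j *|j _]; first by apply: integral_ge0 => x _; exact: D0.
    rewrite /D; under eq_integral do rewrite EFinM.
    rewrite ge0_integralZl_EFin //; last 2 first.
    - by move=> x _; rewrite lee_fin abs2_ge0.
    - exact/measurable_EFinP/measurable_fun_abs2/cmeasurableB.
    apply: le_trans (lee_wpmul2l _ (dv j)) _; first by rewrite lee_fin exprn_ge0.
    by rewrite -EFinM lee_fin -exprMn le_eqVlt; apply/orP; left; apply/eqP;
      congr (_ ^+ _); field.
  have -> : (fun n => \sum_(0 <= i < n) ((4^-1 : R) ^+ i)%:E)%E =
    EFin \o series (geometric 1 (4^-1 : R)).
    apply/funext => n /=; rewrite /series /= sumEFin; congr EFin.
    by apply: eq_bigr => i _; rewrite mul1r.
  have c : series (geometric 1 (4^-1 : R)) @ \oo --> (1 * (1 - 4^-1)^-1 : R).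
    by apply: cvg_geometric_series; rewrite ger0_norm //; lra.
  have -> : limn (EFin \o series (geometric 1 (4^-1 : R))) = (1 * (1 - 4^-1)^-1)%:E.
    by apply: cvg_lim => //; apply: cvg_EFin; [exact: nearW|exact: c].
  exact: ltry.
have Dae : \forall x \ae mu, (\sum_(j <oo) D j x < +oo)%E.
  have := @integrable_ae _ _ _ mu setT measurableT (fun x => (\sum_(j <oo) D j x)%E).
  case=> [|N [mN N0 h]].
    apply/integrableP; split; first exact: ge0_emeasurable_sum.
    by under eq_integral do rewrite gee0_abs ?nneseries_ge0 //.
  exists N; split => // x /= h'; apply: h => /= /(_ I) h''; apply: h'.
  by rewrite -ge0_fin_numE ?nneseries_ge0.
apply: filterS Dae => x Dx.
have [C C0 DC] : exists2 C : R, 0 <= C & forall j, 4 ^+ j * abs2 (v j.+1 x - v j x) <= C.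
  have S0 : (0 <= \sum_(j <oo) D j x)%E by exact: nneseries_ge0.
  exists (fine (\sum_(j <oo) D j x)%E); first exact: fine_ge0.
  move=> j; rewrite -lee_fin fineK ?ge0_fin_numE //.
  apply: le_trans (nneseries_lim_ge j.+1 _) => //.
  by rewrite big_nat_recr //= leeDr // sume_ge0.
have dle j : cnorm (v j.+1 x - v j x) <= geometric (Num.sqrt C) (2^-1) j.
  rewrite -(@ler_pXn2r _ 2) ?nnegrE ?cnorm_ge0 ?mulr_ge0 ?sqrtr_ge0 ?exprn_ge0 //.
  rewrite sqr_cnorm exprMn sqr_sqrtr // -exprM mulnC exprM.
  have -> : (2^-1 : R) ^+ 2 = 4^-1 by field.
  by rewrite exprVn ler_pdivlMr ?exprn_gt0 // mulrC.
have gc : cvgn (series (geometric (Num.sqrt C) (2^-1 : R))).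
  by apply: is_cvg_geometric_series; rewrite ger0_norm //; lra.
have key (p : R[i] -> R) : (forall z w, p (z - w) = p z - p w) ->
    (forall z, `|p z| <= cnorm z) -> cvgn (fun j => p (v j x)).
  move=> pB ple.
  have sc : cvgn (series (fun j => p (v j.+1 x) - p (v j x))).
    apply: normed_cvg; apply: series_le_cvg gc => j //=.
    by rewrite -pB; exact: le_trans (ple _) (dle j).
  have -> : (fun j => p (v j x)) = (fun j => p (v 0%N x) +
      series (fun j => p (v j.+1 x) - p (v j x)) j).
    apply/funext => j; rewrite /series /= telescope_sumr //; ring.
  by apply: is_cvgD => //; exact: is_cvg_cst.
split; apply: key.
- by move=> z w; rewrite ReD ReN.
- exact: Re_le_cnorm.
- by move=> z w; rewrite ImD ImN.
- exact: Im_le_cnorm.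
Qed.

(** Riesz-Fischer: a fast subsequence converges almost everywhere, and Fatou carries the Cauchy
    bound of the whole sequence over to its limit. It provides the L2 limit that defines the Fourier
    transform. *)
Lemma L2_complete (u : nat -> L2 mu) :
  (forall e, 0 < e -> exists N, forall n m, (N <= n)%N -> (N <= m)%N ->
     norm2 (u n - u m) <= e) ->
  exists l, norm2 (u n - l) @[n --> \oo] --> (0 : R).
Proof.
move=> uC.
have e0 j : 0 < (4^-1 : R) ^+ j by rewrite exprn_gt0.
have [N NP] := choice (fun j => uC _ (e0 j)).
(* A sum instead of a maximum: [k] is increasing and [k j] is at least both [N j] and [j]. *)
pose k j := (\sum_(i < j.+1) N i + j)%N.
have kS j : (k j <= k j.+1)%N.
  by rewrite /k (big_ord_recr j.+1) /= -addnA leq_add // addnS ltnW // ltnS leq_addl.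
have kN j : (N j <= k j)%N by rewrite /k big_ord_recr /= -addnA addnCA leq_addr.
have kj j : (j <= k j)%N by rewrite leq_addl.
pose v j := L2fun (u (k j)).
have mv j : cmeasurable (v j) by exact: cmeasurable_L2fun.
have normB n m : (\int[mu]_x (abs2 (L2fun (u n) x - L2fun (u m) x))%:E =
    (norm2 (u n - u m) ^+ 2)%:E)%E.
  rewrite EFin_sqr_norm2; apply: integral_abs2_ae.
  - by apply: cmeasurableB; exact: cmeasurable_L2fun.
  - exact: cmeasurable_L2fun.
  - exact/ae_eq_sym/L2funB.
have [N0 [mN0 N00 hN0]] : \forall x \ae mu,
    cvgn (fun j => Rez (v j x)) /\ cvgn (fun j => Imz (v j x)).
  apply: ae_cvg_of_summable => // j; rewrite normB lee_fin.
  have -> : (16^-1 : R) = 4^-1 ^+ 2 by field.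
  rewrite -exprM mulnC exprM lerXn2r ?nnegrE ?norm2_ge0 ?(ltW (e0 j)) //.
  by apply: NP => //; exact: leq_trans (kN j) (kS j).
(* Set to 0 on the exceptional set, the sequence converges at every point, so the limit [g] is
   measurable. *)
pose w j x := (\1_(~` N0) x)%:C * v j x.
have mw j : cmeasurable (w j).
  by apply: cmeasurableM => //; apply: cmeasurable_indic; exact: measurableC.
have wc x : cvgn (fun j => Rez (w j x)) /\ cvgn (fun j => Imz (w j x)).
  rewrite /w indicE; case: (boolP (x \in ~` N0)) => xN.
    under eq_fun do rewrite mul1r; under [X in _ /\ cvgn X]eq_fun do rewrite mul1r.
    by move: xN; rewrite inE => xN; apply: contrapT => /hN0.
  under eq_fun do rewrite mul0r; under [X in _ /\ cvgn X]eq_fun do rewrite mul0r.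
  by split; exact: is_cvg_cst.
pose g x := (limn (fun j => Rez (w j x))) +i* (limn (fun j => Imz (w j x))).
have mg : cmeasurable g.
  split.
  - apply: (@measurable_fun_cvg _ _ _ setT (fun j x => Rez (w j x))) => [m|x _].
      exact: (mw m).1.
    exact: (wc x).1.
  - apply: (@measurable_fun_cvg _ _ _ setT (fun j x => Imz (w j x))) => [m|x _].
      exact: (mw m).2.
    exact: (wc x).2.
have vg : \forall x \ae mu, Rez (v j x) @[j --> \oo] --> Rez (g x) /\
    Imz (v j x) @[j --> \oo] --> Imz (g x).
  exists N0; split => // x /= hx; apply: contrapT => xN; apply: hx.
  have wv j : w j x = v j x by rewrite /w indicE mem_set // mul1r.
  have [c1 c2] := wc x; split.
  - by have := c1; under eq_fun do rewrite wv.
  - by have := c2; under eq_fun do rewrite wv.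
have bound e : 0 < e -> exists M, forall n, (M <= n)%N ->
    (\int[mu]_x (abs2 (g x - L2fun (u n) x))%:E <= (e ^+ 2)%:E)%E.
  move=> ep; have [M MP] := uC e ep; exists M => n Mn.
  apply: (@fatou_bound (fun j x => abs2 (v j x - L2fun (u n) x))).
  - by move=> j; apply/measurable_fun_abs2/cmeasurableB => //; exact: cmeasurable_L2fun.
  - by apply/measurable_fun_abs2/cmeasurableB => //; exact: cmeasurable_L2fun.
  - by move=> j x; exact: abs2_ge0.
  - by move=> x; exact: abs2_ge0.
  - apply: filterS vg => x [c1 c2]; apply: cvg_abs2.
    + under eq_fun do rewrite ReD ReN; rewrite ReD ReN.
      by apply: cvgB => //; exact: cvg_cst.
    + under eq_fun do rewrite ImD ImN; rewrite ImD ImN.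
      by apply: cvgB => //; exact: cvg_cst.
  - exists M => // j /= Mj; rewrite normB lee_fin lerXn2r ?nnegrE ?norm2_ge0 ?(ltW ep) //.
    by apply: MP => //; exact: leq_trans Mj (kj j).
have sg : sq_integrable mu g.
  have [M MP] := bound 1 ltac:(by []).
  have -> : g = (fun x => (g x - L2fun (u M) x) + L2fun (u M) x).
    by apply/funext => x; rewrite subrK.
  apply: sq_integrableD (L2fun_sq _); split.
    by apply: cmeasurableB => //; exact: cmeasurable_L2fun.
  exact: le_lt_trans (MP M (leqnn M)) (ltry _).
exists (toL2 mu g); apply/cvgrPdist_le => e ep.
have [M MP] := bound e ep; exists M => // n /= Mn.
rewrite sub0r normrN ger0_norm ?norm2_ge0 // norm2BC.
rewrite -(@ler_pXn2r _ 2) ?nnegrE ?norm2_ge0 ?(ltW ep) //.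
rewrite -lee_fin EFin_sqr_norm2; apply: le_trans (MP n Mn).
rewrite le_eqVlt; apply/orP; left; apply/eqP; apply: integral_abs2_ae.
- exact: cmeasurable_L2fun.
- by apply: cmeasurableB => //; exact: cmeasurable_L2fun.
- by apply: filterS2 (L2funB (toL2 mu g) (u n)) (toL2E sg) => x -> ->.
Qed.

End Completeness.

(** * Spectral calculus and the propagator *)

Section SpectralMeasure.
Context {R : realType}.
Notation leb := (@lebesgue_measure R).
Notation H := (L2 leb).
Variable E : set R -> {linear H -> H}.
Hypothesis EP : projection_valued_measure E.

Lemma pvm_setT u : E setT u = u. Proof. by case: EP. Qed.

Lemma pvm_setI A B u : measurable A -> measurable B -> E (A `&` B) u = E A (E B u).
Proof. by case: EP => _ + _ _; exact. Qed.

Lemma pvm_sym A u v : measurable A -> inner (E A u) v = inner u (E A v).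
Proof. by case: EP => _ _ + _; exact. Qed.

Lemma pvm_sigma (F : (set R)^nat) : (forall n, measurable (F n)) -> trivIset setT F ->
  forall u, norm2 (\sum_(i < n) E (F i) u - E (\bigcup_i F i) u)
    @[n --> \oo] --> (0 : R).
Proof. by case: EP => _ _ _ h; exact: h. Qed.

Lemma pvm_idem A u : measurable A -> E A (E A u) = E A u.
Proof. by move=> mA; rewrite -pvm_setI // setIid. Qed.

(** In the constant sequence of empty sets, consecutive partial sums differ by [E set0 u] and have
    the same limit. *)
Lemma pvm_set0 u : E set0 u = 0.
Proof.
have h := pvm_sigma (fun=> measurable0) (@trivIset_set0 _ _ setT) u.
rewrite bigcup0 // in h.
have h1 : norm2 (\sum_(i < n.+1) E set0 u - E set0 u) @[n --> \oo] --> (0 : R).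
  by rewrite (cvg_shiftS (fun n => norm2 (\sum_(i < n) E set0 u - E set0 u))).
have h2 : norm2 (-1 *: (\sum_(i < n) E set0 u) + \sum_(i < n.+1) E set0 u
    - (-1 *: E set0 u + E set0 u)) @[n --> \oo] --> (0 : R).
  by apply: cvg_norm2_linear.
apply: norm2_eq0; apply: (@cvg_unique _ (@Rhausdorff R) _ _ _ _ _ h2).
apply: cvg_near_cst; apply: nearW => n.
by rewrite big_ord_recr /= !scaleN1r addKr addNr subr0.
Qed.

Lemma sqr_norm2_pvm A u : measurable A -> (norm2 (E A u) ^+ 2)%:C = inner u (E A u).
Proof. by move=> mA; rewrite -inner_norm2 pvm_sym // pvm_idem. Qed.

(** Pythagoras: projections on disjoint sets have orthogonal ranges. *)
Lemma sqr_norm2_pvm_sum (F : nat -> set R) u n : (forall n, measurable (F n)) ->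
  trivIset setT F ->
  norm2 (\sum_(i < n) E (F i) u) ^+ 2 = \sum_(i < n) norm2 (E (F i) u) ^+ 2.
Proof.
move=> mF tF; apply: (@complexI R); rewrite -inner_norm2 rmorph_sum /= inner_suml.
apply: eq_bigr => i _; rewrite inner_sumr (bigD1 i) //= big1 ?addr0 ?inner_norm2 //.
move=> j ji; rewrite pvm_sym // -pvm_setI //.
have -> : F i `&` F j = set0.
  move/trivIsetP : tF => /(_ i j I I); apply.
  by apply: contra_neq ji => ij; apply/val_inj.
by rewrite pvm_set0 inner0r.
Qed.

(** The same function as [spectral_dist]. It carries the hypothesis on [E] as an argument because
    the measure structure attached to it depends on that hypothesis. *)
Definition pvm_measure of projection_valued_measure E := fun u => spectral_dist E u.

Let m_ := pvm_measure EP.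

Let m0 u : m_ u set0 = 0%E.
Proof. by rewrite /m_ /pvm_measure /spectral_dist pvm_set0 norm2_0 expr0n. Qed.

Let m_ge0 u A : (0 <= m_ u A)%E.
Proof. by rewrite lee_fin sqr_ge0. Qed.

Let m_sigma u : semi_sigma_additive (m_ u).
Proof.
move=> F mF tF mUF; rewrite /m_ /pvm_measure /spectral_dist.
have h : norm2 (\sum_(i < n) E (F i) u) @[n --> \oo] --> norm2 (E (\bigcup_i F i) u).
  by apply: cvg_norm2; exact: pvm_sigma.
have h2 : norm2 (\sum_(i < n) E (F i) u) ^+ 2 @[n --> \oo] -->
    norm2 (E (\bigcup_i F i) u) ^+ 2 by under eq_fun do rewrite expr2; exact: cvgM.
have -> : (fun n => \sum_(0 <= i < n) (norm2 (E (F i) u) ^+ 2)%:E)%E =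
    EFin \o (fun n => norm2 (\sum_(i < n) E (F i) u) ^+ 2).
  by apply/funext => n /=; rewrite (sqr_norm2_pvm_sum u n mF tF) big_mkord sumEFin.
by apply: cvg_EFin; [exact: nearW|exact: h2].
Qed.

HB.instance Definition _ u := isMeasure.Build _ _ _ (m_ u) (m0 u) (m_ge0 u) (@m_sigma u).

Lemma pvm_measureT u : m_ u setT = (norm2 u ^+ 2)%:E.
Proof. by rewrite /m_ /pvm_measure /spectral_dist pvm_setT. Qed.

Let m_fin u : fin_num_fun (m_ u).
Proof. by move=> A mA; rewrite /m_ /pvm_measure /spectral_dist. Qed.

HB.instance Definition _ u := Measure_isFinite.Build _ _ _ (m_ u) (m_fin u).

Lemma pvm_measure_restr A B u : measurable A -> measurable B ->
  m_ (E B u) A = m_ u (A `&` B).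
Proof. by move=> mA mB; rewrite /m_ /pvm_measure /spectral_dist -pvm_setI. Qed.

Lemma pvm_measure_add A B u : measurable A -> measurable B ->
  (m_ (E B u) A + m_ (E (~` B) u) A = m_ u A)%E.
Proof.
move=> mA mB; have mC := measurableC mB.
rewrite !pvm_measure_restr // -measureU; try exact: measurableI.
- by rewrite -setIUr setUv setIT.
- by rewrite setIACA setICr setI0.
Qed.

Section bounded_function.
Variables (g : R -> R[i]) (M : R).
Hypotheses (mg : cmeasurable g) (gM : forall l, cnorm (g l) <= M).

Lemma pvm_cintegrable u : cintegrable (m_ u) setT g.
Proof.
have hi : (m_ u).-integrable setT (EFin \o cst M).
  exact: finite_measure_integrable_cst.
exact: (le_cintegrable (h := cst M) hi).
Qed.

Lemma pvm_cintegral_add B u : measurable B ->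
  cintegral (m_ (E B u)) setT g + cintegral (m_ (E (~` B) u)) setT g =
  cintegral (m_ u) setT g.
Proof.
move=> mB.
have addE (h : R -> R) : (m_ (E B u)).-integrable setT (EFin \o h) ->
    (m_ (E (~` B) u)).-integrable setT (EFin \o h) ->
    fine (\int[m_ (E B u)]_x (h x)%:E) + fine (\int[m_ (E (~` B) u)]_x (h x)%:E) =
    fine (\int[m_ u]_x (h x)%:E).
  move=> h1 h2; rewrite -fineD ?integrable_fin_num // -integral_measure_add //.
  congr fine; apply: eq_measure_integral => A mA _.
  rewrite -[LHS]/(measure_add (m_ (E B u)) (m_ (E (~` B) u)) A) measure_addE.
  exact: pvm_measure_add.
have [a1 a2] := pvm_cintegrable (E B u).
have [b1 b2] := pvm_cintegrable (E (~` B) u).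
by apply/eqP; rewrite eq_complex /=; apply/andP; split; apply/eqP; exact: addE.
Qed.

Lemma pvm_cintegral_cell B u (c : R[i]) (e : R) : measurable B -> 0 <= e ->
  (forall l, B l -> cnorm (g l - c) <= e) ->
  cnorm (cintegral (m_ (E B u)) setT g - c * (norm2 (E B u) ^+ 2)%:C)
    <= e * norm2 (E B u) ^+ 2.
Proof.
move=> mB e0 ge.
have ci z : cintegrable (m_ (E B u)) setT (fun=> z).
  have hi : (m_ (E B u)).-integrable setT (EFin \o cst (cnorm z)).
    exact: finite_measure_integrable_cst.
  by apply: (le_cintegrable (h := cst (cnorm z)) hi) => //; exact: cmeasurable_cst.
have gi := pvm_cintegrable (E B u).
have cE (z : R) : \int[m_ (E B u)]_x z = z * norm2 (E B u) ^+ 2.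
  rewrite Rintegral_cst //; congr (_ * _).
  exact: (congr1 fine (pvm_measureT (E B u))).
have -> : c * (norm2 (E B u) ^+ 2)%:C = cintegral (m_ (E B u)) setT (fun=> c).
  have -> : cintegral (m_ (E B u)) setT (fun=> c) =
    cintegral (m_ (E B u)) setT (fun=> c * (1 : R)%:C).
    by apply: eq_cintegral => x; rewrite mulr1.
  rewrite cintegralZ; last exact: (ci (1%:C)).
  by rewrite cintegral_real cE mul1r.
rewrite -cintegralB //.
have gci := cintegrableB gi (ci c).
apply: le_trans (cnorm_cintegral gci) _; rewrite -cE.
apply: fine_le.
- by apply: integrable_fin_num => //; exact: cintegrable_cnorm gci.
- by apply: integrable_fin_num => //; exact: finite_measure_integrable_cst.
apply: ae_ge0_le_integral => //.
- by move=> x _; rewrite lee_fin cnorm_ge0.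
- apply/measurable_EFinP/measurable_fun_cnorm/cmeasurableB => //.
(* The spectral measure of [E B u] gives no mass to the complement of [B], so the estimate is needed
   only on [B]. *)
exists (~` B); split; first exact: measurableC.
  transitivity (m_ u (~` B `&` B)).
    by apply: pvm_measure_restr => //; exact: measurableC.
  by rewrite setICl; exact: m0.
by move=> l /= h Bl; apply: h => _; rewrite lee_fin; exact: ge.
Qed.

Variable U : {linear H -> H}.
Hypothesis gU : is_function_of E g U.

Let gUm u : inner u (U u) = cintegral (m_ u) setT g.
Proof. exact: gU. Qed.

(* The forms of [U] and of [E(B) U E(B) + E(~B) U E(~B)] agree on the diagonal. *)
Lemma function_of_comm B u : measurable B -> E B (U u) = U (E B u).
Proof.
move=> mB; have mC := measurableC mB.
pose V : {linear H -> H} := (E B \o U \o E B) \+ (E (~` B) \o U \o E (~` B)).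
have UV : U =1 V.
  apply: quadratic_form_ext => w; rewrite /V /= innerDr -!pvm_sym // !gUm.
  by rewrite pvm_cintegral_add.
have E2 w : E B (E (~` B) w) = 0 by rewrite -pvm_setI // setICr pvm_set0.
have E3 w : E (~` B) (E B w) = 0 by rewrite -pvm_setI // setICl pvm_set0.
rewrite (UV u) (UV (E B u)) /V /= linearD /= !pvm_idem // E2 E3 linear0.
by rewrite linear0.
Qed.

(** Compressed by [E B] on both sides, [U - c] has a form of size at most [e], and
    [quadratic_form_bound] doubles this. On a vector [E B u] the compression is invisible because
    [U] commutes with [E B]. *)
Lemma function_of_cell B u (c : R[i]) (e : R) : measurable B -> 0 <= e ->
  (forall l, B l -> cnorm (g l - c) <= e) ->
  norm2 (U (E B u) - c *: E B u) <= 2 * e * norm2 (E B u).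
Proof.
move=> mB e0 ge.
pose V : {linear H -> H} := (E B \o U \o E B) \- (c \*: E B).
have VE : V (E B u) = U (E B u) - c *: E B u.
  by rewrite /V /= !pvm_idem // function_of_comm // pvm_idem.
rewrite -VE; apply: quadratic_form_bound => w.
rewrite /V /= innerBr -pvm_sym // gUm innerZr -sqr_norm2_pvm //.
apply: le_trans (pvm_cintegral_cell _ _ _ ge) _ => //.
rewrite ler_wpM2l // -subr_ge0.
have -> : norm2 w ^+ 2 - norm2 (E B w) ^+ 2 = fine (m_ (E (~` B) w) setT).
  have := pvm_measure_add w measurableT mB; rewrite !pvm_measureT => /= h.
  by apply: EFin_inj; rewrite EFinB -h addeAC -EFinB subrr add0e.
by rewrite pvm_measureT /= sqr_ge0.
Qed.

End bounded_function.

End SpectralMeasure.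

(** * Group law and unitarity of the propagator *)

Section Propagator.
Context {R : realType}.
Notation leb := (@lebesgue_measure R).
Notation H := (L2 leb).
Variables (E : set R -> {linear H -> H}) (U : R -> {linear H -> H}).
Hypotheses (EP : projection_valued_measure E) (EU : is_propagator E U).

Let g t (l : R) : R[i] := expi (- (t * l)).

Let mg t : cmeasurable (g t).
Proof. by apply: cmeasurable_expi; apply: measurable_funN; exact: measurable_funM. Qed.

Let g1 t l : cnorm (g t l) <= 1.
Proof. by rewrite cnorm_expi. Qed.

Let gi t u : cintegrable (pvm_measure EP u) setT (g t) :=
  pvm_cintegrable EP (mg t) (g1 t) u.

Lemma propagator_form t u :
  inner u (U t u) = cintegral (pvm_measure EP u) setT (g t).
Proof. exact: EU. Qed.

Lemma propagator_form_conj t u : inner u (U t u) = conjc (inner u (U (- t) u)).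
Proof.
rewrite !propagator_form -cintegral_conj; last exact: gi.
by apply: eq_cintegral => l; rewrite /g mulNr opprK expiN.
Qed.

(** On the diagonal this is [propagator_form_conj], and polarization extends it. Exchanging [u] and
    [v] replaces [u - imu *: v] by [v + imu *: u], which is [imu] times it, and a unimodular factor
    does not change a diagonal form. *)
Lemma propagator_adj t u v : inner (U (- t) u) v = inner u (U t v).
Proof.
have four0 : (4 : R[i]) != 0 by rewrite pnatr_eq0.
have conj4 : conjc (4 : R[i]) = 4 by rewrite conjc_nat.
apply: (mulfI four0); rewrite polarization (innerC v) -{1}conj4 -conjcM polarization.
have rot (w : H) : conjc (inner (imu *: w) (U (- t) (imu *: w))) = inner w (U t w).
  have -> : U (- t) (imu *: w) = imu *: U (- t) w by exact: linearZ.
  rewrite innerZl innerZr conjc_imu mulrA mulNr imu_sqr opprK mul1r.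
  by rewrite -propagator_form_conj.
have -> : v + imu *: u = imu *: (u - imu *: v).
  by rewrite scalerBr scalerA imu_sqr scaleN1r opprK addrC.
have -> : v - imu *: u = - (imu *: (u + imu *: v)).
  by rewrite scalerDr scalerA imu_sqr scaleN1r opprD opprK addrC.
have conjE (a b c e : R[i]) : conjc (a - b - imu * (c - e)) =
    conjc a - conjc b - imu * (conjc e - conjc c).
  by rewrite !(conjcD, conjcN, conjcM) conjc_imu; ring.
have symN (w : H) s : inner (- w) (U s (- w)) = inner w (U s w).
  by rewrite linearN innerNl innerNr opprK.
rewrite conjE symN (rot (u - imu *: v)) (rot (u + imu *: v)).
by rewrite -!propagator_form_conj (addrC v u) -(opprB u v) symN.
Qed.

Lemma propagator_comm t B u : measurable B -> E B (U t u) = U t (E B u).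
Proof. by move=> mB; exact: (function_of_comm EP (mg t) (g1 t) (EU t)). Qed.

(** The mean value theorem is applied to cosine and sine separately; the constant is the sum of the
    two and is not sharp. *)
Lemma expi_lipschitz (x y : R) : cnorm (expi x - expi y) <= 2 * `|x - y|.
Proof.
wlog xy : x y / y <= x.
  move=> h; case: (leP y x) => [/h//|/ltW/h].
  by rewrite -cnormN opprB distrC.
have lip (f df : R -> R) : (forall z : R, is_derive z 1 f (df z)) ->
    (forall z, `|df z| <= 1) -> `|f x - f y| <= `|x - y|.
  move=> fd df1.
  have fc : {within `[y, x], continuous f}.
    apply: continuous_subspaceT => z.
    exact/differentiable_continuous/derivable1_diffP/ex_derive.
  have [c _ ->] := MVT_segment xy (fun z _ => fd z) fc.
  by rewrite normrM ler_piMl.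
apply: le_trans (cnorm_le_ReIm _) _; rewrite ReD ReN ImD ImN /=.
rewrite mulr_natl mulr2n lerD //.
- apply: (lip cos (fun z => - sin z)) => z; rewrite normrN.
  by rewrite ler_norml sin_geN1 sin_le1.
- by apply: (lip sin cos) => z; rewrite ler_norml cos_geN1 cos_le1.
Qed.

(** The intervals [[z e, (z + 1) e[], numbered by the codes of the integers [z], since a
    projection-valued measure is additive along sequences indexed by [nat]. A number that codes no
    integer gives the empty set. *)
Let cell (e : R) (n : nat) : set R := (fun l => pickle (Num.floor (l / e))) @^-1` [set n].

Lemma measurable_cell e n : 0 < e -> measurable (cell e n).
Proof.
move=> e0; case E1 : (unpickle n : option int) => [z|]; last first.
  suff -> : cell e n = set0 by [].
  by apply/seteqP; split => // l; rewrite /cell /= => h; move: E1; rewrite -h pickleK.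
have [pz|pz] := eqVneq (pickle z) n; last first.
  suff -> : cell e n = set0 by [].
  apply/seteqP; split => // l; rewrite /cell /= => h; move: E1 pz.
  by rewrite -h pickleK => -[->]; rewrite eqxx.
suff -> : cell e n = `[z%:~R * e, (z + 1)%:~R * e[%classic by exact: measurable_itv.
apply/seteqP; split => l; rewrite /cell /= in_itv /=.
- rewrite -pz => /(pcan_inj pickleK) <-.
  by rewrite -ler_pdivlMr // -ltr_pdivrMr // floor_itv.
- rewrite -ler_pdivlMr // -ltr_pdivrMr // => h; rewrite -pz; congr pickle.
  exact: floor_def.
Qed.

Lemma cell_diam e n l l' : 0 < e -> cell e n l -> cell e n l' -> `|l - l'| <= e.
Proof.
move=> e0; rewrite /cell /= => <- /(pcan_inj pickleK) h.
have := floor_itv (l / e); have := floor_itv (l' / e); rewrite h intrD.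
rewrite !ler_pdivlMr // !ltr_pdivrMr // mulrDl mul1r => /andP[a b] /andP[c d].
by rewrite ler_distl; apply/andP; split; lra.
Qed.

Lemma propagator_cell e t n l0 u : 0 < e -> cell e n l0 ->
  norm2 (U t (E (cell e n) u) - g t l0 *: E (cell e n) u) <=
  4 * `|t| * e * norm2 (E (cell e n) u).
Proof.
move=> e0 cl0.
(* One factor 2 comes from [function_of_cell], the other from [expi_lipschitz]. *)
have -> : 4 * `|t| * e = 2 * (2 * (`|t| * e)) by ring.
apply: (function_of_cell EP (mg t) (g1 t) (EU t)).
- exact: measurable_cell.
- by rewrite !mulr_ge0 // ltW.
- move=> l cl; apply: le_trans (expi_lipschitz _ _) _.
  rewrite ler_wpM2l // -opprD normrN -mulrBr normrM ler_wpM2l //.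
  exact: cell_diam cl cl0.
Qed.

(* Only the quadratic form of each [U t] is given.  The group law is recovered by cutting the
   spectral axis into cells of size [e], on which [U t] is within [O(e)] of a scalar. *)
Lemma propagatorD s t u : U s (U t u) = U (s + t) u.
Proof.
have Kle (a b c : R) : 0 <= a -> 0 <= b -> 0 <= c ->
    let K := 4 * a + 4 * b + 4 * c + 1 in [/\ 4 * a <= K, 4 * b <= K & 4 * c <= K].
  by move=> a0 b0 c0 /=; split; lra.
pose D : {linear H -> H} := (U s \o U t) \- U (s + t).
have DE w : D w = U s (U t w) - U (s + t) w by [].
suff D0 : forall w, inner w (D w) = 0.
  have : (U s \o U t) u = U (s + t) u.
    apply: (quadratic_form_ext (T1 := U s \o U t)) => w.
    by apply/eqP; rewrite -subr_eq0 -innerBr; apply/eqP/D0.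
  by [].
pose K := 4 * `|s| + 4 * `|t| + 4 * `|s + t| + 1.
have K1 : 1 <= K by rewrite lerDr !addr_ge0 // mulr_ge0.
have K0 : 0 < K := lt_le_trans ltr01 K1.
have small e : 0 < e -> e <= 1 -> forall n v,
    norm2 (D (E (cell e n) v)) <= 3 * K ^+ 2 * e * norm2 (E (cell e n) v).
  move=> e0 e1 n v; set w := E (cell e n) v.
  have [[l0 cl0]|c0] := pselect (exists l, cell e n l); last first.
    have -> : w = 0.
      rewrite /w (_ : cell e n = set0) ?(pvm_set0 EP) //.
      by apply/seteqP; split => // l cl; case: c0; exists l.
    by rewrite linear0 norm2_0 mulr0.
  have mc := measurable_cell n e0.
  have h1 := propagator_cell t v e0 cl0.
  have h2 := propagator_cell s (U t v) e0 cl0.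
  have h3 := propagator_cell (s + t) v e0 cl0.
  rewrite -/w in h1 h3; rewrite propagator_comm // -/w in h2.
  have gD : g (s + t) l0 = g s l0 * g t l0 by rewrite /g -expiD -opprD -mulrDl.
  have w0 := norm2_ge0 w.
  have Ut : norm2 (U t w) <= (1 + 4 * `|t| * e) * norm2 w.
    rewrite -(subrK (g t l0 *: w) (U t w)); apply: le_trans (norm2D _ _) _.
    by rewrite norm2Z cnorm_expi mul1r mulrDl mul1r addrC lerD2l.
  (* Each of the three propagators is replaced by its scalar at the point [l0] of the cell, at the
     cost of one use of [propagator_cell]; the scalars themselves satisfy the group law [gD]. *)
  have -> : D w = (U s (U t w) - g s l0 *: U t w) + g s l0 *: (U t w - g t l0 *: w)
      - (U (s + t) w - g (s + t) l0 *: w).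
    rewrite DE gD -scalerA scalerBr opprB addrA; congr (_ - _).
    by rewrite addrA subrK subrK.
  apply: le_trans (norm2D _ _) _; rewrite norm2N.
  apply: le_trans (lerD (norm2D _ _) (lexx _)) _.
  rewrite norm2Z cnorm_expi mul1r.
  apply: le_trans (lerD (lerD h2 h1) h3) _.
  have h4 : 4 * `|s| * e * norm2 (U t w) <= 4 * `|s| * e * (K * norm2 w).
    rewrite ler_wpM2l ?mulr_ge0 ?(ltW e0) //; apply: le_trans Ut _.
    rewrite ler_wpM2r // /K -(addrC 1) lerD2l.
    apply: (@le_trans _ _ (4 * `|t|)); first by rewrite ler_piMr // mulr_ge0.
    by rewrite addrAC lerDr addr_ge0 // mulr_ge0.
  have [a1 a2 a3] := Kle _ _ _ (normr_ge0 s) (normr_ge0 t) (normr_ge0 (s + t)).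
  have KK : K <= K ^+ 2 by rewrite expr2 ler_peMl // ltW.
  have ew : 0 <= e * norm2 w by rewrite mulr_ge0 // ltW.
  apply: le_trans (lerD (lerD h4 (lexx _)) (lexx _)) _.
  have -> : 3 * K ^+ 2 * e * norm2 w = K * K * (e * norm2 w) + K ^+ 2 * (e * norm2 w)
    + K ^+ 2 * (e * norm2 w) by ring.
  apply: lerD; first apply: lerD.
  - have -> : 4 * `|s| * e * (K * norm2 w) = 4 * `|s| * K * (e * norm2 w) by ring.
    by rewrite ler_wpM2r // ler_wpM2r // ltW.
  - by rewrite -mulrA ler_wpM2r // (le_trans a2).
  - by rewrite -mulrA ler_wpM2r // (le_trans a3).
move=> w; have bound e : 0 < e -> e <= 1 ->
    cnorm (inner w (D w)) <= 3 * K ^+ 2 * e * norm2 w ^+ 2.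
  move=> e0 e1.
  have mc n := measurable_cell n e0.
  have tc : trivIset setT (cell e) by exact: trivIset_preimage1.
  have cU : \bigcup_n cell e n = setT.
    by apply/seteqP; split => // l _; exists (pickle (Num.floor (l / e))).
  pose v n := \sum_(i < n) E (cell e i) w.
  have vw : norm2 (v n - w) @[n --> \oo] --> (0 : R).
    by have := pvm_sigma EP mc tc w; rewrite cU (pvm_setT EP).
  (* [D] commutes with the projections, so no cross terms appear and the estimates on the cells add
     up by Pythagoras. *)
  have Dv n : inner w (D (v n)) = \sum_(i < n) inner (E (cell e i) w) (D (E (cell e i) w)).
    rewrite linear_sum inner_sumr; apply: eq_bigr => i _.
    rewrite (pvm_sym EP) // !DE linearB /= !propagator_comm //.
    by rewrite !(pvm_idem EP).
  have Dle n : cnorm (inner w (D (v n))) <= 3 * K ^+ 2 * e * norm2 (v n) ^+ 2.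
    rewrite Dv (sqr_norm2_pvm_sum EP) // mulr_sumr.
    elim/big_ind2: _ => [|x1 x2 y1 y2 h1 h2|i _]; first by rewrite cnorm0.
      exact: le_trans (cnormD _ _) (lerD h1 h2).
    apply: le_trans (cauchy_schwarz _ _) _.
    rewrite mulrC (expr2 (norm2 _)) mulrA ler_wpM2r ?norm2_ge0 //; exact: small.
  (* With [D] moved to the other argument, the form is visibly continuous in [v n]. *)
  have Dadj x y : inner x (D y) = inner (U (- t) (U (- s) x) - U (- (s + t)) x) y.
    by rewrite DE innerBr innerBl !propagator_adj.
  have l1 : (inner w (D (v n)) : R[i]^o) @[n --> \oo] --> (inner w (D w) : R[i]^o).
    by rewrite Dadj; under eq_fun do rewrite Dadj; exact: cvg_innerr.
  have l2 : cnorm (inner w (D (v n))) @[n --> \oo] --> cnorm (inner w (D w)).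
    move/cvg_cnormP : l1; apply: squeeze_dist => n.
    rewrite ler_distl; apply/andP; split.
    - rewrite lerBlDr -(cnormN (_ - _)); apply: le_trans (cnormD _ _).
      by rewrite opprB addrC subrK.
    - by apply: le_trans (cnormD _ _); rewrite addrC subrK.
  have l3 : 3 * K ^+ 2 * e * norm2 (v n) ^+ 2 @[n --> \oo] --> 3 * K ^+ 2 * e * norm2 w ^+ 2.
    have l4 : norm2 (v n) @[n --> \oo] --> norm2 w by exact: cvg_norm2.
    apply: cvgM; first exact: cvg_cst.
    by under eq_fun do rewrite expr2; rewrite expr2; exact: cvgM.
  apply: (ler_cvg_to l2 l3); exact: nearW.
apply: cnorm_eq0; apply/eqP; rewrite eq_le cnorm_ge0 andbT leNgt; apply/negP => x0.
(* The choice [e = x / (2 * L)] lies in []0, 1]] and brings the bound on [x] down to [x / 2]. The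
   summand [x] in [L] keeps it positive and [e] below 1. *)
set x := cnorm _ in x0; pose L := 3 * K ^+ 2 * norm2 w ^+ 2 + x.
have c0 : 0 <= 3 * K ^+ 2 * norm2 w ^+ 2 by rewrite mulr_ge0 ?sqr_ge0 // mulr_ge0 ?sqr_ge0.
have L0 : 0 < L by rewrite ltr_wpDl.
have e0 : 0 < x / (2 * L) by rewrite divr_gt0 // mulr_gt0.
have e1 : x / (2 * L) <= 1 by rewrite ler_pdivrMr ?mulr_gt0 // mul1r /L; lra.
have := bound _ e0 e1; rewrite leNgt => /negP; apply.
have -> : 3 * K ^+ 2 * (x / (2 * L)) * norm2 w ^+ 2 =
  (3 * K ^+ 2 * norm2 w ^+ 2 / L) * (x / 2) by field; exact: lt0r_neq0.
apply: (@le_lt_trans _ _ (x / 2)); last first.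
  by rewrite ltr_pdivrMr // ltr_pMr // ltr1n.
by rewrite ler_piMl ?divr_ge0 ?(ltW x0) // ler_pdivrMr // mul1r lerDl ltW.
Qed.

Lemma propagator0 u : U 0 u = u.
Proof.
have := quadratic_form_ext (T1 := U 0) (T2 := idfun) => /(_ _ u) -> // w /=.
rewrite propagator_form.
have -> : cintegral (pvm_measure EP w) setT (g 0) =
    cintegral (pvm_measure EP w) setT (fun=> (1 : R)%:C).
  by apply: eq_cintegral => l; rewrite /g mul0r oppr0 expi0.
rewrite cintegral_real Rintegral_cst // mul1r inner_norm2; congr (_%:C).
exact: (congr1 fine (pvm_measureT EP w)).
Qed.

Lemma propagator_norm t u : norm2 (U t u) = norm2 u.
Proof.
apply/eqP; rewrite -(@eqrXn2 _ 2) ?norm2_ge0 //; apply/eqP/(@complexI R).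
by rewrite -!inner_norm2 -propagator_adj propagatorD addNr propagator0.
Qed.

End Propagator.

(** * Wave operators *)

Section MultiplicationOperators.
Context {R : realType}.
Notation leb := (@lebesgue_measure R).
Notation H := (L2 leb).
Implicit Types (u v : H) (g : R -> R[i]).

Section bounded.
Variables (g : R -> R[i]) (M : R).
Hypotheses (mg : cmeasurable g) (gM : forall x, cnorm (g x) <= M).

Lemma mulQ_ae u : \forall x \ae leb, L2fun (mulQ g u) x = g x * L2fun u x.
Proof. exact: (toL2E (@sq_integrableM_bounded _ _ R leb g _ M mg gM (L2fun_sq u))). Qed.

Lemma mulQ_linear : linear (mulQ g).
Proof.
move=> a u v; apply: L2fun_inj.
have h1 := L2funZD a (mulQ g u) (mulQ g v).
have h2 := L2funZD a u v.
have h3 := mulQ_ae (a *: u + v).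
have h4 := mulQ_ae u; have h5 := mulQ_ae v.
have h12 : \forall x \ae leb, L2fun (a *: mulQ g u + mulQ g v) x =
    a * L2fun (mulQ g u) x + L2fun (mulQ g v) x /\
    L2fun (a *: u + v) x = a * L2fun u x + L2fun v x by apply: filterS2 h1 h2.
have h45 : \forall x \ae leb, L2fun (mulQ g u) x = g x * L2fun u x /\
    L2fun (mulQ g v) x = g x * L2fun v x by apply: filterS2 h4 h5.
by apply: filterS3 h12 h3 h45 => x [-> ->] -> [-> ->]; ring.
Qed.

Lemma norm2_mulQ u : (forall x, cnorm (g x) = 1) -> norm2 (mulQ g u) = norm2 u.
Proof.
move=> g1; congr (Num.sqrt (fine _)).
rewrite (integral_abs2_ae _ _ (mulQ_ae u)).
- by apply: eq_integral => x _; rewrite abs2M -[abs2 (g x)]sqr_cnorm g1 expr1n mul1r.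
- exact: cmeasurable_L2fun.
- by apply: cmeasurableM => //; exact: cmeasurable_L2fun.
Qed.

End bounded.

Lemma cmeasurable_phase (t : R) : cmeasurable (fun x : R => expi (- (t * x))).
Proof. by apply: cmeasurable_expi; apply: measurable_funN; exact: measurable_funM. Qed.

Lemma cnorm_phase (t x : R) : cnorm (expi (- (t * x))) <= 1.
Proof. by rewrite cnorm_expi. Qed.

Lemma exp_itQ_ae t u :
  \forall x \ae leb, L2fun (exp_itQ t u) x = expi (- (t * x)) * L2fun u x.
Proof. exact: mulQ_ae (cmeasurable_phase t) (cnorm_phase t) u. Qed.

Lemma exp_itQ_linear t : linear (exp_itQ t : H -> H).
Proof. exact: mulQ_linear (cmeasurable_phase t) (cnorm_phase t). Qed.

Lemma norm2_exp_itQ t u : norm2 (exp_itQ t u) = norm2 u.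
Proof.
by apply: (norm2_mulQ (cmeasurable_phase t) (cnorm_phase t)) => x; rewrite cnorm_expi.
Qed.

Lemma exp_itQD s t u : exp_itQ s (exp_itQ t u) = exp_itQ (s + t) u.
Proof.
apply: L2fun_inj.
apply: filterS3 (exp_itQ_ae s (exp_itQ t u)) (exp_itQ_ae t u) (exp_itQ_ae (s + t) u).
by move=> x -> -> ->; rewrite mulrA -expiD -opprD -mulrDl.
Qed.

End MultiplicationOperators.

Section WaveOperators.
Context {R : realType}.
Notation leb := (@lebesgue_measure R).
Notation H := (L2 leb).
Variables (E : set R -> {linear H -> H}) (U : R -> {linear H -> H}).
Hypotheses (EP : projection_valued_measure E) (EU : is_propagator E U).

Lemma pinfty_shift (a : R) : (t + a @[t --> pinfty_nbhs R]) --> pinfty_nbhs R.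
Proof.
move=> P [M [_ MP]]; exists (M - a); split; first exact: num_real.
by move=> x xM; apply: MP; rewrite -ltrBlDr.
Qed.

Lemma ninfty_shift (a : R) : (t + a @[t --> ninfty_nbhs R]) --> ninfty_nbhs R.
Proof.
move=> P [M [_ MP]]; exists (M - a); split; first exact: num_real.
by move=> x xM; apply: MP; rewrite -ltrBrDr.
Qed.

Section one_side.
Variables (F : set_system R) (W : H -> H).
Context {FF : ProperFilter F}.
Hypothesis F_shift : forall a : R, (t + a @[t --> F]) --> F.
Hypothesis WF : is_wave_operator U F W.

Lemma wave_linear : linear W.
Proof.
move=> a u v; apply: (norm2_lim_unique (WF (a *: u + v))).
have -> : (fun t => norm2 (U (- t) (exp_itQ t (a *: u + v)) - (a *: W u + W v))) =
    (fun t => norm2 (a *: U (- t) (exp_itQ t u) + U (- t) (exp_itQ t v)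
      - (a *: W u + W v))).
  by apply/funext => t; rewrite (exp_itQ_linear t a u v) linearD linearZ.
by apply: cvg_norm2_linear; exact: WF.
Qed.

Lemma wave_norm u : norm2 (W u) = norm2 u.
Proof.
apply: (@cvg_unique _ (@Rhausdorff R) (norm2 (U (- t) (exp_itQ t u)) @[t --> F])).
  exact: cvg_norm2 (WF u).
apply: cvg_near_cst; apply: nearW => t.
by rewrite (propagator_norm EP EU) norm2_exp_itQ.
Qed.

Lemma wave_inner u v : inner (W u) (W v) = inner u v.
Proof. exact: isometry_inner wave_linear wave_norm u v. Qed.

(** The defining limit is unchanged when time is shifted by [t]; the group law absorbs [U t] into
    the shifted propagator. *)
Lemma wave_intertwining t u : U t (W u) = W (exp_itQ t u).
Proof.
apply: (norm2_lim_unique _ (WF (exp_itQ t u))).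
have h : norm2 (U (- s) (exp_itQ s u) - W u) @[s --> F] --> (0 : R) by exact: WF.
have h1 := @cvg_comp _ _ _ (fun s => s + t) _ F F _ (F_shift t) h.
have E1 : (fun s => norm2 (U (- s) (exp_itQ s (exp_itQ t u)) - U t (W u))) =
    (fun s => norm2 (U (- s) (exp_itQ s u) - W u)) \o (fun s => s + t).
  apply/funext => s /=; rewrite exp_itQD -[RHS](propagator_norm EP EU t) linearB /=.
  by rewrite (propagatorD EP EU) opprD addrCA subrr addr0.
by rewrite E1.
Qed.

End one_side.

Variables (Wp Wm : H -> H).
Hypotheses (Wp_lim : is_wave_operator U (pinfty_nbhs R) Wp)
  (Wm_lim : is_wave_operator U (ninfty_nbhs R) Wm)
  (WpWm : range Wp = range Wm).

Let Wp_inner := wave_inner Wp_lim.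
Let Wm_inner := wave_inner Wm_lim.

Let S := scattering Wp Wm.

(** Since the ranges coincide, [Wm u = Wp w] for some [w]. As [Wp] is isometric, [w] represents the
    functional in [adj], so the choice made there is [w] and not the default 0. *)
Lemma wave_scattering u : Wp (S u) = Wm u.
Proof.
have [w _ Ww] : range Wp (Wm u) by rewrite WpWm; exists u.
have ex : exists w', [set w' | forall x, inner (Wp x) (Wm u) = inner x w'] w'.
  by exists w => x; rewrite -Ww Wp_inner.
have /= h := xgetPex 0 ex.
have -> : S u = w; last exact: Ww.
by apply: inner_ext => x; rewrite -h -Ww Wp_inner.
Qed.

Lemma scattering_inner u v : inner (S u) (S v) = inner u v.
Proof. by rewrite -Wp_inner !wave_scattering Wm_inner. Qed.

Lemma scattering_norm u : norm2 (S u) = norm2 u.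
Proof.
apply/eqP; rewrite -(@eqrXn2 _ 2) ?norm2_ge0 //; apply/eqP/(@complexI R).
by rewrite -!inner_norm2 scattering_inner.
Qed.

(** The representing vector is the preimage of [Wp c] under [Wm], which exists because the ranges
    coincide. *)
Lemma inner_adj_scattering u c : inner u (adj S c) = inner (S u) c.
Proof.
have [w _ Ww] : range Wm (Wp c) by rewrite -WpWm; exists c.
have ex : exists w', [set w' | forall x, inner (S x) c = inner x w'] w'.
  by exists w => x; rewrite -Wp_inner wave_scattering -Ww Wm_inner.
by have /= -> := xgetPex 0 ex.
Qed.

End WaveOperators.
#[global] Instance lebesgue_ae_filter {R : realType} :
  Filter (almost_everywhere (@lebesgue_measure R)).
Proof. exact: ae_filter_ringOfSetsType. Qed.

(** * Plancherel by Poisson summability *)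

Section AffineChangeOfVariable.
Context {R : realType}.
Notation leb := (@lebesgue_measure R).
Variables (a b : R).
Hypothesis a0 : 0 < a.

Let phi (x : measurableTypeR R) : measurableTypeR R := a * x + b.

Lemma measurable_affine (D : set R) : measurable_fun D (fun x : R => a * x + b).
Proof. by apply: measurable_funD => //; exact: measurable_funM. Qed.

Let mphi : measurable_fun setT phi := @measurable_affine setT.

Let push := measure_function_pushforward__canonical__measure_function_Measure leb mphi.

(** The right-hand side is a measure that agrees with Lebesgue measure on half-open intervals, and
    these determine it. *)
Lemma lebesgue_measure_affine (A : set R) : measurable A ->
  leb A = (a%:E * leb ((fun x => (a * x + b)%R) @^-1` A))%E.
Proof.
move=> mA; pose m := mscale (NngNum (ltW a0)) push.
suff : leb A = m A by [].
apply: lebesgue_measure_unique => //= _ [[p q]] _ <-.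
rewrite /m /mscale /= /pushforward.
have -> : phi @^-1` `]p, q] = `](p - b) / a, (q - b) / a]%classic.
  apply/seteqP; split => x; rewrite /phi /= !in_itv /=.
  - by rewrite ltr_pdivrMr // ler_pdivlMr // ltrBlDr lerBrDr mulrC.
  - by rewrite ltr_pdivrMr // ler_pdivlMr // ltrBlDr lerBrDr mulrC.
rewrite !lebesgue_measure_itv /= !lte_fin ltr_pM2r ?invr_gt0 // ltrD2r.
case: ifPn => _; rewrite ?mule0 // -!EFinD -EFinM; congr EFin.
by field; exact: lt0r_neq0.
Qed.

Lemma ge0_integral_affine (f : R -> \bar R) : measurable_fun setT f ->
  (forall x, 0 <= f x)%E ->
  (\int[leb]_x f x = a%:E * \int[leb]_x f (a * x + b)%R)%E.
Proof.
move=> mf f0.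
have h := @ge0_integral_pushforward _ _ _ _ R phi mphi leb setT f measurableT mf
  (fun x _ => f0 x).
rewrite preimage_setT in h; rewrite -[X in (_ * X)%E]h.
have -> : (\int[leb]_x f x = \int[mscale (NngNum (ltW a0)) push]_x f x)%E.
  by apply: eq_measure_integral => A mA _; exact: (lebesgue_measure_affine mA).
by rewrite ge0_integral_mscale.
Qed.

Lemma integral_affine (f : R -> R) : leb.-integrable setT (EFin \o f) ->
  leb.-integrable setT (EFin \o (fun x => f (a * x + b))) /\
  \int[leb]_x f x = a * \int[leb]_x f (a * x + b).
Proof.
move=> fi; have [/measurable_EFinP mf fi'] := integrableP _ _ _ fi.
have mfa : measurable_fun setT (fun x => f (a * x + b)).
  exact: measurableT_comp mf (@measurable_affine setT).
have fai : leb.-integrable setT (EFin \o (fun x => f (a * x + b))).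
  apply/integrableP; split; first exact/measurable_EFinP.
  move: fi'; rewrite (ge0_integral_affine (f := fun x => `|(f x)%:E|%E)) //; last first.
    by apply: measurableT_comp => //; exact/measurable_EFinP.
  rewrite !ltey; apply: contra_neq => /= ->; rewrite gt0_muley //.
split => //.
have part (h : R -> \bar R) : measurable_fun setT h -> (forall x, 0 <= h x)%E ->
    (\int[leb]_x h x = a%:E * \int[leb]_x h (a * x + b)%R)%E.
  exact: ge0_integral_affine.
suff E : (\int[leb]_x (f x)%:E = a%:E * \int[leb]_x (f (a * x + b)%R)%:E)%E.
  by rewrite /Rintegral E fineM // integrable_fin_num.
rewrite [LHS]integralE [in RHS]integralE.
have mfE : measurable_fun setT (EFin \o f) by exact/measurable_EFinP.
rewrite (part (fun x => (EFin \o f)^\+ x)%E); last 2 first.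
- exact: measurable_funepos.
- by move=> x; exact: funepos_ge0.
rewrite (part (fun x => (EFin \o f)^\- x)%E); last 2 first.
- exact: measurable_funeneg.
- by move=> x; exact: funeneg_ge0.
rewrite [RHS]muleBr //; last exact: (integrable_add_def measurableT fai).
by congr (_ * _ - _ * _)%E; apply: eq_integral => x _; rewrite ?funeposE ?funenegE.
Qed.

Lemma ae_affine (P : measurableTypeR R -> Prop) : (\forall x \ae leb, P x) ->
  \forall x \ae leb, P (a * x + b).
Proof.
move=> [N [mN N0 h]]; exists ((fun x => a * x + b) @^-1` N); split.
- by rewrite -[X in measurable X]setTI; exact: measurable_affine.
- have := lebesgue_measure_affine mN; rewrite N0 => /esym/eqP.
  by rewrite mule_eq0 eqe gt_eqF //= => /eqP.
- by move=> x /= hx; exact: h.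
Qed.

End AffineChangeOfVariable.

Section TranslationReflection.
Context {R : realType}.
Notation leb := (@lebesgue_measure R).

Lemma ge0_integral_translation (t : R) (f : R -> \bar R) : measurable_fun setT f ->
  (forall x, 0 <= f x)%E -> (\int[leb]_x f (x + t)%R = \int[leb]_x f x)%E.
Proof.
move=> mf f0; rewrite (ge0_integral_affine t ltr01 mf f0) mul1e.
by under [RHS]eq_integral do rewrite mul1r.
Qed.

Lemma ae_translation (t : R) (P : measurableTypeR R -> Prop) : (\forall x \ae leb, P x) ->
  \forall x \ae leb, P (x + t).
Proof. by move=> h; apply: filterS (ae_affine t ltr01 h) => x; rewrite mul1r. Qed.

Lemma ae_scaling (a : R) (P : measurableTypeR R -> Prop) : 0 < a -> (\forall x \ae leb, P x) ->
  \forall x \ae leb, P (a * x).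
Proof. by move=> a0 h; apply: filterS (ae_affine 0 a0 h) => x; rewrite addr0. Qed.

Lemma ge0_integral_reflection (f : R -> \bar R) : measurable_fun setT f ->
  (forall x, 0 <= f x)%E -> (\int[leb]_x f (- x)%R = \int[leb]_x f x)%E.
Proof.
move=> mf f0; have mN : measurable_fun setT (-%R : R -> R) by exact: measurable_funN.
have := @ge0_integral_pushforward _ _ _ _ R (-%R : measurableTypeR R -> measurableTypeR R)
  mN leb setT f measurableT mf (fun x _ => f0 x).
rewrite preimage_setT => <-; apply: eq_measure_integral => A mA _.
exact: lebesgue_measureN.
Qed.

Lemma integral_reflection (f : R -> R) : leb.-integrable setT (EFin \o f) ->
  leb.-integrable setT (EFin \o (fun x => f (- x))) /\
  \int[leb]_x f (- x) = \int[leb]_x f x.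
Proof.
move=> fi; have [/measurable_EFinP mf fi'] := integrableP _ _ _ fi.
have mN : measurable_fun setT (-%R : R -> R) by exact: measurable_funN.
have mfN : measurable_fun setT (fun x : R => f (- x)) by exact: measurableT_comp mf mN.
have fNi : leb.-integrable setT (EFin \o (fun x => f (- x))).
  apply/integrableP; split; first exact/measurable_EFinP.
  rewrite (ge0_integral_reflection (f := fun x => `|(f x)%:E|%E)) //.
  by apply: measurableT_comp => //; exact/measurable_EFinP.
split=> //; rewrite /Rintegral; congr fine; rewrite [LHS]integralE [in RHS]integralE.
have mfE : measurable_fun setT (EFin \o f) by exact/measurable_EFinP.
rewrite -(ge0_integral_reflection (f := fun x => (EFin \o f)^\+ x)%E); last 2 first.
- exact: measurable_funepos.
- by move=> x; exact: funepos_ge0.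
rewrite -(ge0_integral_reflection (f := fun x => (EFin \o f)^\- x)%E); last 2 first.
- exact: measurable_funeneg.
- by move=> x; exact: funeneg_ge0.
by congr (_ - _)%E; apply: eq_integral => x _; rewrite ?funeposE ?funenegE.
Qed.

(** The substitution [y = x - e z], composed of an affine map of positive slope and a reflection. It
    is shaped for the Poisson averages below. *)
Lemma cintegral_dilation (e x : R) (f : R -> R[i]) : 0 < e ->
  cintegrable leb setT f ->
  cintegral leb setT f = cintegral leb setT (fun z => e%:C * f (x - e * z)).
Proof.
move=> e0 [f1 f2].
have key (h : R -> R) : leb.-integrable setT (EFin \o h) ->
    leb.-integrable setT (EFin \o (fun z => h (x - e * z))) /\
    \int[leb]_y h y = e * \int[leb]_z h (x - e * z).
  move=> hi; have [h1 ->] := integral_affine x e0 hi.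
  have [h2 h3] := integral_reflection h1.
  have E : (fun z => h (e * - z + x)) = (fun z => h (x - e * z)).
    by apply/funext => z; rewrite mulrN addrC.
  by rewrite E in h2 h3; split => //; rewrite h3.
have [i1 E1] := key _ f1; have [i2 E2] := key _ f2.
have -> : cintegral leb setT f = e%:C * cintegral leb setT (fun z => f (x - e * z)).
  rewrite /cintegral; apply/eqP; rewrite eq_complex /= !mul0r subr0 addr0.
  by apply/andP; split; apply/eqP; [exact: E1|exact: E2].
by rewrite cintegralZ.
Qed.

End TranslationReflection.

(** * The Poisson kernel and its integrals *)

Section PoissonKernel.
Context {R : realType}.
Notation leb := (@lebesgue_measure R).

(** The Abel damping factor: integrable, increasing to 1 as [e] decreases to 0, and with a
    nonnegative integrable Fourier transform, the Poisson kernel. *)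
Definition poisson_weight (e k : R) : R := expR (- (e * `|k|)).

Lemma continuous_poisson_weight e : continuous (poisson_weight e).
Proof.
move=> x; apply: continuous_comp; last exact: continuous_expR.
by apply: cvgN; apply: cvgM; [exact: cvg_cst|exact: norm_continuous].
Qed.

Lemma poisson_weight_gt0 e k : 0 < poisson_weight e k.
Proof. exact: expR_gt0. Qed.

Lemma measurable_poisson_weight e : measurable_fun setT (poisson_weight e).
Proof. by apply: continuous_measurable_fun; exact: continuous_poisson_weight. Qed.

Section fixed.
Variables (e z : R).
Hypothesis e0 : 0 < e.

(** The added 1 makes the integrand nonnegative, as [ge0_continuous_FTC2y] requires on a half-line;
    it is subtracted again in [integral_poisson_weight_expi]. The function [F] below is a primitive
    of [f] for [k >= 0]. *)
Let f (k : R) := poisson_weight e k * (1 + cos (k * z)).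

Let d := e ^+ 2 + z ^+ 2.

Let d0 : d != 0.
Proof. by rewrite gt_eqF // ltr_pwDl // ?exprn_gt0 // sqr_ge0. Qed.

Let F (k : R) := d^-1 * (expR (- e * k) * (z * sin (k * z) - e * cos (k * z)))
  - e^-1 * expR (- e * k).

Let f_ge0 k : 0 <= f k.
Proof. by rewrite mulr_ge0 ?expR_ge0 // -lerBlDl sub0r cos_geN1. Qed.

Let f_cont : continuous f.
Proof.
move=> x; apply: cvgM; first exact: continuous_poisson_weight.
apply: cvgD; first exact: cvg_cst.
have : {for x, continuous (cos \o (fun k : R => k * z))}.
  apply: continuous_comp; last exact: continuous_cos.
  by apply: cvgM; [exact: cvg_id|exact: cvg_cst].
exact.
Qed.

Let dF (k : R) : is_derive k 1 F (expR (- e * k) * (1 + cos (k * z))).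
Proof.
apply: is_derive_eq.
rewrite /GRing.scale /=; have e1 : e != 0 by rewrite gt_eqF.
by rewrite /d; field; rewrite e1; exact: d0.
Qed.

Let Fy : F k @[k --> +oo%R] --> (0 : R).
Proof.
have E0 : expR (- e * k) @[k --> +oo%R] --> (0 : R).
  have h : e * k @[k --> +oo%R] --> +oo%R.
    apply/cvgryPge => A; exists (A / e); split; first exact: num_real.
    by move=> x; rewrite ltr_pdivrMr // mulrC => /ltW.
  have -> : (fun k => expR (- e * k)) = (fun x => expR (- x)) \o (fun k => e * k).
    by apply/funext => k /=; rewrite mulNr.
  apply: (@cvg_comp _ _ _ (fun k => e * k) (fun x => expR (- x)) _ (pinfty_nbhs R) _ h).
  exact: cvgr_expR.
apply: (@squeeze_dist _ _ _ _ _ (fun k => (`|d^-1| * (`|z| + `|e|) + `|e^-1|) * expR (- e * k))).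
  move=> k; rewrite subr0 /F; apply: le_trans (ler_normB _ _) _.
  rewrite mulrDl; apply: lerD; last by rewrite normrM (ger0_norm (expR_ge0 _)).
  rewrite !normrM -!mulrA ler_wpM2l // mulrC (ger0_norm (expR_ge0 _)) ler_wpM2r ?expR_ge0 //.
  apply: le_trans (ler_normB _ _) _; rewrite !normrM; apply: lerD.
  - by rewrite ler_piMr // ler_norml sin_geN1 sin_le1.
  - by rewrite ler_piMr // ler_norml cos_geN1 cos_le1.
rewrite -(mulr0 (`|d^-1| * (`|z| + `|e|) + `|e^-1|)).
by apply: cvgM E0; exact: cvg_cst.
Qed.

Let integral_half :
  (\int[leb]_(k in `[0%R, +oo[) (f k)%:E = (e / d + e^-1)%:E)%E.
Proof.
have -> : (e / d + e^-1)%:E = (0%:E - (F 0)%:E)%E.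
  rewrite -EFinB; congr EFin; rewrite /F mulr0 expR0 mul0r sin0 cos0.
  by rewrite /d; field; rewrite gt_eqF //; exact: d0.
apply: ge0_continuous_FTC2y => //.
- exact: continuous_subspaceT.
- apply: cvg_at_right_filter; apply: differentiable_continuous.
  exact/derivable1_diffP/ex_derive.
- move=> x; rewrite in_itv /= andbT => x0; rewrite derive1E (@derive_val _ _ _ _ _ _ _ (dF x)) /f.
  by rewrite /poisson_weight ger0_norm ?ltW // mulNr.
Qed.

Lemma integral_poisson_weight_1Dcos :
  (\int[leb]_k (poisson_weight e k * (1 + cos (k * z)))%:E = (2 * (e / (e ^+ 2 + z ^+ 2) + e^-1))%:E)%E.
Proof.
rewrite ge0_symfun_integralT //; last first.
  by move=> x; rewrite /= /f /poisson_weight normrN mulNr cosN.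
rewrite EFinM -integral_half; congr (_ * _)%E; congr integral.
by apply/seteqP; split => x /=; rewrite in_itv /= andbT.
Qed.

End fixed.

(** At [z = 0] the integrand of the preceding lemma is twice the weight. *)
Lemma integral_poisson_weight e : 0 < e -> (\int[leb]_k (poisson_weight e k)%:E = (2 / e)%:E)%E.
Proof.
move=> e0; have := integral_poisson_weight_1Dcos 0 e0.
under eq_integral do rewrite mulr0 cos0 mulrC EFinM.
rewrite ge0_integralZl_EFin //.
- move=> h; have : ((1 + 1)%:E * \int[leb]_k (poisson_weight e k)%:E = (1 + 1)%:E * (2 / e)%:E)%E.
    rewrite h -EFinM; congr EFin; field; by rewrite gt_eqF //= expr0n addr0 expf_neq0 // gt_eqF.
  move=> /(congr1 (fun y => ((1 + 1)^-1)%:E * y)%E).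
  rewrite muleA -EFinM mulVf ?pnatr_eq0 // mul1e => ->.
  by rewrite -!EFinM; congr EFin; rewrite mulrA mulVf ?mul1r // pnatr_eq0.
- by move=> x _; rewrite lee_fin ltW // poisson_weight_gt0.
- by apply/measurable_EFinP; exact: measurable_poisson_weight.
Qed.

Lemma integrable_poisson_weight e : 0 < e ->
  leb.-integrable setT (EFin \o poisson_weight e).
Proof.
move=> e0; apply: integrable_ge0P.
- by move=> x; rewrite ltW // poisson_weight_gt0.
- exact: measurable_poisson_weight.
- by rewrite integral_poisson_weight // ltry.
Qed.

Lemma integral_poisson_weight_expi (e z : R) : 0 < e ->
  cintegral leb setT (fun k => expi (k * z) * (poisson_weight e k)%:C) =
  (2 * e / (e ^+ 2 + z ^+ 2))%:C.
Proof.
move=> e0.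
have d0 : e ^+ 2 + z ^+ 2 != 0 by rewrite gt_eqF // ltr_pwDl // ?exprn_gt0 // sqr_ge0.
have mexpi : cmeasurable (fun k : R => expi (k * z)).
  by apply: cmeasurable_expi; exact: measurable_funM.
have iw := integrable_poisson_weight e0.
have bexpi (k : R) : cnorm (expi (k * z)) <= 1 by rewrite cnorm_expi.
have [ic jc] := @cintegrableM_bounded _ _ R leb _ _ 1 mexpi bexpi (cintegrable_real iw).
have icos : leb.-integrable setT (EFin \o (fun k : R => poisson_weight e k * cos (k * z))).
  by move: ic; congr integrable; apply/funext => k /=; congr EFin; rewrite mulr0 subr0 mulrC.
have isin : leb.-integrable setT (EFin \o (fun k : R => poisson_weight e k * sin (k * z))).
  by move: jc; congr integrable; apply/funext => k /=; congr EFin; rewrite mulr0 add0r mulrC.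
apply/eqP; rewrite eq_complex /=; apply/andP; split; apply/eqP.
- transitivity (\int[leb]_k (poisson_weight e k * cos (k * z))).
    by congr fine; apply: eq_integral => k _; congr EFin; rewrite mulr0 subr0 mulrC.
  have := congr1 fine (integral_poisson_weight_1Dcos z e0).
  have -> : (fine (\int[leb]_k (poisson_weight e k * (1 + cos (k * z)))%:E))%E =
      \int[leb]_k (poisson_weight e k + poisson_weight e k * cos (k * z)).
    by congr fine; apply: eq_integral => k _; rewrite mulrDr mulr1.
  rewrite RintegralD // [X in X + _ = _](congr1 fine (integral_poisson_weight e0)) /=.
  set I := (X in _ + X = _) => h.
  rewrite -/I; have {h} -> : I = 2 * (e / (e ^+ 2 + z ^+ 2) + e^-1) - 2 / e.
    by rewrite -h; ring.
  by field; rewrite d0 gt_eqF.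
- transitivity (\int[leb]_k (poisson_weight e k * sin (k * z))).
    by congr fine; apply: eq_integral => k _; congr EFin; rewrite mulr0 add0r mulrC.
  (* The sine part is odd, so its integral equals its own opposite. *)
  have [_ E1] := integral_reflection isin.
  have E2 : \int[leb]_k (poisson_weight e (- k) * sin (- k * z)) =
      - 1 * \int[leb]_k (poisson_weight e k * sin (k * z)).
    rewrite -RintegralZl //; apply: eq_Rintegral => k _.
    by rewrite /poisson_weight normrN mulNr sinN; ring.
  by move: E1; rewrite E2; lra.
Qed.

(** The Fourier transform of the weight with [e = 1]. It is left unnormalized: its mass [2 * pi] is
    the constant in Plancherel's formula. *)
Definition poisson_kernel (z : R) : R := 2 / (1 + z ^+ 2).

Lemma poisson_kernel_ge0 z : 0 <= poisson_kernel z.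
Proof. by rewrite divr_ge0 // addr_ge0 // sqr_ge0. Qed.

Lemma continuous_poisson_kernel : continuous poisson_kernel.
Proof.
by move=> x; apply: cvgM; [exact: cvg_cst|exact: (@continuous_oneDsqrV R x)].
Qed.

Lemma measurable_poisson_kernel : measurable_fun setT poisson_kernel.
Proof. by apply: continuous_measurable_fun; exact: continuous_poisson_kernel. Qed.

Lemma integral_poisson_kernel : (\int[leb]_z (poisson_kernel z)%:E = (2 * pi)%:E)%E.
Proof.
have sym : poisson_kernel =1 poisson_kernel \o -%R.
  by move=> x; rewrite /= /poisson_kernel sqrrN.
rewrite (ge0_symfun_integralT poisson_kernel_ge0 continuous_poisson_kernel sym).
have -> : [set x : R | 0 <= x] = `[0%R, +oo[%classic.
  by apply/seteqP; split => x /=; rewrite in_itv /= andbT.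
rewrite /poisson_kernel; under eq_integral do rewrite EFinM.
rewrite ge0_integralZl_EFin //.
- have -> : (\int[leb]_(x in `[0%R, +oo[) ((1 + x ^+ 2)^-1)%:E = (pi / 2)%:E)%E.
    exact: integral0y_oneDsqr.
  by rewrite -!EFinM; congr EFin; field.
- by move=> x _; rewrite lee_fin invr_ge0 addr_ge0 // sqr_ge0.
- apply: measurable_funTS; apply/measurable_EFinP.
  by apply: continuous_measurable_fun; exact: continuous_oneDsqrV.
Qed.

Lemma integrable_poisson_kernel : leb.-integrable setT (EFin \o poisson_kernel).
Proof.
apply: integrable_ge0P.
- exact: poisson_kernel_ge0.
- exact: measurable_poisson_kernel.
- by rewrite integral_poisson_kernel ltry.
Qed.

End PoissonKernel.

(** * Plancherel's formula for regular functions *)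

Section PlancherelRegular.
Context {R : realType}.
Notation leb := (@lebesgue_measure R).
Notation mR := (measurableTypeR R).
Variables (s : R) (n : nat).
Hypothesis s2 : s ^+ 2 = 1.

Definition window : set R := `[- n%:R, n%:R]%classic.

Lemma measurable_window : measurable window.
Proof. exact: measurable_itv. Qed.

Lemma measurable_indic_window : measurable_fun setT (\1_window : R -> R).
Proof. by apply: measurable_indic; exact: measurable_window. Qed.

Lemma integrable_window : leb.-integrable setT (EFin \o \1_window).
Proof. exact: integrable_indic_itv. Qed.

(* The class on which Plancherel is proved directly: a.e. continuity lets Poisson averages converge. *)
Definition regular (w : R -> R[i]) : Prop :=
  [/\ cmeasurable w,
      exists2 M, 0 <= M & forall x, cnorm (w x) <= M * \1_window x &
      \forall x \ae leb, forall h : nat -> R, h j @[j --> \oo] --> (0 : R) ->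
        Rez (w (x - h j)) @[j --> \oo] --> Rez (w x) /\
        Imz (w (x - h j)) @[j --> \oo] --> Imz (w x)].

Variable w : R -> R[i].
Hypothesis wreg : regular w.

Let mw : cmeasurable w. Proof. by case: wreg. Qed.

Lemma regular_cintegrable : cintegrable leb setT w.
Proof.
case: wreg => _ [M M0 wM] _.
have hi := integrableZl measurableT M integrable_window.
exact: (@le_cintegrable _ _ R leb w (fun x => M * \1_window x) hi).
Qed.

Let wi := regular_cintegrable.

Let W (k : R) : R[i] := cintegral leb setT (fun x => expi (s * (k * x)) * w x).

Let mK (c : R) : cmeasurable (fun z : mR * mR => expi (c * (z.2 * z.1))).
Proof.
apply: cmeasurable_expi; apply: measurable_funM => //.
by apply: measurable_funM; [exact: measurable_snd|exact: measurable_fst].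
Qed.

Let K1 c (z : mR * mR) : cnorm (expi (c * (z.2 * z.1))) <= 1.
Proof. by rewrite cnorm_expi. Qed.

Let mW : cmeasurable W.
Proof.
apply: (@cmeasurable_cintegral_snd _ _ _ _ _ leb
  (fun z : mR * mR => expi (s * (z.2 * z.1)) * w z.1)).
by apply: cmeasurableM => //; exact: (@cmeasurable_fst _ _ mR mR).
Qed.

Let iKw (k : R) : cintegrable leb setT (fun x => expi (s * (k * x)) * w x).
Proof.
apply: (@cintegrableM_bounded _ _ R leb _ _ 1) => //; last by move=> x; rewrite cnorm_expi.
by apply: cmeasurable_expi; apply: measurable_funM => //; exact: measurable_funM.
Qed.

Let WB k : cnorm (W k) <= \int[leb]_x cnorm (w x).
Proof.
apply: le_trans (cnorm_cintegral (iKw k)) _.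
rewrite le_eqVlt; apply/orP; left; apply/eqP; apply: eq_Rintegral => x _.
by rewrite cnormM cnorm_expi mul1r.
Qed.

Section fixed_width.
Variable e : R.
Hypothesis e0 : 0 < e.

Let pw (k : R) : R[i] := (poisson_weight e k)%:C.

Let ipw : cintegrable leb setT pw.
Proof. exact/cintegrable_real/integrable_poisson_weight. Qed.

Let v1 k := conjc (W k) * pw k.

Let iv1 : cintegrable leb setT v1.
Proof.
apply: (@cintegrableM_bounded _ _ R leb _ _ (\int[leb]_x cnorm (w x))) => //.
- exact: cmeasurable_conj.
- by move=> x; rewrite cnorm_conj WB.
Qed.

Let Q (z : R) := 2 * e / (e ^+ 2 + z ^+ 2).

Let d0 z : e ^+ 2 + z ^+ 2 != 0.
Proof. by rewrite gt_eqF // ltr_pwDl ?exprn_gt0 ?sqr_ge0. Qed.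

(** Fubini turns the inverse transform of the damped [conjc (W k)] into a convolution with the
    transform [Q] of the weight. As [Q] is even and [s ^+ 2 = 1], the sign [s] drops out, which
    treats the transform and its inverse together. *)
Lemma poisson_inner (x : R) :
  cintegral leb setT (fun k => expi (s * (k * x)) * v1 k) =
  cintegral leb setT (fun y => conjc (w y) * (Q (x - y))%:C).
Proof.
have iv2 : cintegrable leb setT (fun k => expi (s * (k * x)) * pw k).
  apply: (@cintegrableM_bounded _ _ R leb _ _ 1) => //; last by move=> k; rewrite cnorm_expi.
  by apply: cmeasurable_expi; apply: measurable_funM => //; exact: measurable_funM.
have := @cintegral_kernel_fubini _ _ mR mR R leb leb _ _ _ 1 (mK (- s)) (K1 (- s))
  (cintegrable_conj wi) iv2.
move=> h; transitivity (cintegral leb setT (fun k =>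
    cintegral leb setT (fun y => expi (- s * (k * y)) * conjc (w y)) *
    (expi (s * (k * x)) * pw k))).
  apply: eq_cintegral => k; rewrite /v1 mulrCA; congr (_ * _).
  rewrite /W -cintegral_conj //; apply: eq_cintegral => y.
  by rewrite conjcM -expiN mulNr.
rewrite -h; apply: eq_cintegral => y; congr (_ * _).
have -> : Q (x - y) = Q (s * (x - y)) by rewrite /Q exprMn s2 mul1r.
rewrite -integral_poisson_weight_expi //; apply: eq_cintegral => k.
by rewrite mulrA -expiD; congr (expi _ * _); rewrite /=; ring.
Qed.

Let A (x : R) := cintegral leb setT (fun z => (poisson_kernel z)%:C * conjc (w (x - e * z))).

Let iQ x : cintegrable leb setT (fun y => conjc (w y) * (Q (x - y))%:C).
Proof.
have mQ : measurable_fun setT (fun y : R => Q (x - y)).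
  apply: measurable_funM => //; apply: continuous_measurable_fun => y.
  apply: cvgV => //; apply: cvgD; first exact: cvg_cst.
  have c : (x - y0) @[y0 --> y] --> x - y by apply: cvgB; [exact: cvg_cst|exact: cvg_id].
  by rewrite expr2; under eq_fun do rewrite expr2; exact: cvgM.
have -> : (fun y => conjc (w y) * (Q (x - y))%:C) = (fun y => (Q (x - y))%:C * conjc (w y)).
  by apply/funext => y; rewrite mulrC.
apply: (@cintegrableM_bounded _ _ R leb _ _ (2 / e)).
- exact: cmeasurable_real.
- move=> y; rewrite cnorm_real ger0_norm; last first.
    by rewrite divr_ge0 ?mulr_ge0 ?ltW // ltr_pwDl ?exprn_gt0 ?sqr_ge0.
  rewrite /Q ler_pdivrMr; last by rewrite ltr_pwDl ?exprn_gt0 ?sqr_ge0.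
  have -> : 2 / e * (e ^+ 2 + (x - y) ^+ 2) = 2 * e + 2 / e * (x - y) ^+ 2.
    by field; rewrite gt_eqF.
  by rewrite lerDl mulr_ge0 ?sqr_ge0 // divr_ge0 // ltW.
- exact: cintegrable_conj.
Qed.

(** The dilation moves the width [e] from the kernel to the argument of [w], so that a single
    integrable kernel serves as dominating function for all [e]. *)
Lemma poisson_average x :
  cintegral leb setT (fun y => conjc (w y) * (Q (x - y))%:C) = A x.
Proof.
rewrite (cintegral_dilation x e0 (iQ x)); apply: eq_cintegral => z.
rewrite mulrCA -rmorphM /= mulrC; congr (_%:C * _).
rewrite /Q /poisson_kernel subKr exprMn.
have d1 : 1 + z ^+ 2 != 0 by rewrite gt_eqF // ltr_pwDl ?sqr_ge0.
have -> : e ^+ 2 + e ^+ 2 * z ^+ 2 = e ^+ 2 * (1 + z ^+ 2) by ring.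
by field; rewrite d1 gt_eqF.
Qed.

Lemma cmeasurable_average : cmeasurable A.
Proof.
have -> : A = (fun x => cintegral leb setT (fun y => conjc (w y) * (Q (x - y))%:C)).
  by apply/funext => x; rewrite poisson_average.
apply: (@cmeasurable_cintegral_snd _ _ _ _ _ leb
  (fun z : mR * mR => conjc (w z.1) * (Q (z.2 - z.1))%:C)).
apply: cmeasurableM; first exact/cmeasurable_conj/(@cmeasurable_fst _ _ mR mR).
apply: cmeasurable_real; apply: (@measurableT_comp _ _ _ _ _ _ Q).
  apply: measurable_funM => //; apply: continuous_measurable_fun => y.
  apply: cvgV => //; apply: cvgD; first exact: cvg_cst.
  rewrite expr2; under eq_fun do rewrite expr2.
  by apply: cvgM; exact: cvg_id.
by apply: measurable_funB; [exact: measurable_snd|exact: measurable_fst].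
Qed.

(** A second use of Fubini, now paired with [w]: the damped square integral of the transform is the
    pairing of [w] with its Poisson average. *)
Lemma poisson_mean :
  \int[leb]_k (poisson_weight e k * abs2 (W k)) = \int[leb]_x Rez (w x * A x).
Proof.
rewrite -[RHS]/(Rez (cintegral leb setT (fun x => w x * A x))).
have -> : cintegral leb setT (fun x => w x * A x) =
    cintegral leb setT (fun x => w x * cintegral leb setT (fun k => expi (s * (k * x)) * v1 k)).
  by apply: eq_cintegral => x; rewrite poisson_inner poisson_average.
have -> := @cintegral_kernel_fubini _ _ mR mR R leb leb _ _ _ 1 (mK s) (K1 s) wi iv1.
rewrite Re_cintegral; apply: eq_Rintegral => k _.
rewrite -[cintegral _ _ _]/(W k) /v1 mulrA (mulrC (W k)) mul_conj_abs2 -rmorphM /=.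
by rewrite mulrC.
Qed.

Lemma integrable_poisson_mean :
  leb.-integrable setT (EFin \o (fun k => poisson_weight e k * abs2 (W k))).
Proof.
have h := @cintegrableM_bounded _ _ R leb _ _ _ mW WB iv1.
move: h.1; congr integrable; apply/funext => k.
rewrite /comp /v1 mulrA (mulrC (W k)) mul_conj_abs2 -rmorphM.
by rewrite -[Rez _]/(abs2 (W k) * poisson_weight e k) mulrC.
Qed.

Lemma cnorm_average M x : 0 <= M -> (forall x, cnorm (w x) <= M) -> cnorm (A x) <= 2 * pi * M.
Proof.
move=> M0 wM.
have ipk := cintegrable_real integrable_poisson_kernel.
have m1 : cmeasurable (fun z : R => conjc (w (x - e * z))).
  apply: cmeasurable_conj; case: mw => w1 w2.
  have m : measurable_fun setT (fun z : R => x - e * z).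
    by apply: measurable_funB => //; exact: measurable_funM.
  by split; [exact: (measurableT_comp w1 m)|exact: (measurableT_comp w2 m)].
have iA : cintegrable leb setT (fun z => (poisson_kernel z)%:C * conjc (w (x - e * z))).
  have -> : (fun z => (poisson_kernel z)%:C * conjc (w (x - e * z))) =
    (fun z => conjc (w (x - e * z)) * (poisson_kernel z)%:C).
    by apply/funext => z; rewrite mulrC.
  by apply: (@cintegrableM_bounded _ _ R leb _ _ M) => // z; rewrite cnorm_conj.
apply: le_trans (cnorm_cintegral iA) _.
apply: (@le_trans _ _ (\int[leb]_z (M * poisson_kernel z))).
  apply: le_Rintegral => //.
  - exact: cintegrable_cnorm iA.
  - by have := integrableZl measurableT M integrable_poisson_kernel.
  - move=> z _; rewrite cnormM cnorm_conj cnorm_real ger0_norm ?poisson_kernel_ge0 //.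
    by rewrite mulrC ler_wpM2r // poisson_kernel_ge0.
rewrite RintegralZl //; last exact: integrable_poisson_kernel.
by rewrite [X in _ * X](congr1 fine integral_poisson_kernel) mulrC.
Qed.

End fixed_width.

Let e_ (j : nat) : R := j.+1%:R^-1.

Let e_gt0 j : 0 < e_ j. Proof. by rewrite invr_gt0 ltr0n. Qed.

Let e_cvg : e_ j @[j --> \oo] --> (0 : R).
Proof. exact: cvg_harmonic. Qed.

Let average e x := cintegral leb setT (fun z => (poisson_kernel z)%:C * conjc (w (x - e * z))).

Let average_cvg : \forall x \ae leb,
  Rez (w x * average (e_ j) x) @[j --> \oo] --> 2 * pi * abs2 (w x).
Proof.
case: wreg => _ [M M0 wM0] wc.
have wM x : cnorm (w x) <= M.
  by apply: le_trans (wM0 x) _; rewrite ler_piMr // indicE; case: (_ \in _).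
have pk0 (z : R) : 0 <= poisson_kernel z by exact: poisson_kernel_ge0.
(* [p] stands for [Rez] or [Imz]; both parts of the average converge by the same argument. *)
have lim (p : R[i] -> R) x :
    (forall (c : R) z, p (c%:C * conjc z) = c * p (conjc z)) ->
    (forall z, `|p (conjc z)| <= cnorm z) ->
    (forall f : R -> R[i], cmeasurable f -> measurable_fun setT (fun z => p (conjc (f z)))) ->
    (forall h : nat -> R, h j @[j --> \oo] --> (0 : R) ->
      p (conjc (w (x - h j))) @[j --> \oo] --> p (conjc (w x))) ->
    \int[leb]_z p ((poisson_kernel z)%:C * conjc (w (x - e_ j * z))) @[j --> \oo] -->
    2 * pi * p (conjc (w x)).
  move=> pZ ple pm pc.
  have -> : 2 * pi * p (conjc (w x)) = \int[leb]_z (poisson_kernel z * p (conjc (w x))).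
    rewrite RintegralZr //; last exact: integrable_poisson_kernel.
    by rewrite [X in _ = X * _](congr1 fine integral_poisson_kernel).
  apply: (@Rintegral_dominated_cvg _ _ _ leb
    (fun j z => p ((poisson_kernel z)%:C * conjc (w (x - e_ j * z))))
    (fun z => poisson_kernel z * p (conjc (w x))) (fun z => M * poisson_kernel z)).
  - move=> j; under eq_fun do rewrite pZ.
    apply: measurable_funM; first exact: measurable_poisson_kernel.
    apply: (pm (fun z => w (x - e_ j * z))).
    have m : measurable_fun setT (fun z : R => x - e_ j * z).
      by apply: measurable_funB => //; exact: measurable_funM.
    by case: mw => w1 w2; split; [exact: (measurableT_comp w1 m)|exact: (measurableT_comp w2 m)].
  - by apply: measurable_funM => //; exact: measurable_poisson_kernel.
  - apply: aeW => z; under eq_fun do rewrite pZ.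
    apply: cvgM; first exact: cvg_cst.
    apply: pc; rewrite -(mul0r z); apply: cvgM => //; exact: cvg_cst.
  - by have := integrableZl measurableT M integrable_poisson_kernel.
  - move=> j z; rewrite pZ normrM (ger0_norm (pk0 z)) (mulrC M) ler_wpM2l //.
    exact: le_trans (ple _) (wM _).
apply: filterS wc => x wcx.
have l1 := lim (@complex.Re R) x.
have l2 := lim (@complex.Im R) x.
have -> : 2 * pi * abs2 (w x) = Rez (w x) * (2 * pi * Rez (conjc (w x)))
    - Imz (w x) * (2 * pi * Imz (conjc (w x))).
  by rewrite Re_conj Im_conj /abs2; ring.
under eq_fun do rewrite ReM.
apply: cvgB; (apply: cvgM; first exact: cvg_cst).
- apply: l1.
  + by move=> c z; rewrite ReM /= mul0r subr0.
  + by move=> z; rewrite Re_conj; exact: Re_le_cnorm.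
  + by move=> f [f1 f2]; under eq_fun do rewrite Re_conj.
  + move=> h /wcx[h1 _]; rewrite Re_conj; under eq_fun do rewrite Re_conj; exact: h1.
- apply: l2.
  + by move=> c z; rewrite ImM /= mul0r addr0.
  + by move=> z; rewrite Im_conj normrN; exact: Im_le_cnorm.
  + by move=> f [f1 f2]; under eq_fun do rewrite Im_conj; exact: measurable_funN.
  + move=> h /wcx[_ h1]; rewrite Im_conj; under eq_fun do rewrite Im_conj.
    exact: cvgN.
Qed.

Let mean_cvg : \int[leb]_k (poisson_weight (e_ j) k * abs2 (W k)) @[j --> \oo] -->
  2 * pi * \int[leb]_x abs2 (w x).
Proof.
case: wreg => _ [M M0 wM0] _.
have wM x : cnorm (w x) <= M.
  by apply: le_trans (wM0 x) _; rewrite ler_piMr // indicE; case: (_ \in _).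
under eq_fun do rewrite poisson_mean //.
have hi : leb.-integrable setT (EFin \o (fun x => 2 * pi * M * cnorm (w x))).
  by have := integrableZl measurableT (2 * pi * M) (cintegrable_cnorm wi).
have iabs : leb.-integrable setT (EFin \o (fun x => abs2 (w x))).
  have h := integrableZl measurableT M (cintegrable_cnorm wi).
  apply: (le_integrable _ _ _ h) => //.
    exact/measurable_EFinP/measurable_fun_abs2.
  move=> x _ /=; rewrite lee_fin !ger0_norm ?mulr_ge0 ?cnorm_ge0 ?abs2_ge0 //.
  by rewrite -sqr_cnorm expr2 ler_wpM2r ?cnorm_ge0.
rewrite -RintegralZl //.
apply: (@Rintegral_dominated_cvg _ _ _ leb
  (fun j x => Rez (w x * average (e_ j) x)) _ (fun x => 2 * pi * M * cnorm (w x))) => //.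
- move=> j; have [] // := cmeasurableM mw (cmeasurable_average (e_gt0 j)).
- by apply: measurable_funM => //; exact: measurable_fun_abs2.
- move=> j x; apply: le_trans (Re_le_cnorm _) _; rewrite cnormM mulrC.
  by rewrite ler_wpM2r ?cnorm_ge0 // cnorm_average.
Qed.

(** The damped integrals have two expressions for their limit as the width tends to 0: [mean_cvg]
    gives one, and, the weights increasing to 1, monotone convergence gives the other. Square
    integrability of the transform is thus part of the conclusion. *)
Lemma plancherel_regular :
  (\int[leb]_k (abs2 (W k))%:E = (2 * pi * \int[leb]_x abs2 (w x))%:E)%E.
Proof.
have c1 : (\int[leb]_k (poisson_weight (e_ j) k * abs2 (W k))%:E @[j --> \oo] -->
    (2 * pi * \int[leb]_x abs2 (w x))%:E)%E.
  have -> : (fun j => \int[leb]_k (poisson_weight (e_ j) k * abs2 (W k))%:E)%E =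
      EFin \o (fun j => \int[leb]_k (poisson_weight (e_ j) k * abs2 (W k))).
    apply/funext => j /=; rewrite /Rintegral fineK // integrable_fin_num //.
    exact: integrable_poisson_mean.
  by apply: cvg_EFin; [exact: nearW|exact: mean_cvg].
have mg j : measurable_fun setT (fun k => (poisson_weight (e_ j) k * abs2 (W k))%:E).
  apply/measurable_EFinP/measurable_funM; last exact: measurable_fun_abs2.
  exact: measurable_poisson_weight.
have pw0 j k : 0 <= poisson_weight (e_ j) k by rewrite ltW // poisson_weight_gt0.
have c2 := @cvg_monotone_convergence _ _ _ leb setT measurableT _ mg.
have {c2} c2 : (\int[leb]_k (poisson_weight (e_ j) k * abs2 (W k))%:E @[j --> \oo] -->
    \int[leb]_k (abs2 (W k))%:E)%E.
  have -> : (\int[leb]_k (abs2 (W k))%:E = \int[leb]_k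
     limn (fun j => (poisson_weight (e_ j) k * abs2 (W k))%:E))%E.
    apply: eq_integral => k _; apply/esym/cvg_lim => //.
    apply: cvg_EFin; first exact: nearW.
    rewrite -[X in _ --> X]mul1r; apply: cvgM; last exact: cvg_cst.
    rewrite -expR0; apply: (@cvg_comp _ _ _ (fun j => - (e_ j * `|k|)) expR _ (nbhs (0 : R))).
      by rewrite -oppr0 -(mul0r `|k|); apply: cvgN; apply: cvgM => //; exact: cvg_cst.
    exact: continuous_expR.
  apply: c2.
  - by move=> j k _; rewrite lee_fin mulr_ge0 ?abs2_ge0.
  - move=> k _ i j ij; rewrite lee_fin ler_wpM2r ?abs2_ge0 // ler_expR lerN2.
    by rewrite ler_wpM2r // lef_pV2 ?posrE ?ltr0n // ler_nat ltnS.
exact: (@cvg_unique _ (@ereal_hausdorff R) _ _ _ _ c2 c1).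
Qed.

End PlancherelRegular.

(** * The Fourier transform on L2 *)

Section RegularDensity.
Context {R : realType}.
Notation leb := (@lebesgue_measure R).
Notation H := (L2 leb).
Variable n : nat.
Notation W := (window n : set R).

Lemma window_indic_sub (x : R) (h : nat -> R) : x != - n%:R -> x != n%:R ->
  h j @[j --> \oo] --> (0 : R) ->
  \forall j \near \oo, \1_W (x - h j) = \1_W x :> R.
Proof.
move=> xn1 xn2 h0.
have key (d : R) : 0 < d -> \forall j \near \oo, `|h j| < d.
  move=> dp; have /cvgrPdist_lt/(_ _ dp) := h0.
  by apply: filterS => j; rewrite sub0r normrN.
have d0 : 0 < Num.min `|x + n%:R| `|x - n%:R|.
  by rewrite lt_min !normr_gt0 subr_eq0 addr_eq0 xn1.
apply: filterS (key _ d0) => j; rewrite lt_min => /andP[h1 h2].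
rewrite !indicE; congr (nat_of_bool _)%:R; apply/idP/idP.
- rewrite !inE /window /= !in_itv /= => /andP[a b].
  move: h1 h2; rewrite !lter_norml; case: (ltrP (x + n%:R) 0) => c1; case: (ltrP (x - n%:R) 0) => c2.
  + rewrite (ltr0_norm c1) (ltr0_norm c2) => /andP[? ?] /andP[? ?]; lra.
  + rewrite (ltr0_norm c1) (ger0_norm c2) => /andP[? ?] /andP[? ?]; lra.
  + rewrite (ger0_norm c1) (ltr0_norm c2) => /andP[? ?] /andP[? ?]; apply/andP; split; lra.
  + rewrite (ger0_norm c1) (ger0_norm c2) => /andP[? ?] /andP[? ?]; lra.
- rewrite !inE /window /= !in_itv /= => /andP[a b].
  move: h1 h2; rewrite !lter_norml ger0_norm; last by lra.
  rewrite ler0_norm; last by lra.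
  by move=> /andP[? ?] /andP[? ?]; apply/andP; split; lra.
Qed.

(** Discontinuities can come only from the indicator, at the two endpoints of the window, which form
    a null set. *)
Lemma regular_continuous (g1 g2 : R -> R) (M : R) : 0 <= M -> continuous g1 -> continuous g2 ->
  (forall x, `|g1 x| <= M) -> (forall x, `|g2 x| <= M) ->
  regular n (fun x => (\1_W x)%:C * (g1 x +i* g2 x)).
Proof.
move=> M0 c1 c2 b1 b2; split.
- apply: cmeasurableM; first by apply: cmeasurable_indic; exact: measurable_window.
  by split => /=; exact: continuous_measurable_fun.
- exists (2 * M); first by rewrite mulr_ge0.
  move=> x; rewrite cnormM cnorm_real ger0_norm // mulrC ler_wpM2r //.
  apply: le_trans (cnorm_le_ReIm _) _; rewrite /= mulr_natl mulr2n; exact: lerD.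
exists [set - n%:R; n%:R]; split.
- by apply: measurableU; exact: measurable_set1.
- apply: null_set_setU; try exact: measurable_set1; exact: lebesgue_measure_set1.
move=> x /= hx; apply: contrapT => /not_orP[x1 x2]; apply: hx => h h0.
have near1 := window_indic_sub (introN eqP x1) (introN eqP x2) h0.
have cg (g : R -> R) : continuous g -> g (x - h j) @[j --> \oo] --> g x.
  move=> cg; apply: (@cvg_comp _ _ _ (fun j => x - h j) g _ (nbhs x)); last exact: cg.
  have : x - h j @[j --> \oo] --> x - 0 by apply: cvgB => //; exact: cvg_cst.
  by rewrite subr0.
split.
- rewrite /= [0 * g2 x]mul0r subr0.
  apply: (@cvg_trans _ (\1_W x * g1 (x - h j) @[j --> \oo])).
    apply: near_eq_cvg; apply: filterS near1 => j E.
    by rewrite /= mul0r subr0 E.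
  by apply: cvgM; [exact: cvg_cst|exact: cg].
- rewrite /= [0 * g1 x]mul0r addr0.
  apply: (@cvg_trans _ (\1_W x * g2 (x - h j) @[j --> \oo])).
    apply: near_eq_cvg; apply: filterS near1 => j E.
    by rewrite /= mul0r addr0 E.
  by apply: cvgM; [exact: cvg_cst|exact: cg].
Qed.

Lemma regular_sq_integrable (w : R -> R[i]) : regular n w -> sq_integrable leb w.
Proof.
move=> [mw [M M0 wM] _].
have s1 : sq_integrable leb (fun x => (\1_W x)%:C).
  split; first by apply: cmeasurable_indic; exact: measurable_window.
  under eq_integral do rewrite abs2_real indicE.
  have -> : (\int[leb]_x (((x \in W)%:R : R) ^+ 2)%:E = \int[leb]_x (\1_W x)%:E)%E.
    by apply: eq_integral => x _; rewrite indicE; case: (x \in W); rewrite ?expr1n ?expr0n.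
  by apply: integrable_lty => //; exact: integrable_window.
apply: (@le_sq_integrable _ _ R leb _ _ M mw _ s1) => x.
by rewrite cnorm_real ger0_norm.
Qed.

(** An approximation in L1 becomes one in L2: clipping to [[- M, M]] does not increase the distance
    to [b], and then the squared distance is at most [2 * M] times the distance. *)
Lemma clip_continuous_approx (b : R -> R) (M e : R) : measurable_fun setT b ->
  (forall x, `|b x| <= M) -> 0 < e ->
  exists g : R -> R, [/\ continuous g, forall x, `|g x| <= M &
    (\int[leb]_x (\1_W x * (b x - g x) ^+ 2)%:E <= e%:E)%E].
Proof.
move=> mb bM e0; have M0 : 0 <= M := le_trans (normr_ge0 _) (bM 0).
have Wfin : (leb W < +oo)%E by rewrite lebesgue_measure_itv /=; case: ifP; rewrite ?ltry.
have bi : leb.-integrable W (EFin \o b).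
  apply: measurable_bounded_integrable => //.
  - exact: measurable_window.
  - exact: measurable_funTS.
  - exists M; split; first exact: num_real.
    by move=> x Mx y _; exact: le_trans (bM y) (ltW Mx).
have [g_ [gc gi glim]] := approximation_continuous_integrable (measurable_window n) Wfin bi.
pose clip (y : R) := Num.max (- M) (Num.min M y).
have clipM y : `|clip y| <= M.
  rewrite ler_norml /clip le_max lexx /= ge_max ge_min lexx /= andbT.
  by apply: le_trans M0; rewrite oppr_le0 (le_trans (normr_ge0 _) (bM 0)).
have clipb x y : `|b x - clip y| <= `|b x - y|.
  have := bM x; rewrite ler_norml => /andP[b1 b2]; rewrite /clip /Order.max /Order.min.
  case: (ltrP M y) => h1.
    case: ltrP; last by move=> h2; rewrite ger0_norm ?ler0_norm; lra.
    by move=> _; rewrite !ler0_norm ?opprB; lra.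
  case: ltrP => h2 //.
  by rewrite !ger0_norm; lra.
have [j Hj] : exists j, (\int[leb]_(x in W) `|(b x - g_ j x)%:E| <= (e / (2 * M + 1))%:E)%E.
  (* The [+ 1] keeps the denominator positive when [M = 0]. *)
  have e1 : 0 < e / (2 * M + 1) by rewrite divr_gt0 // ltr_wpDl // mulr_ge0.
  have /fine_cvgP[fin /cvgrPdist_lt/(_ _ e1) nr] := glim.
  have [N _ NP] := filterI fin nr; exists N; have [/= f1 f2] := NP N (leqnn N).
  rewrite -(fineK f1) lee_fin; move: f2; rewrite sub0r normrN => /ltW.
  exact: le_trans (ler_norm _).
have cclip : continuous clip.
  move=> y; have : {for y, continuous clip}; last exact.
  apply: continuous_max; first exact: cvg_cst.
  by apply: continuous_min; [exact: cvg_cst|exact: cvg_id].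
exists (clip \o g_ j); split.
- by move=> x; apply: continuous_comp; [exact: gc|exact: cclip].
- by move=> x /=; exact: clipM.
have mg : measurable_fun setT (g_ j) by exact: continuous_measurable_fun.
apply: (@le_trans _ _ (\int[leb]_(x in W) ((2 * M)%:E * `|(b x - g_ j x)%:E|))%E).
  rewrite [leRHS]integral_mkcond; apply: ge0_le_integral => //.
  - by move=> x _; rewrite lee_fin mulr_ge0 ?sqr_ge0.
  - apply/measurable_EFinP/measurable_funM; first exact: measurable_indic_window.
    apply: measurable_funX; apply: measurable_funB => //.
    apply: (@measurableT_comp _ _ _ _ _ _ clip) => //.
    exact: continuous_measurable_fun.
  - apply/(measurable_restrictT _ (measurable_window n)).
    apply: measurable_funeM; apply: measurableT_comp => //.
    by apply/measurable_EFinP; apply: measurable_funTS; exact: measurable_funB.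
  - move=> x _; rewrite indicE /patch; case: ifPn => xW; rewrite ?mul0r // mul1r.
    rewrite [leRHS](_ : _ = (2 * M * `|b x - g_ j x|)%:E) ?EFinM // lee_fin /=.
    apply: le_trans (ler_norm _) _; rewrite normrM.
    have h1 : `|b x - clip (g_ j x)| <= 2 * M.
      apply: le_trans (ler_normB _ _) _; rewrite mulr_natl mulr2n; exact: lerD.
    exact: ler_pM (normr_ge0 _) (normr_ge0 _) h1 (clipb x (g_ j x)).
rewrite ge0_integralZl //; last 3 first.
- exact: measurable_window.
- apply: measurableT_comp => //; apply/measurable_EFinP; apply: measurable_funTS.
  exact: measurable_funB.
- by rewrite lee_fin mulr_ge0.
apply: le_trans (lee_wpmul2l _ Hj) _; first by rewrite lee_fin mulr_ge0.
have M1 : 0 < 2 * M + 1 by rewrite ltr_wpDl // mulr_ge0.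
rewrite -EFinM lee_fin mulrA ler_pdivrMr // mulrC ler_wpM2l ?(ltW e0) //.
by rewrite lerDl.
Qed.

Lemma integral_indic_sqB_le (b c g : R -> R) (e1 e2 : R) : measurable_fun setT b ->
  measurable_fun setT c -> measurable_fun setT g ->
  (\int[leb]_x ((b x - c x) ^+ 2)%:E <= e1%:E)%E ->
  (\int[leb]_x (\1_W x * (c x - g x) ^+ 2)%:E <= e2%:E)%E ->
  (\int[leb]_x (\1_W x * (b x - g x) ^+ 2)%:E <= (2 * e1 + 2 * e2)%:E)%E.
Proof.
move=> mb mc mg h1 h2.
have m1 : measurable_fun setT (fun x => ((b x - c x) ^+ 2)%:E).
  by apply/measurable_EFinP/measurable_funX; exact: measurable_funB.
have mi (h : R -> R) : measurable_fun setT h ->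
    measurable_fun setT (fun x => (\1_W x * (h x - g x) ^+ 2)%:E).
  move=> mh; apply/measurable_EFinP/measurable_funM; first exact: measurable_indic_window.
  by apply: measurable_funX; exact: measurable_funB.
apply: (@le_trans _ _ (\int[leb]_x (2%:E * ((b x - c x) ^+ 2)%:E +
    2%:E * (\1_W x * (c x - g x) ^+ 2)%:E))%E).
  apply: ge0_le_integral => //.
  - by move=> x _; rewrite lee_fin mulr_ge0 ?sqr_ge0.
  - exact: mi.
  - by apply: emeasurable_funD; apply: measurable_funeM => //; exact: mi.
  - move=> x _; rewrite -!EFinM -EFinD lee_fin.
    have sq (p q : R) : (p + q) ^+ 2 <= 2 * p ^+ 2 + 2 * q ^+ 2.
      by rewrite -subr_ge0 (_ : _ - _ = (p - q) ^+ 2) ?sqr_ge0 //; ring.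
    have -> : b x - g x = (b x - c x) + (c x - g x) by ring.
    rewrite indicE; case: (x \in W); first by rewrite !mul1r; exact: sq.
    by rewrite !mul0r mulr0 addr0 mulr_ge0 ?sqr_ge0.
rewrite ge0_integralD //; last 4 first.
- by move=> x _; rewrite -EFinM lee_fin mulr_ge0 ?sqr_ge0.
- exact: measurable_funeM.
- by move=> x _; rewrite -EFinM lee_fin mulr_ge0 // mulr_ge0 ?sqr_ge0.
- by apply: measurable_funeM; exact: mi.
rewrite !ge0_integralZl //; last 3 first.
- exact: mi.
- by move=> x _; rewrite lee_fin mulr_ge0 ?sqr_ge0.
- by move=> x _; rewrite lee_fin sqr_ge0.
by rewrite [(2 * e1 + _)%:E]EFinD !EFinM; apply: leeD; apply: lee_wpmul2l.
Qed.

(** Truncating large values costs little by dominated convergence and reduces the claim to the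
    bounded case. *)
Lemma continuous_sq_approx (b : R -> R) (e : R) : measurable_fun setT b ->
  leb.-integrable setT (EFin \o (fun x => b x ^+ 2)) -> 0 < e ->
  exists g M, [/\ continuous g, 0 <= M, forall x, `|g x| <= M &
    (\int[leb]_x (\1_W x * (b x - g x) ^+ 2)%:E <= e%:E)%E].
Proof.
move=> mb b2 e0.
(* Here the window cuts the values of [b], at height [j], and not its argument. *)
pose c (j : nat) x := \1_(window j : set R) (b x) * b x.
have mc j : measurable_fun setT (c j).
  apply: measurable_funM => //.
  have mi : measurable_fun setT (\1_(window j : set R) : R -> R).
    exact: measurable_indic_window.
  exact: (measurableT_comp mi mb).
have cE j x : c j x = if `|b x| <= j%:R then b x else 0.
  rewrite /c indicE; have -> : (b x \in (window j : set R)) = (`|b x| <= j%:R).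
    by rewrite ler_norml /window; apply/idP/idP; rewrite inE /= in_itv.
  by case: ifP; rewrite ?mul1r ?mul0r.
have cb j x : `|c j x| <= j%:R by rewrite cE; case: ifP => // _; rewrite normr0.
have lim : \int[leb]_x (b x - c j x) ^+ 2 @[j --> \oo] --> (0 : R).
  have -> : (0 : R) = \int[leb]_x (0 : R) by rewrite /Rintegral integral0.
  apply: (@Rintegral_dominated_cvg _ _ _ leb (fun j x => (b x - c j x) ^+ 2)
    (fun=> 0) (fun x => b x ^+ 2)) => //.
  - by move=> j; apply: measurable_funX; apply: measurable_funB => //; exact: mc.
  - apply: aeW => x; apply: cvg_near_cst.
    exists (Num.truncn `|b x|).+1 => // j /= hj; rewrite cE ifT ?subrr ?expr0n //.
    by rewrite (le_trans (ltW (truncnS_gt _))) // ler_nat.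
  - move=> j x; rewrite ger0_norm ?sqr_ge0 // cE; case: ifP; rewrite ?subr0 //.
    by rewrite subrr expr0n sqr_ge0.
have e4 : 0 < e / 4 by rewrite divr_gt0.
have [N _ NP] : \forall j \near \oo, \int[leb]_x (b x - c j x) ^+ 2 <= e / 4.
  have /cvgrPdist_lt/(_ _ e4) := lim; apply: filterS => j.
  by rewrite sub0r normrN => /ltW; exact: le_trans (ler_norm _).
have {NP} hN : (\int[leb]_x ((b x - c N x) ^+ 2)%:E <= (e / 4)%:E)%E.
  have i : leb.-integrable setT (EFin \o (fun x => (b x - c N x) ^+ 2)).
    apply: (le_integrable _ _ _ b2) => //.
      by apply/measurable_EFinP/measurable_funX; apply: measurable_funB => //; exact: mc.
    move=> x _ /=; rewrite lee_fin !ger0_norm ?sqr_ge0 // cE; case: ifP; rewrite ?subr0 //.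
    by rewrite subrr expr0n sqr_ge0.
  rewrite -(fineK (integrable_fin_num _ i)) // lee_fin.
  exact: NP (leqnn N).
have [g [gc gM gi]] := clip_continuous_approx (mc N) (cb N) e4.
exists g, N%:R; split => //.
have -> : e = 2 * (e / 4) + 2 * (e / 4) by field.
apply: integral_indic_sqB_le hN gi => //.
exact: continuous_measurable_fun.
Qed.

End RegularDensity.

Section ChiQ.
Context {R : realType}.
Notation leb := (@lebesgue_measure R).
Notation H := (L2 leb).
Variable J : set R.
Hypothesis mJ : measurable J.

Let m1 : cmeasurable (fun x : R => (\1_J x : R)%:C).
Proof. exact: cmeasurable_indic. Qed.

Let b1 (x : R) : cnorm ((\1_J x : R)%:C) <= 1.
Proof. by rewrite cnorm_real indicE; case: (_ \in _); rewrite ?normr1 ?normr0. Qed.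

Lemma chiQ_ae (u : H) : \forall x \ae leb, L2fun (chiQ J u) x = (\1_J x)%:C * L2fun u x.
Proof. exact: mulQ_ae m1 b1 u. Qed.

Lemma chiQ_linear : linear (chiQ J : H -> H).
Proof. exact: mulQ_linear m1 b1. Qed.

Lemma chiQB (u v : H) : chiQ J (u - v) = chiQ J u - chiQ J v.
Proof. by have := chiQ_linear (-1) v u; rewrite !scaleN1r (addrC _ u) (addrC _ (chiQ J u)). Qed.

Lemma sq_integrable_chi (u : H) : sq_integrable leb (fun x => (\1_J x)%:C * L2fun u x).
Proof. exact: @sq_integrableM_bounded _ _ R leb _ _ 1 m1 b1 (L2fun_sq u). Qed.

End ChiQ.

Section RegularDense.
Context {R : realType}.
Notation leb := (@lebesgue_measure R).
Notation H := (L2 leb).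
Variable n : nat.
Notation W := (window n : set R).

Lemma regular_indic (w : R -> R[i]) x : regular n w -> w x = (\1_W x)%:C * w x.
Proof.
move=> [_ [M M0 wM] _]; rewrite indicE; case: (boolP (x \in W)) => xW; first by rewrite mul1r.
have := wM x; rewrite indicE (negbTE xW) mulr0 mul0r => h.
by apply: cnorm_eq0; apply/eqP; rewrite eq_le h cnorm_ge0.
Qed.

Lemma regular_dense (u : H) (e : R) : 0 < e ->
  exists2 w, regular n w & norm2 (chiQ W u - toL2 leb w) <= e.
Proof.
move=> e0; have [[mu1 mu2] ui] := L2fun_sq u.
have iabs := integrable_abs2 (L2fun_sq u).
have sub (p : R -> R) : measurable_fun setT p -> (forall x, p x ^+ 2 <= abs2 (L2fun u x)) ->
    leb.-integrable setT (EFin \o (fun x => p x ^+ 2)).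
  move=> mp pu; apply: (le_integrable _ _ _ iabs) => //.
    by apply/measurable_EFinP/measurable_funX.
  by move=> x _ /=; rewrite lee_fin !ger0_norm ?sqr_ge0 ?abs2_ge0.
have i1 := sub _ mu1 (fun x => ltac:(by rewrite lerDl sqr_ge0)).
have i2 := sub _ mu2 (fun x => ltac:(by rewrite lerDr sqr_ge0)).
have e2 : 0 < e ^+ 2 / 2 by rewrite divr_gt0 // exprn_gt0.
have [g1 [M1 [c1 M10 b1 h1]]] := continuous_sq_approx n mu1 i1 e2.
have [g2 [M2 [c2 M20 b2 h2]]] := continuous_sq_approx n mu2 i2 e2.
pose w x : R[i] := (\1_W x)%:C * (g1 x +i* g2 x).
have wreg : regular n w.
  apply: (@regular_continuous _ n g1 g2 (M1 + M2)) => //; first exact: addr_ge0.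
  - by move=> x; rewrite (le_trans (b1 x)) // lerDl.
  - by move=> x; rewrite (le_trans (b2 x)) // lerDr.
exists w => //.
have sw := regular_sq_integrable wreg.
rewrite -(@ler_pXn2r _ 2) ?nnegrE ?norm2_ge0 ?(ltW e0) // -lee_fin EFin_sqr_norm2.
have mW := measurable_window n : measurable W.
have E : \forall x \ae leb, L2fun (chiQ W u - toL2 leb w) x =
    (\1_W x)%:C * ((Rez (L2fun u x) - g1 x) +i* (Imz (L2fun u x) - g2 x)).
  apply: filterS3 (L2funB (chiQ W u) (toL2 leb w)) (chiQ_ae mW u) (toL2E sw) => x -> -> ->.
  by rewrite /w -mulrBr; congr (_ * _); case: (L2fun u x).
have mE (p g : R -> R) : measurable_fun setT p -> continuous g ->
    measurable_fun setT (fun x => (\1_W x * (p x - g x) ^+ 2)%:E).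
  move=> mp cg; apply/measurable_EFinP/measurable_funM; first exact/measurable_indic.
  by apply/measurable_funX/measurable_funB => //; exact: continuous_measurable_fun.
rewrite (integral_abs2_ae _ _ E); last 2 first.
- exact: cmeasurable_L2fun.
- apply: cmeasurableM; first exact: cmeasurable_indic.
  by split => /=; apply: measurable_funB => //; exact: continuous_measurable_fun.
have -> : e ^+ 2 = e ^+ 2 / 2 + e ^+ 2 / 2 by field.
rewrite EFinD; apply: le_trans (leeD h1 h2).
rewrite -ge0_integralD //.
- apply: ge0_le_integral => //.
  + by move=> x _; rewrite lee_fin abs2_ge0.
  + apply/measurable_EFinP/measurable_fun_abs2; apply: cmeasurableM; first exact: cmeasurable_indic.
    by split => /=; apply: measurable_funB => //; exact: continuous_measurable_fun.
  + by apply: emeasurable_funD; exact: mE.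
  + move=> x _; rewrite -EFinD lee_fin abs2M abs2_real -mulrDr /abs2 /=.
    by rewrite indicE; case: (_ \in _); rewrite ?expr1n ?expr0n.
- by move=> x _; rewrite lee_fin mulr_ge0 ?sqr_ge0.
- exact: mE.
- by move=> x _; rewrite lee_fin mulr_ge0 ?sqr_ge0.
- exact: mE.
Qed.

End RegularDense.

(** * Transforms truncated to a window *)

Section TruncatedTransform.
Context {R : realType}.
Notation leb := (@lebesgue_measure R).
Notation H := (L2 leb).
Notation mR := (measurableTypeR R).
Variable s : R.
Hypothesis s2 : s ^+ 2 = 1.

Definition window_transform (n : nat) (u : H) (k : R) : R[i] :=
  cintegral leb (window n) (fun x => expi (s * (k * x)) * L2fun u x).

(** The vector whose inner product with [u] is the truncated transform of [u] at [k]. Linearity in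
    [u] and, by Cauchy-Schwarz, continuity in [u] at each fixed [k] follow at once. *)
Definition modulation (n : nat) (k : R) : H :=
  toL2 leb (fun x => (\1_(window n) x)%:C * expi (- (s * (k * x)))).

Let m_expi (c k : R) : cmeasurable (fun x : R => expi (c * (k * x))).
Proof. by apply: cmeasurable_expi; apply: measurable_funM => //; exact: measurable_funM. Qed.

Let m_indic (n : nat) : cmeasurable (fun x : R => (\1_(window n) x : R)%:C).
Proof. by apply: cmeasurable_indic; exact: measurable_window. Qed.

Let sq_mod n k : sq_integrable leb (fun x => (\1_(window n) x)%:C * expi (- (s * (k * x)))).
Proof.
have s1 : sq_integrable leb (fun x => (\1_(window n) x)%:C).
  split; first exact: m_indic.
  under eq_integral do rewrite abs2_real indicE.
  have -> : (\int[leb]_x (((x \in window n)%:R : R) ^+ 2)%:E =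
      \int[leb]_x (\1_(window n) x)%:E)%E.
    by apply: eq_integral => x _; rewrite indicE; case: (_ \in _); rewrite ?expr1n ?expr0n.
  by apply: integrable_lty => //; exact: integrable_window.
under eq_fun do rewrite mulrC -mulNr.
apply: (@sq_integrableM_bounded _ _ R leb _ _ 1) => //; first exact: m_expi.
by move=> x; rewrite cnorm_expi.
Qed.

Lemma inner_modulation n k (u : H) (g : R -> R[i]) : cmeasurable g ->
  (\forall x \ae leb, L2fun u x = g x) ->
  inner (modulation n k) u = cintegral leb (window n) (fun x => expi (s * (k * x)) * g x).
Proof.
move=> mg ug; rewrite (L2fun_ae (toL2E (sq_mod n k)) ug) //; last by case: (sq_mod n k).
rewrite [in RHS]cintegral_mkcond; last exact: measurable_window.
apply: eq_cintegral => x; rewrite conjcM conj_real -expiN opprK.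
exact/esym/mulrA.
Qed.

Lemma window_transformE n u k : window_transform n u k = inner (modulation n k) u.
Proof.
rewrite (inner_modulation _ _ (cmeasurable_L2fun u)) //; exact: aeW.
Qed.

Lemma inner_modulation_chi n k (u : H) :
  inner (modulation n k) (chiQ (window n) u) = inner (modulation n k) u.
Proof.
have mW := measurable_window n : measurable (window n : set R).
have mc : cmeasurable (fun x => (\1_(window n) x)%:C * L2fun u x).
  by case: (sq_integrable_chi mW u).
rewrite -[RHS]window_transformE (inner_modulation _ _ mc (chiQ_ae mW u)).
rewrite /window_transform [LHS]cintegral_mkcond; last exact: measurable_window.
rewrite [RHS]cintegral_mkcond; last exact: measurable_window.
apply: eq_cintegral => x.
by rewrite indicE; case: (_ \in _); rewrite ?mul1r ?mul0r.
Qed.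

Lemma modulation_regular n k w : regular n w ->
  inner (modulation n k) (toL2 leb w) =
  cintegral leb setT (fun x => expi (s * (k * x)) * w x).
Proof.
move=> wreg; have [mw _ _] := wreg.
rewrite (inner_modulation _ _ mw (toL2E (regular_sq_integrable wreg))).
rewrite cintegral_mkcond; last exact: measurable_window.
by apply: eq_cintegral => x; rewrite [in RHS](regular_indic _ wreg) mulrCA.
Qed.

Lemma cmeasurable_window_transform n u : cmeasurable (window_transform n u).
Proof.
have -> : window_transform n u = (fun k => cintegral leb setT (fun x =>
    (fun z : mR * mR => (\1_(window n) z.1)%:C * (expi (s * (z.2 * z.1)) * L2fun u z.1)) (x, k))).
  by apply/funext => k; rewrite /window_transform cintegral_mkcond //; exact: measurable_window.
apply: (@cmeasurable_cintegral_snd _ _ _ _ _ leb (fun z : mR * mR =>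
  (\1_(window n) z.1)%:C * (expi (s * (z.2 * z.1)) * L2fun u z.1))).
apply: cmeasurableM.
  exact: (@cmeasurable_fst _ _ mR mR _ _ (m_indic n)).
apply: cmeasurableM; last exact: (@cmeasurable_fst _ _ mR mR _ _ (cmeasurable_L2fun u)).
apply: cmeasurable_expi; apply: measurable_funM => //.
by apply: measurable_funM; [exact: measurable_snd|exact: measurable_fst].
Qed.

Lemma window_transform_regular n w : regular n w ->
  (\int[leb]_k (abs2 (window_transform n (toL2 leb w) k))%:E =
   (2 * pi * norm2 (toL2 leb w) ^+ 2)%:E)%E.
Proof.
move=> wreg; have sw := regular_sq_integrable wreg.
have -> : 2 * pi * norm2 (toL2 leb w) ^+ 2 = 2 * pi * \int[leb]_x abs2 (w x).
  congr (_ * _); apply: EFin_inj; rewrite norm2_toL2 // /Rintegral fineK //.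
  by apply: integrable_fin_num => //; exact: integrable_abs2.
rewrite -(plancherel_regular s2 wreg); apply: eq_integral => k _.
by rewrite window_transformE modulation_regular.
Qed.

(* The constant is not sharp; it only serves to extend the isometry by density. *)
Lemma window_transform_bound n u :
  (\int[leb]_k (abs2 (window_transform n u k))%:E <=
   (2 * pi * (2 * norm2 (chiQ (window n) u)) ^+ 2)%:E)%E.
Proof.
set v := chiQ (window n) u.
(* The main case needs approximants within [1 / (j + 1) < norm2 v] of [v], so that their norm is at
   most [2 * norm2 v]; a vanishing [v] is treated apart. *)
have [v0|v0] := eqVneq (norm2 v) 0.
  rewrite v0 mulr0 expr0n mulr0.
  have v00 := norm2_eq0 v0; rewrite /v in v00.
  under eq_integral do rewrite window_transformE -inner_modulation_chi v00 inner0r abs2_0.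
  by rewrite integral0.
have vp : 0 < norm2 v by rewrite lt_neqAle eq_sym v0 norm2_ge0.
have e0 j : 0 < (j.+1%:R^-1 : R) by rewrite invr_gt0 ltr0n.
have /choice[w wP] : forall j : nat, exists w, regular n w /\ norm2 (v - toL2 leb w) <= j.+1%:R^-1.
  by move=> j; have [w w1 w2] := regular_dense n u (e0 j); exists w.
have bnd k j : cnorm (window_transform n (toL2 leb (w j)) k - window_transform n u k) <=
    norm2 (modulation n k) * j.+1%:R^-1.
  rewrite !window_transformE -(inner_modulation_chi n k u) -innerBr.
  apply: le_trans (cauchy_schwarz _ _) _; rewrite ler_wpM2l ?norm2_ge0 // norm2BC.
  by case: (wP j).
have lim0 k : norm2 (modulation n k) * j.+1%:R^-1 @[j --> \oo] --> (0 : R).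
  by rewrite -[X in _ --> X](mulr0 (norm2 (modulation n k))); apply: cvgM; [exact: cvg_cst|exact: cvg_harmonic].
apply: (@fatou_bound _ _ _ leb (fun j k => abs2 (window_transform n (toL2 leb (w j)) k))) => //.
- by move=> j; apply: measurable_fun_abs2; exact: cmeasurable_window_transform.
- by apply: measurable_fun_abs2; exact: cmeasurable_window_transform.
- by move=> *; exact: abs2_ge0.
- by move=> *; exact: abs2_ge0.
- apply: aeW => k; apply: cvg_abs2.
  + apply: squeeze_dist (lim0 k) => j; rewrite -ReN -ReD.
    exact: le_trans (Re_le_cnorm _) (bnd k j).
  + apply: squeeze_dist (lim0 k) => j; rewrite -ImN -ImD.
    exact: le_trans (Im_le_cnorm _) (bnd k j).
have h : j.+1%:R^-1 @[j --> \oo] --> (0 : R) by exact: cvg_harmonic.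
have /cvgrPdist_lt/(_ _ vp) := h; apply: filterS => j; rewrite sub0r normrN gtr0_norm // => /ltW hj.
have [wreg wd] := wP j.
rewrite window_transform_regular // lee_fin ler_wpM2l ?mulr_ge0 ?pi_ge0 //.
rewrite lerXn2r ?nnegrE ?norm2_ge0 ?mulr_ge0 ?norm2_ge0 //.
have -> : toL2 leb (w j) = v - (v - toL2 leb (w j)) by rewrite subKr.
apply: le_trans (norm2D _ _) _; rewrite norm2N mulr_natl mulr2n lerD2l.
exact: le_trans wd hj.
Qed.

Lemma fourier_trunc_ae n u : \forall k \ae leb,
  L2fun (fourier_trunc s u n) k = (Num.sqrt (2 * pi))^-1%:C * window_transform n u k.
Proof.
apply: toL2E; apply: sq_integrableZ; split; first exact: cmeasurable_window_transform.
exact: le_lt_trans (window_transform_bound n u) (ltry _).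
Qed.

Opaque fourier_trunc window_transform modulation.

Lemma fourier_trunc_linear n : linear (fun u : H => fourier_trunc s u n).
Proof.
move=> a u v; apply: L2fun_inj.
have h1 := L2funZD a (fourier_trunc s u n) (fourier_trunc s v n).
have h2 := fourier_trunc_ae n u; have h3 := fourier_trunc_ae n v.
apply: ae_eq_trans (fourier_trunc_ae n (a *: u + v)) _; apply: ae_eq_sym.
apply: ae_eq_trans h1 _.
move: h2 h3; move: (fourier_trunc s u n) (fourier_trunc s v n).
by move: ((Num.sqrt (2 * pi))^-1%:C) => c U V; apply: filterS2 => k -> ->;
  rewrite !window_transformE innerP; ring.
Qed.

Lemma norm2_fourier_trunc_sq n u :
  ((2 * pi * norm2 (fourier_trunc s u n) ^+ 2)%:E =
   \int[leb]_k (abs2 (window_transform n u k))%:E)%E.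
Proof.
have mT := cmeasurable_window_transform n u.
rewrite EFinM EFin_sqr_norm2 (integral_abs2_ae _ _ (fourier_trunc_ae n u)); last 2 first.
- exact: cmeasurable_L2fun.
- by apply: cmeasurableM => //; exact: cmeasurable_cst.
under eq_integral do rewrite abs2M abs2_real EFinM.
rewrite ge0_integralZl //; last 2 first.
- exact/measurable_EFinP/measurable_fun_abs2.
- by move=> k _; rewrite lee_fin abs2_ge0.
rewrite muleA -EFinM exprVn sqr_sqrtr ?mulr_ge0 ?pi_ge0 // divff ?mul1e //.
by rewrite mulf_neq0 // gt_eqF // pi_gt0.
Qed.

(** For regular functions, which the cut-off leaves unchanged, this is Plancherel. The crude bound
    [bd] makes both sides continuous, and density does the rest. *)
Lemma norm2_fourier_trunc n u : norm2 (fourier_trunc s u n) = norm2 (chiQ (window n) u).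
Proof.
have mW := measurable_window n : measurable (window n : set R).
have pi2 : (0 : R) < 2 * pi by rewrite mulr_gt0 // pi_gt0.
have bd v : norm2 (fourier_trunc s v n) <= 2 * norm2 (chiQ (window n) v).
  rewrite -(@ler_pXn2r _ 2) ?nnegrE ?mulr_ge0 ?norm2_ge0 //.
  rewrite -(ler_pM2l pi2) -lee_fin norm2_fourier_trunc_sq; exact: window_transform_bound.
have rg w : regular n w -> norm2 (fourier_trunc s (toL2 leb w) n) = norm2 (toL2 leb w).
  move=> wreg; apply/eqP; rewrite -(@eqrXn2 _ 2 _ _ isT (norm2_ge0 _) (norm2_ge0 _)); apply/eqP.
  apply: (mulfI (lt0r_neq0 pi2)); apply: EFin_inj.
  apply: etrans (norm2_fourier_trunc_sq _ _) _.
  exact: window_transform_regular.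
have chiw w : regular n w -> chiQ (window n) (toL2 leb w) = toL2 leb w.
  move=> wreg; apply: L2fun_inj.
  apply: filterS2 (chiQ_ae mW (toL2 leb w)) (toL2E (regular_sq_integrable wreg)) => x -> ->.
  by rewrite -regular_indic.
apply/eqP; rewrite -subr_eq0 -normr_le0; apply/ler_addgt0Pr => e e0; rewrite add0r.
have e3 : 0 < e / 3 by rewrite divr_gt0.
have [w wreg wd] := regular_dense n u e3.
have h1 : `|norm2 (fourier_trunc s u n) - norm2 (fourier_trunc s (toL2 leb w) n)| <= 2 * (e / 3).
  apply: le_trans (norm2_lipschitz _ _) _.
  have -> : fourier_trunc s u n - fourier_trunc s (toL2 leb w) n = fourier_trunc s (u - toL2 leb w) n.
    have := fourier_trunc_linear n (-1) (toL2 leb w) u; rewrite !scaleN1r.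
    by rewrite (addrC _ u) (addrC _ (fourier_trunc s u n)).
  by apply: le_trans (bd _) _; rewrite chiQB // chiw // ler_pM2l.
have h2 := le_trans (norm2_lipschitz (toL2 leb w) (chiQ (window n) u)) _.
have {}h2 : `|norm2 (toL2 leb w) - norm2 (chiQ (window n) u)| <= e / 3.
  by apply: h2; rewrite norm2BC.
have {}h1 : `|norm2 (fourier_trunc s u n) - norm2 (toL2 leb w)| <= 2 * (e / 3).
  exact: (eq_ind _ (fun a => `|norm2 (fourier_trunc s u n) - a| <= 2 * (e / 3)) h1 _ (rg _ wreg)).
have -> : e = 2 * (e / 3) + e / 3 by field.
exact: le_trans (ler_distD (norm2 (toL2 leb w)) _ _) (lerD h1 h2).
Qed.

End TruncatedTransform.

(** * The transform on L2: isometry, inversion, translation *)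

Section FourierSgn.
Context {R : realType}.
Notation leb := (@lebesgue_measure R).
Notation H := (L2 leb).
Notation mR := (measurableTypeR R).
Notation chi n := (chiQ (window n)).

Let mW (n : nat) : measurable (window n : set R) := measurable_window n.

Lemma window_sub (n m : nat) : (n <= m)%N -> (window n : set R) `<=` window m.
Proof.
move=> nm x; rewrite /window /= !in_itv /= => /andP[h1 h2].
have nm' : (n%:R : R) <= m%:R by rewrite ler_nat.
by rewrite (le_trans _ h1) ?lerN2 // (le_trans h2).
Qed.

Lemma window_indicM (n m : nat) (x : R) : (n <= m)%N ->
  \1_(window m) x * \1_(window n) x = \1_(window n) x :> R.
Proof.
move=> nm; rewrite !indicE; case: (boolP (x \in window n)) => xn; last by rewrite mulr0.
by rewrite mem_set ?mul1r //; apply: (window_sub nm); rewrite inE in xn.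
Qed.

Lemma norm2_chiQ_le (J : set R) (u : H) : measurable J -> norm2 (chiQ J u) <= norm2 u.
Proof.
move=> mJ; rewrite -(@ler_pXn2r _ 2) ?nnegrE ?norm2_ge0 // -lee_fin !EFin_sqr_norm2.
have [ms _] := sq_integrable_chi mJ u.
rewrite (integral_abs2_ae (cmeasurable_L2fun _) ms (chiQ_ae mJ u)).
apply: ge0_le_integral => //.
- by move=> x _; rewrite lee_fin abs2_ge0.
- exact/measurable_EFinP/measurable_fun_abs2.
- exact/measurable_EFinP/measurable_fun_abs2/cmeasurable_L2fun.
- move=> x _; rewrite lee_fin abs2M abs2_real indicE ler_piMl ?abs2_ge0 //.
  by case: (_ \in _); rewrite ?expr1n ?expr0n.
Qed.

Lemma chiQ_window_cvg (u : H) : norm2 (chi n u - u) @[n --> \oo] --> (0 : R).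
Proof.
have ae n : \forall x \ae leb, L2fun (chi n u - u) x = ((\1_(window n) x - 1) : R)%:C * L2fun u x.
  apply: filterS2 (L2funB (chi n u) u) (chiQ_ae (mW n) u) => x -> ->.
  by rewrite rmorphB /= mulrBl mul1r.
have mD0 n : cmeasurable (fun x : R => ((\1_(window n) x - 1) : R)%:C).
  by apply: cmeasurable_real; apply: measurable_funB => //; exact: measurable_indic_window.
have mD n := cmeasurableM (mD0 n) (cmeasurable_L2fun u).
have sq n : norm2 (chi n u - u) ^+ 2 =
    \int[leb]_x ((\1_(window n) x - 1) ^+ 2 * abs2 (L2fun u x)).
  rewrite sqr_norm2 /Rintegral; congr fine.
  rewrite (@integral_abs2_ae _ _ R leb _ _ (cmeasurable_L2fun _) (mD n) (ae n)).
  by apply: eq_integral => x _; rewrite abs2M abs2_real.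
have ind01 n (x : R) : (\1_(window n) x - 1) ^+ 2 <= 1 :> R.
  by rewrite indicE; case: (_ \in _); rewrite ?subrr ?expr0n // sub0r sqrrN expr1n.
have lim : \int[leb]_x ((\1_(window n) x - 1) ^+ 2 * abs2 (L2fun u x)) @[n --> \oo] --> (0 : R).
  have -> : (0 : R) = \int[leb]_x (0 : R) by rewrite /Rintegral integral0.
  apply: (@Rintegral_dominated_cvg _ _ _ leb _ (fun=> 0) (fun x => abs2 (L2fun u x))) => //.
  - move=> n; apply: measurable_funM; last exact/measurable_fun_abs2/cmeasurable_L2fun.
    by apply: measurable_funX; apply: measurable_funB => //; exact: measurable_indic_window.
  - apply: aeW => x; apply: cvg_near_cst.
    exists (Num.truncn `|x|).+1 => // n /= hn.
    have xn : window n x.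
      rewrite /window /= in_itv /= -ler_norml.
      by rewrite (le_trans (ltW (truncnS_gt _))) // ler_nat.
    by rewrite indicE mem_set // subrr expr0n mul0r.
  - exact: integrable_abs2 (L2fun_sq u).
  - move=> n x.
    have h : 0 <= (\1_(window n) x - 1) ^+ 2 * abs2 (L2fun u x) by rewrite mulr_ge0 ?sqr_ge0 ?abs2_ge0.
    by rewrite (ger0_norm h) ler_piMl ?abs2_ge0.
have -> : (fun n => norm2 (chi n u - u)) = (fun n => Num.sqrt (norm2 (chi n u - u) ^+ 2)).
  by apply/funext => n; rewrite sqrtr_sqr ger0_norm ?norm2_ge0.
under eq_fun do rewrite sq.
rewrite -sqrtr0; apply: (@cvg_comp _ _ _ _ Num.sqrt _ (nbhs (0 : R))); first exact: lim.
exact: sqrt_continuous.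
Qed.

Lemma cvg_inner (U V : nat -> H) (u v : H) :
  norm2 (U n - u) @[n --> \oo] --> (0 : R) -> norm2 (V n - v) @[n --> \oo] --> (0 : R) ->
  cnorm (inner (U n) (V n) - inner u v) @[n --> \oo] --> (0 : R).
Proof.
move=> hu hv.
apply: (@squeeze0 _ _ _ _ _ (fun n => norm2 (U n - u) * norm2 (V n - v) +
  norm2 (U n - u) * norm2 v + norm2 u * norm2 (V n - v))) => [n|].
  rewrite cnorm_ge0 /=.
  have -> : inner (U n) (V n) - inner u v = inner (U n - u) (V n - v) +
     inner (U n - u) v + inner u (V n - v) by rewrite !innerBl !innerBr; ring.
  apply: le_trans (cnormD _ _) _; apply: lerD; last exact: cauchy_schwarz.
  apply: le_trans (cnormD _ _) _; apply: lerD; exact: cauchy_schwarz.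
have -> : (0 : R) = 0 * 0 + 0 * norm2 v + norm2 u * 0 by ring.
apply: cvgD; last by apply: cvgM => //; exact: cvg_cst.
by apply: cvgD; apply: cvgM => //; exact: cvg_cst.
Qed.

Lemma cnorm_lim_unique (z : nat -> R[i]) (a b : R[i]) :
  cnorm (z n - a) @[n --> \oo] --> (0 : R) -> cnorm (z n - b) @[n --> \oo] --> (0 : R) -> a = b.
Proof.
move=> ha hb; apply/eqP; rewrite -subr_eq0; apply/eqP/cnorm_eq0.
have h : cnorm (a - b) @[n --> \oo] --> (0 : R).
  apply: (@squeeze0 _ nat \oo _ (fun=> cnorm (a - b)) (fun n => cnorm (z n - a) + cnorm (z n - b))) => [n|].
    rewrite cnorm_ge0 /= -(cnormN (z n - a)).
    have -> : a - b = - (z n - a) + (z n - b) by ring.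
    exact: cnormD.
  by rewrite -(addr0 (0 : R)); exact: cvgD.
exact: (@cvg_unique _ (@Rhausdorff R) _ _ _ _ (@cvg_cst _ (cnorm (a - b)) _ _ _) h).
Qed.

(** By Fatou, the squared distance between the pointwise limit [g] and [v] is below every
    [e ^+ 2]. *)
Lemma L2_ae_limit (v_ : nat -> H) (v : H) (g : R -> R[i]) : cmeasurable g ->
  norm2 (v_ n - v) @[n --> \oo] --> (0 : R) ->
  (\forall x \ae leb, Rez (L2fun (v_ n) x) @[n --> \oo] --> Rez (g x) /\
                      Imz (L2fun (v_ n) x) @[n --> \oo] --> Imz (g x)) ->
  \forall x \ae leb, L2fun v x = g x.
Proof.
move=> mg vv vg.
have md n : cmeasurable (fun x => L2fun (v_ n) x - L2fun v x).
  by apply: cmeasurableB; exact: cmeasurable_L2fun.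
have mgv := cmeasurableB mg (cmeasurable_L2fun v).
have bnd e : 0 < e -> (\int[leb]_x (abs2 (g x - L2fun v x))%:E <= (e ^+ 2)%:E)%E.
  move=> e0; apply: (@fatou_bound _ _ _ leb (fun n x => abs2 (L2fun (v_ n) x - L2fun v x))).
  - by move=> n; exact: measurable_fun_abs2.
  - exact: measurable_fun_abs2.
  - by move=> *; exact: abs2_ge0.
  - by move=> *; exact: abs2_ge0.
  - apply: filterS vg => x [h1 h2]; apply: cvg_abs2.
      under eq_fun do rewrite ReD ReN; rewrite ReD ReN; apply: cvgB h1 _; exact: cvg_cst.
    under eq_fun do rewrite ImD ImN; rewrite ImD ImN; apply: cvgB h2 _; exact: cvg_cst.
  have /cvgrPdist_lt/(_ _ e0) := vv; apply: filterS => n.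
  rewrite sub0r normrN ger0_norm ?norm2_ge0 // => /ltW h.
  rewrite -(integral_abs2_ae (cmeasurable_L2fun _) (md n) (L2funB (v_ n) v)) -EFin_sqr_norm2 lee_fin.
  by rewrite lerXn2r ?nnegrE ?norm2_ge0 ?(ltW e0).
have I0 : (\int[leb]_x (abs2 (g x - L2fun v x))%:E = 0)%E.
  apply/eqP; rewrite eq_le; apply/andP; split; last first.
    by apply: integral_ge0 => x _; rewrite lee_fin abs2_ge0.
  apply/lee_addgt0Pr => e e0; rewrite add0e.
  have se : 0 < Num.sqrt e by rewrite sqrtr_gt0.
  by apply: le_trans (bnd _ se) _; rewrite sqr_sqrtr // ltW.
have mE : measurable_fun setT (fun x => (abs2 (g x - L2fun v x))%:E).
  exact/measurable_EFinP/measurable_fun_abs2.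
have /(ae_eq_integral_abs leb measurableT mE) : (\int[leb]_x `|(abs2 (g x - L2fun v x))%:E| = 0)%E.
  by rewrite -I0; apply: eq_integral => x _; rewrite gee0_abs // lee_fin abs2_ge0.
by apply: filterS => x /(_ I)[] /abs2_eq0 /eqP; rewrite subr_eq0 => /eqP.
Qed.

Lemma cintegral_window_cvg (h : R -> R[i]) : cintegrable leb setT h ->
  Rez (cintegral leb (window n) h) @[n --> \oo] --> Rez (cintegral leb setT h) /\
  Imz (cintegral leb (window n) h) @[n --> \oo] --> Imz (cintegral leb setT h).
Proof.
move=> hi; have [mh1 mh2] := cintegrable_cmeasurable hi.
have lim (p : R -> R) : measurable_fun setT p -> (forall x, `|p x| <= cnorm (h x)) ->
    \int[leb]_x (\1_(window n) x * p x) @[n --> \oo] --> \int[leb]_x p x.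
  move=> mp ph.
  apply: (@Rintegral_dominated_cvg _ _ _ leb _ _ (fun x => cnorm (h x))) => //.
  - by move=> n; apply: measurable_funM => //; exact: measurable_indic_window.
  - apply: aeW => x; apply: cvg_near_cst.
    exists (Num.truncn `|x|).+1 => // n /= hn.
    have xn : window n x.
      rewrite /window /= in_itv /= -ler_norml.
      by rewrite (le_trans (ltW (truncnS_gt _))) // ler_nat.
    by rewrite indicE mem_set // mul1r.
  - exact: cintegrable_cnorm.
  - move=> n x; apply: le_trans (ph x); rewrite normrM ler_piMl // indicE.
    by case: (_ \in _); rewrite ?normr1 ?normr0.
have E n : cintegral leb (window n) h = cintegral leb setT (fun x => (\1_(window n) x)%:C * h x).
  by apply: cintegral_mkcond; exact: measurable_window.
split.
- have -> : (fun n => Rez (cintegral leb (window n) h)) =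
      (fun n => \int[leb]_x (\1_(window n) x * Rez (h x))).
    apply/funext => n; rewrite E Re_cintegral; apply: eq_Rintegral => x _.
    by rewrite ReM /= mul0r subr0.
  by apply: lim => // x; exact: Re_le_cnorm.
- have -> : (fun n => Imz (cintegral leb (window n) h)) =
      (fun n => \int[leb]_x (\1_(window n) x * Imz (h x))).
    apply/funext => n; rewrite E; apply: eq_Rintegral => x _.
    by rewrite ImM /= mul0r addr0.
  by apply: lim => // x; exact: Im_le_cnorm.
Qed.

Section one_sign.
Variable s : R.
Hypothesis s2 : s ^+ 2 = 1.

Lemma fourier_trunc_sub n m (u : H) : (n <= m)%N ->
  fourier_trunc s (chi n u) m = fourier_trunc s u n.
Proof.
move=> nm; apply: L2fun_inj.
have h1 := fourier_trunc_ae s2 m (chi n u); have h2 := fourier_trunc_ae s2 n u.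
apply: ae_eq_trans h1 _; apply: ae_eq_sym; apply: ae_eq_trans h2 _; apply: aeW => k.
congr (_ * _); rewrite !window_transformE.
rewrite (inner_modulation s n k (cmeasurable_L2fun u) (aeW _ (fun=> erefl))).
have [mc _] := sq_integrable_chi (mW n) u.
rewrite (inner_modulation s m k mc (chiQ_ae (mW n) u)).
rewrite [LHS]cintegral_mkcond; last exact: measurable_window.
rewrite [RHS]cintegral_mkcond; last exact: measurable_window.
apply: eq_cintegral => x.
rewrite [RHS](_ : _ = (\1_(window m) x * \1_(window n) x)%:C * (expi (s * (k * x)) * L2fun u x)).
  by rewrite window_indicM.
by rewrite rmorphM /=; ring.
Qed.

(** The limit selected in [fourier_sgn] exists: the transforms truncated at [p] and at [N] differ by
    the transform, truncated at [p], of the tail [u - chi N u], whose norm is small. *)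
Lemma fourier_sgn_cvg (u : H) :
  norm2 (fourier_trunc s u n - fourier_sgn s u) @[n --> \oo] --> (0 : R).
Proof.
suff ex : exists v, [set v | norm2 (fourier_trunc s u n - v) @[n --> \oo] --> (0 : R)] v.
  exact: (xgetPex 0 ex).
apply: L2_complete => e e0.
have e2 : 0 < e / 2 by rewrite divr_gt0.
have /cvgrPdist_lt/(_ _ e2)[N _ NP] := chiQ_window_cvg u; exists N => n m Nn Nm.
have key p : (N <= p)%N -> norm2 (fourier_trunc s u p - fourier_trunc s u N) <= e / 2.
  move=> Np; rewrite -(fourier_trunc_sub u Np).
  have := fourier_trunc_linear s2 p (-1) (chi N u) u.
  rewrite !scaleN1r (addrC _ u) (addrC _ (fourier_trunc s u p)) => <-.
  rewrite norm2_fourier_trunc //; apply: le_trans (norm2_chiQ_le _ (mW p)) _.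
  have := NP N (leqnn N); rewrite /= sub0r normrN ger0_norm ?norm2_ge0 // norm2BC.
  exact: ltW.
apply: le_trans (norm2_dist _ (fourier_trunc s u N) _) _.
have -> : e = e / 2 + e / 2 by field.
by apply: lerD; [exact: key|rewrite norm2BC; exact: key].
Qed.

Lemma fourier_sgn_linear : linear (fourier_sgn s : H -> H).
Proof.
move=> a u v; apply: (norm2_lim_unique (fourier_sgn_cvg (a *: u + v))).
have E : (fun n => norm2 (fourier_trunc s (a *: u + v) n - (a *: fourier_sgn s u + fourier_sgn s v))) =
  (fun n => norm2 (a *: fourier_trunc s u n + fourier_trunc s v n -
    (a *: fourier_sgn s u + fourier_sgn s v))).
  by apply/funext => n; rewrite (fourier_trunc_linear s2 n a u v).
rewrite E; exact: cvg_norm2_linear (fourier_sgn_cvg u) (fourier_sgn_cvg v).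
Qed.

Lemma norm2_fourier_sgn (u : H) : norm2 (fourier_sgn s u) = norm2 u.
Proof.
have h1 : norm2 (fourier_trunc s u n) @[n --> \oo] --> norm2 (fourier_sgn s u).
  exact: cvg_norm2 (fourier_sgn_cvg u).
have h2 : norm2 (chi n u) @[n --> \oo] --> norm2 u by exact: cvg_norm2 (chiQ_window_cvg u).
apply: (@cvg_unique _ (@Rhausdorff R) _ _ _ _ h1).
have -> : (fun n => norm2 (fourier_trunc s u n)) = (fun n => norm2 (chi n u)).
  by apply/funext => n; rewrite norm2_fourier_trunc.
exact: h2.
Qed.

Lemma inner_fourier_sgn (u v : H) : inner (fourier_sgn s u) (fourier_sgn s v) = inner u v.
Proof. exact: isometry_inner fourier_sgn_linear norm2_fourier_sgn u v. Qed.

(** The truncated integrals converge pointwise as well as in L2, and [L2_ae_limit] identifies the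
    two limits. *)
Lemma fourier_sgn_integrable (u : H) : cintegrable leb setT (L2fun u) ->
  \forall k \ae leb, L2fun (fourier_sgn s u) k =
    (Num.sqrt (2 * pi))^-1%:C * cintegral leb setT (fun x => expi (s * (k * x)) * L2fun u x).
Proof.
move=> ui; apply: (L2_ae_limit _ (fourier_sgn_cvg u)).
  apply: cmeasurableM; first exact: cmeasurable_cst.
  apply: (@cmeasurable_cintegral_snd _ _ _ _ _ leb (fun z : mR * mR =>
    expi (s * (z.2 * z.1)) * L2fun u z.1)).
  apply: cmeasurableM; last exact: (@cmeasurable_fst _ _ mR mR _ _ (cmeasurable_L2fun u)).
  apply: cmeasurable_expi; apply: measurable_funM => //.
  by apply: measurable_funM; [exact: measurable_snd|exact: measurable_fst].
have hn : \forall k \ae leb, forall n, L2fun (fourier_trunc s u n) k =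
    (Num.sqrt (2 * pi))^-1%:C * window_transform s n u k.
  by apply/ae_foralln => n; exact: fourier_trunc_ae.
apply: filterS hn => k hk.
have mK : cmeasurable (fun x : R => expi (s * (k * x))).
  by apply: cmeasurable_expi; apply: measurable_funM => //; exact: measurable_funM.
have i1 : cintegrable leb setT (fun x => expi (s * (k * x)) * L2fun u x).
  by apply: (@cintegrableM_bounded _ _ R leb _ _ 1 mK) => // x; rewrite cnorm_expi.
have [l1 l2] := cintegral_window_cvg i1.
split.
- rewrite ReM /= mul0r subr0; under eq_fun do rewrite hk ReM /= mul0r subr0.
  by apply: cvgM => //; exact: cvg_cst.
- rewrite ImM /= mul0r addr0; under eq_fun do rewrite hk ImM /= mul0r addr0.
  by apply: cvgM => //; exact: cvg_cst.
Qed.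

End one_sign.

Lemma cintegrable_chi n (u : H) :
  cintegrable leb setT (fun x => (\1_(window n) x)%:C * L2fun u x).
Proof.
apply: sq_integrable_mul (L2fun_sq u); split.
  by apply: cmeasurable_indic; exact: measurable_window.
under eq_integral do rewrite abs2_real indicE.
have -> : (\int[leb]_x (((x \in window n)%:R : R) ^+ 2)%:E =
    \int[leb]_x (\1_(window n) x)%:E)%E.
  by apply: eq_integral => x _; rewrite indicE; case: (_ \in _); rewrite ?expr1n ?expr0n.
by apply: integrable_lty => //; exact: integrable_window.
Qed.

Lemma window_transformT (s : R) n (u : H) k : window_transform s n u k =
  cintegral leb setT (fun x => expi (s * (k * x)) * ((\1_(window n) x)%:C * L2fun u x)).
Proof.
rewrite window_transformE (inner_modulation s n k (cmeasurable_L2fun u) (aeW _ (fun=> erefl))).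
rewrite [LHS]cintegral_mkcond; last exact: measurable_window.
by apply: eq_cintegral => x; rewrite mulrCA.
Qed.

(** Both vectors are cut to the window, hence integrable, so that Fubini applies; conjugation
    reverses the sign of the phase. *)
Lemma inner_fourier_trunc (s : R) n (u v : H) : s ^+ 2 = 1 ->
  inner (chi n u) (fourier_trunc s v n) = inner (fourier_trunc (- s) u n) (chi n v).
Proof.
move=> s2; have s2' : (- s) ^+ 2 = 1 by rewrite sqrrN.
pose c : R[i] := (Num.sqrt (2 * pi))^-1%:C.
have mcT r (r2 : r ^+ 2 = 1) w : cmeasurable (fun k => c * window_transform r n w k).
  exact: cmeasurableM (cmeasurable_cst _) (cmeasurable_window_transform _ _ _).
have [mu _] := sq_integrable_chi (mW n) u; have [mv _] := sq_integrable_chi (mW n) v.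
rewrite (L2fun_ae (chiQ_ae (mW n) u) (fourier_trunc_ae s2 n v) mu (mcT _ s2 _)).
rewrite (L2fun_ae (fourier_trunc_ae s2' n u) (chiQ_ae (mW n) v) (mcT _ s2' _) mv).
have iu := cintegrable_chi n u; have iv := cintegrable_chi n v.
have mK : cmeasurable (fun z : mR * mR => expi (s * (z.1 * z.2))).
  apply: cmeasurable_expi; apply: measurable_funM => //.
  by apply: measurable_funM; [exact: measurable_fst|exact: measurable_snd].
have K1 (z : mR * mR) : cnorm (expi (s * (z.1 * z.2))) <= 1 by rewrite cnorm_expi.
have := @cintegral_kernel_fubini _ _ mR mR R leb leb _ _ _ 1 mK K1
  (cintegrable_conj iu) (cintegrableZ c iv).
have mE r (k : R) : cmeasurable (fun x : R => expi (r * (k * x))).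
  by apply: cmeasurable_expi; apply: measurable_funM => //; exact: measurable_funM.
have iK r k w : cintegrable leb setT w -> cintegrable leb setT (fun x => expi (r * (k * x)) * w x).
  by move=> wi; apply: (@cintegrableM_bounded _ _ R leb _ _ 1 (mE r k)) => // x; rewrite cnorm_expi.
move=> E; transitivity (cintegral leb setT (fun x => conjc ((\1_(window n) x)%:C * L2fun u x) *
   cintegral leb setT (fun y => expi (s * (x * y)) * (c * ((\1_(window n) y)%:C * L2fun v y))))).
  apply: eq_cintegral => k; rewrite window_transformT; congr (_ * _).
  rewrite -cintegralZ; last exact: iK.
  by apply: eq_cintegral => x; rewrite mulrCA.
apply: etrans E _; apply: eq_cintegral => x.
rewrite conjcM conj_real window_transformT -cintegral_conj; last exact: iK.
rewrite [LHS]mulrCA -[RHS]mulrA; congr (_ * (_ * _)).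
apply: eq_cintegral => k.
by rewrite [RHS]conjcM -expiN mulNr opprK (mulrC x).
Qed.

Lemma fourier_sgn_adj (s : R) (u v : H) : s ^+ 2 = 1 ->
  inner u (fourier_sgn s v) = inner (fourier_sgn (- s) u) v.
Proof.
move=> s2; have s2' : (- s) ^+ 2 = 1 by rewrite sqrrN.
apply: (cnorm_lim_unique (cvg_inner (chiQ_window_cvg u) (fourier_sgn_cvg s2 v))).
have -> : (fun n => cnorm (inner (chi n u) (fourier_trunc s v n) - inner (fourier_sgn (- s) u) v)) =
  (fun n => cnorm (inner (fourier_trunc (- s) u n) (chi n v) - inner (fourier_sgn (- s) u) v)).
  by apply/funext => n; rewrite inner_fourier_trunc.
exact: cvg_inner (fourier_sgn_cvg s2' u) (chiQ_window_cvg v).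
Qed.

(** Inversion is adjunction followed by the isometry of the transform of opposite sign. *)
Lemma fourier_sgnK (s : R) (u : H) : s ^+ 2 = 1 -> fourier_sgn s (fourier_sgn (- s) u) = u.
Proof.
move=> s2; have s2' : (- s) ^+ 2 = 1 by rewrite sqrrN.
by apply: inner_ext => v; rewrite fourier_sgn_adj // inner_fourier_sgn.
Qed.

Section translation.
Variable t : R.

Let shift (v : H) : H := toL2 leb (fun k => L2fun v (k + t)).

Let mshift (v : H) : cmeasurable (fun k : R => L2fun v (k + t)).
Proof.
have [m1 m2] := cmeasurable_L2fun v.
have m : measurable_fun setT (fun k : R => k + t) by exact: measurable_funD.
by split; [exact: (measurableT_comp m1 m)|exact: (measurableT_comp m2 m)].
Qed.

Let shift_sq (v : H) :
  (\int[leb]_k (abs2 (L2fun v (k + t)%R))%:E = \int[leb]_k (abs2 (L2fun v k))%:E)%E.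
Proof.
apply: (ge0_integral_translation t (f := fun k => (abs2 (L2fun v k))%:E)).
- exact: (measurable_abs2 (cmeasurable_L2fun v)).
- by move=> k; rewrite lee_fin abs2_ge0.
Qed.

Let shift_ae (v : H) : \forall k \ae leb, L2fun (shift v) k = L2fun v (k + t).
Proof.
apply: toL2E; split; first exact: mshift.
by rewrite shift_sq; case: (L2fun_sq v).
Qed.

Let norm2_shift (v : H) : norm2 (shift v) = norm2 v.
Proof.
apply/eqP; rewrite -(@eqrXn2 _ 2 _ _ isT (norm2_ge0 _) (norm2_ge0 _)); apply/eqP/EFin_inj.
rewrite !EFin_sqr_norm2 (@integral_abs2_ae _ _ R leb _ _ (cmeasurable_L2fun _) (mshift v) (shift_ae v)).
exact: shift_sq.
Qed.

Let shiftB (v w : H) : shift v - shift w = shift (v - w).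
Proof.
apply: L2fun_inj; apply: ae_eq_trans (L2funB (shift v) (shift w)) _.
apply: ae_eq_sym; apply: ae_eq_trans (shift_ae (v - w)) _.
have h1 := shift_ae v; have h2 := shift_ae w; have h3 := ae_translation t (L2funB v w).
by apply: filterS3 h1 h2 h3 => k -> -> ->.
Qed.

Let trunc_shift n (u : H) : fourier_trunc (-1) (exp_itQ t u) n = shift (fourier_trunc (-1) u n).
Proof.
have s2 : (-1 : R) ^+ 2 = 1 by rewrite sqrrN expr1n.
apply: L2fun_inj; apply: ae_eq_trans (fourier_trunc_ae s2 n (exp_itQ t u)) _.
apply: ae_eq_sym; apply: ae_eq_trans (shift_ae (fourier_trunc (-1) u n)) _.
apply: filterS (ae_translation t (fourier_trunc_ae s2 n u)) => k ->; congr (_ * _).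
rewrite !window_transformE.
rewrite (inner_modulation (-1) n _ (cmeasurable_L2fun u) (aeW _ (fun=> erefl))).
have mph := cmeasurableM (cmeasurable_phase t) (cmeasurable_L2fun u).
rewrite (inner_modulation (-1) n k mph (exp_itQ_ae t u)).
congr cintegral; apply/funext => x; rewrite [RHS]mulrA -expiD; congr (expi _ * _).
by ring.
Qed.

(** Each truncated integral already turns the phase into a translation exactly, and translation,
    being isometric, passes to the limit. *)
Lemma fourier_exp_itQ (u : H) :
  \forall k \ae leb, L2fun (fourier (exp_itQ t u)) k = L2fun (fourier u) (k + t).
Proof.
have s2 : (-1 : R) ^+ 2 = 1 by rewrite sqrrN expr1n.
suff -> : fourier (exp_itQ t u) = shift (fourier u) by exact: shift_ae.
apply: (norm2_lim_unique (fourier_sgn_cvg s2 (exp_itQ t u))).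
have -> : (fun n => norm2 (fourier_trunc (-1) (exp_itQ t u) n - shift (fourier u))) =
  (fun n => norm2 (fourier_trunc (-1) u n - fourier u)).
  by apply/funext => n; rewrite trunc_shift shiftB norm2_shift.
exact: fourier_sgn_cvg.
Qed.

End translation.

End FourierSgn.

(** * The momentum operator *)

Section Density.
Context {R : realType}.
Notation leb := (@lebesgue_measure R).
Variables (nu : {measure set R -> \bar R}) (g : R -> R).
Hypothesis mg : measurable_fun setT g.
Hypothesis g0 : forall x, 0 <= g x.
Hypothesis nuE : forall A, measurable A -> nu A = (\int[leb]_(x in A) (g x)%:E)%E.
Import HBNNSimple.

Let density_nnsfun (h : {nnsfun R >-> R}) :
  (\int[nu]_x (h x)%:E = \int[leb]_x ((h x)%:E * (g x)%:E))%E.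
Proof.
have mgE : measurable_fun setT (EFin \o g) by exact/measurable_EFinP.
have mh r : measurable_fun setT (fun x => ((r * \1_(h @^-1` [set r]) x)%:E * (g x)%:E)%E).
  by apply: emeasurable_funM => //; apply/measurable_EFinP; exact: measurable_funM.
have i0 r x : (0 <= (r * \1_(h @^-1` [set r]) x)%:E)%E.
  by rewrite EFinM; exact: nnfun_muleindic_ge0.
have hT : (h : R -> R) \_ setT = h by apply/funext => x; rewrite /patch mem_set.
rewrite integral_nnsfun // sintegralE hT.
transitivity (\int[leb]_x (\sum_(r \in range h) (r * \1_(h @^-1` [set r]) x)%:E * (g x)%:E))%E; last first.
  apply: eq_integral => x _; rewrite -ge0_mule_fsuml //.
  by rewrite fsumEFin // -fimfunE.
rewrite ge0_integral_fsum //; last by move=> r x _; rewrite mule_ge0 // lee_fin.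
apply: eq_fsbigr => r; rewrite inE => -[y _ <-].
under eq_integral do rewrite EFinM -muleA.
have mi : measurable_fun [set: R] (fun x : R => ((\1_(h @^-1` [set h y]) x)%:E * (g x)%:E)%E).
  by apply: emeasurable_funM => //; exact/measurable_EFinP.
rewrite ge0_integralZl //; last 2 first.
- by move=> x _; rewrite mule_ge0 // lee_fin.
- by rewrite lee_fin.
rewrite nuE //; congr (_ * _)%E; rewrite [LHS]integral_mkcond.
apply: eq_integral => x _; rewrite indicE /patch; case: ifPn => _; rewrite ?mul1e ?mul0e //.
Qed.

(** Simple functions first, then monotone convergence on both sides. It is applied to [sob_measure],
    to read Sobolev regularity as a weighted Lebesgue integral. *)
Lemma ge0_integral_density (f : R -> \bar R) : measurable_fun setT f ->
  (forall x, 0 <= f x)%E -> (\int[nu]_x f x = \int[leb]_x (f x * (g x)%:E))%E.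
Proof.
move=> mf f0; pose h := nnsfun_approx measurableT mf.
have hf x : (h n x)%:E @[n --> \oo] --> f x by exact: cvg_nnsfun_approx.
have nd x : {homo (fun n => (h n x)%:E) : n m / (n <= m)%N >-> (n <= m)%E}.
  by move=> n m nm; rewrite lee_fin; exact/lefP/nd_nnsfun_approx.
have c1 : (\int[nu]_x (h n x)%:E @[n --> \oo] --> \int[nu]_x f x)%E.
  have -> : (\int[nu]_x f x = \int[nu]_x limn (fun n => (h n x)%:E))%E.
    by apply: eq_integral => x _; apply/esym/cvg_lim.
  apply: cvg_monotone_convergence => //.
  - by move=> n; exact/measurable_EFinP.
  - by move=> n x _; rewrite lee_fin.
have mgE : measurable_fun setT (EFin \o g) by exact/measurable_EFinP.
have mhg n : measurable_fun [set: R] (fun x : R => ((h n x)%:E * (g x)%:E)%E).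
  by apply: emeasurable_funM => //; exact/measurable_EFinP.
have c2 : (\int[leb]_x ((h n x)%:E * (g x)%:E) @[n --> \oo] --> \int[leb]_x (f x * (g x)%:E))%E.
  have -> : (\int[leb]_x (f x * (g x)%:E) = \int[leb]_x limn (fun n => (h n x)%:E * (g x)%:E))%E.
    apply: eq_integral => x _; apply/esym/cvg_lim => //.
    exact: cvgeZr.
  apply: cvg_monotone_convergence => //.
  - by move=> n x _; rewrite mule_ge0 // lee_fin.
  - by move=> x _ n m nm; apply: lee_wpmul2r; [rewrite lee_fin|exact: nd].
have E : (fun n => \int[nu]_x (h n x)%:E)%E = (fun n => \int[leb]_x ((h n x)%:E * (g x)%:E))%E.
  by apply/funext => n; exact: density_nnsfun.
rewrite E in c1.
exact: (@cvg_unique _ (@ereal_hausdorff R) _ _ _ _ c1 c2).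
Qed.

End Density.

(** * Fourier moments of Sobolev functions *)

Section SobolevMoments.
Context {R : realType}.
Notation leb := (@lebesgue_measure R).
Notation H := (L2 leb).
Notation mR := (measurableTypeR R).

(** The remainder is weaker than necessary so that, at [a = 1 + k ^+ 2], it is exactly
    [poisson_kernel k], already known to be integrable. *)
Lemma le_amgm (a c : R) : 0 < a -> 0 <= c -> c <= a * c ^+ 2 + 2 / a.
Proof.
move=> a0 c0; have h : 0 <= (a * c - 1) ^+ 2 / a by rewrite divr_ge0 ?sqr_ge0 // ltW.
have E : (a * c - 1) ^+ 2 / a = a * c ^+ 2 - 2 * c + a^-1 by field; rewrite gt_eqF.
have ai : 0 <= a^-1 by rewrite invr_ge0 ltW.
rewrite E in h; lra.
Qed.

Lemma ler_norm_sqrD1 (k : R) : `|k| <= 1 + k ^+ 2.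
Proof.
rewrite -(real_normK (num_real k)); move: (`|k|) => a.
by rewrite -subr_ge0 (_ : _ - _ = (a - 2^-1) ^+ 2 + 3 / 4) ?addr_ge0 ?sqr_ge0 //; field.
Qed.

Lemma jap_powR_ge (s k : R) : 1 <= s -> 1 + k ^+ 2 <= jap k `^ (2 * s).
Proof.
move=> s1; have j0 : 0 <= 1 + k ^+ 2 by rewrite addr_ge0 ?sqr_ge0.
have j1 : 1 <= jap k by rewrite /jap -[leLHS]sqrtr1 ler_wsqrtr // lerDl sqr_ge0.
have -> : 1 + k ^+ 2 = jap k `^ 2.
  by rewrite (powR_mulrn 2) ?sqrtr_ge0 // sqr_sqrtr.
by apply: ler_powR => //; rewrite ler_peMr.
Qed.

Variables (s : R) (u : H).
Hypothesis s1 : 1 <= s.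
Hypothesis us : in_sobolev s u.

Let uf := L2fun (fourier u).

Let muf : cmeasurable uf := cmeasurable_L2fun (fourier u).

Let mjap : measurable_fun setT (fun k : R => jap k `^ (2 * s)).
Proof. by apply/measurable_EFinP; exact: measurable_jap. Qed.

Let mpol : measurable_fun setT (fun k : R => 1 + k ^+ 2).
Proof. by apply: measurable_funD => //; exact: measurable_funX. Qed.

Lemma integrable_sobolev :
  leb.-integrable setT (EFin \o (fun k => (1 + k ^+ 2) * abs2 (uf k))).
Proof.
have [_ lt] := us.
have mabs : measurable_fun setT (fun k => (abs2 (uf k))%:E) by exact/measurable_EFinP/measurable_fun_abs2.
apply: integrable_ge0P.
- by move=> k; rewrite mulr_ge0 ?abs2_ge0 // addr_ge0 ?sqr_ge0.
- by apply: measurable_funM => //; exact: measurable_fun_abs2.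
have j0 (k : R) : 0 <= jap k `^ (2 * s) by exact: powR_ge0.
have a0 (k : R) : (0 <= (abs2 (uf k))%:E)%E by rewrite lee_fin abs2_ge0.
have E := @ge0_integral_density R (sob_measure s : {measure set R -> \bar R})
  (fun k => jap k `^ (2 * s)) mjap j0 (fun _ _ => erefl) (fun k => (abs2 (uf k))%:E) mabs a0.
have {}lt : (\int[leb]_k ((abs2 (uf k))%:E * (jap k `^ (2 * s))%:E) < +oo)%E.
  exact: (eq_ind _ (fun z => z < +oo)%E lt _ E).
apply: le_lt_trans lt.
apply: ge0_le_integral => //.
- by move=> k _; rewrite lee_fin mulr_ge0 ?abs2_ge0 // addr_ge0 ?sqr_ge0.
- by apply/measurable_EFinP/measurable_funM => //; exact: measurable_fun_abs2.
- by apply: emeasurable_funM => //; exact/measurable_EFinP.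
- by move=> k _; rewrite -EFinM lee_fin mulrC ler_wpM2l ?abs2_ge0 // jap_powR_ge.
Qed.

(** An integrable transform gives [u] a representative defined everywhere by an absolutely
    convergent inverse integral, which the definition of the momentum asks for. *)
Lemma cintegrable_sobolev : cintegrable leb setT uf.
Proof.
have hi := integrableD measurableT integrable_sobolev (@integrable_poisson_kernel R).
apply: (@le_cintegrable _ _ R leb uf
  (fun k => (1 + k ^+ 2) * abs2 (uf k) + poisson_kernel k) hi) => //.
move=> k; rewrite -sqr_cnorm; apply: le_amgm (cnorm_ge0 _).
by rewrite ltr_pwDl ?sqr_ge0.
Qed.

Lemma sq_integrable_momentum : sq_integrable leb (fun k => k%:C * uf k).
Proof.
split; first by apply: cmeasurableM => //; exact: cmeasurable_real.
have [_ hi] := integrableP _ _ _ integrable_sobolev; apply: le_lt_trans hi.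
apply: ge0_le_integral => //.
- by move=> k _; rewrite lee_fin abs2_ge0.
- apply/measurable_EFinP/measurable_fun_abs2/cmeasurableM => //; exact: cmeasurable_real.
- apply: measurableT_comp => //.
  by apply/measurable_EFinP/measurable_funM => //; exact: measurable_fun_abs2.
- move=> k _; rewrite /= lee_fin abs2M abs2_real ger0_norm; last first.
    by rewrite mulr_ge0 ?abs2_ge0 // addr_ge0 ?sqr_ge0.
  by rewrite ler_wpM2r ?abs2_ge0 // lerDr.
Qed.

Lemma integrable_momentum :
  leb.-integrable setT (EFin \o (fun k => k * abs2 (uf k))).
Proof.
apply: (le_integrable _ _ _ integrable_sobolev) => //.
  by apply/measurable_EFinP/measurable_funM => //; exact: measurable_fun_abs2.
move=> k _ /=; rewrite lee_fin !normrM ler_wpM2r //.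
exact: le_trans (ler_norm_sqrD1 k) (ler_norm _).
Qed.

(** The candidate for [P u]; [is_momentum_vec] checks it against the definition by absolute
    continuity. *)
Definition momentum_vec : H := fourier_inv (toL2 leb (fun k => k%:C * uf k)).

Lemma inner_momentum_vec : inner u momentum_vec = (\int[leb]_k (k * abs2 (uf k)))%:C.
Proof.
have e1 : (1 : R) ^+ 2 = 1 by rewrite expr1n.
rewrite /momentum_vec /fourier_inv fourier_sgn_adj // -[fourier_sgn _ _]/(fourier u).
have [m1 _] := sq_integrable_momentum.
rewrite (L2fun_ae (aeW _ (fun=> erefl)) (toL2E sq_integrable_momentum) muf m1).
rewrite -cintegral_real.
apply: eq_cintegral => k; rewrite mulrCA mul_conj_abs2 -rmorphM //.
Qed.

End SobolevMoments.

(** * Uniqueness of the momentum *)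

Section ConullPoints.
Context {R : realType}.
Notation leb := (@lebesgue_measure R).
Notation H := (L2 leb).
Notation mR := (measurableTypeR R).

Lemma ae_dense (P : R -> Prop) (a b : R) : a < b -> (\forall x \ae leb, P x) ->
  exists2 x, a < x < b & P x.
Proof.
move=> ab [N [mN N0 sN]]; apply: contrapT => h.
have sub : `]a, b[ `<=` N.
  move=> x /=; rewrite in_itv /= => xab; apply: sN => Px; apply: h.
  by exists x.
have : (leb `]a, b[ <= leb N)%E by apply: le_measure => //; rewrite inE //; exact: measurable_itv.
by rewrite N0 lebesgue_measure_itv /= lte_fin ab -EFinB lee_fin subr_le0 leNgt ab.
Qed.

(* A primitive vanishing at almost every point has zero derivative wherever it is differentiable. *)
Lemma ae_zero_of_primitive (f : R -> R) (a b : R) : leb.-integrable setT (EFin \o f) ->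
  (\forall x \ae leb, a < x < b -> \int[leb]_(t in `[a, x]) f t = 0) ->
  \forall x \ae leb, a < x < b -> f x = 0.
Proof.
move=> fi F0.
have loc : locally_integrable [set: R] f by apply: open_integrable_locally => //; exact: openT.
have fi' (y : R) : leb.-integrable [set` Interval (BLeft a) (BRight y)] (EFin \o f).
  exact: integrableS fi.
have ftc := FTC1 fi' loc.
have F1 := F0; apply: filterS2 ftc F1 => x hx Fx /andP[ax xb]; have [dF dFx] := hx ax.
have lim : h^-1 *: (((fun x => \int[leb]_(t in `[a, x]) f t) \o shift x) (h *: (1 : R)) -
    \int[leb]_(t in `[a, x]) f t) @[h --> 0^'] --> f x.
  by rewrite -dFx derive1E; exact: dF.
apply/eqP; rewrite -normr_le0; apply/ler_addgt0Pr => e e0; rewrite add0r.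
have /cvgrPdist_lt/(_ _ e0) := lim; move=> -[d /= d0 hd].
(* Points where the primitive vanishes are dense, so some difference quotient with step below [d] is
   exactly 0. *)
have [y] := ae_dense (ltac:(by rewrite lt_min ltrDl d0) : x < Num.min (x + d) b) F0.
rewrite lt_min => /and3P[xy yd yb] Fy.
have := hd (y - x); rewrite /ball_ /= sub0r normrN gtr0_norm ?subr_gt0 //.
rewrite ltrBlDr addrC yd gt_eqF ?subr_gt0 // => /(_ isT isT) /=.
rewrite scaler1 subrK Fy ?(lt_trans ax xy) ?yb // Fx ?ax ?xb // subrr scaler0 subr0.
exact: ltW.
Qed.

(** The endpoints are confined to a conull set [D] because, in the application, two primitives can
    be compared only where both agree with the same class. *)
Lemma ae_zero_of_integral_itv (f : R -> R) (D : R -> Prop) :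
  (forall n, leb.-integrable setT (EFin \o (fun x => \1_(window n) x * f x))) ->
  (\forall x \ae leb, D x) ->
  (forall a b, D a -> D b -> a <= b -> \int[leb]_(x in `[a, b]) f x = 0) ->
  \forall x \ae leb, f x = 0.
Proof.
move=> fi Dae D0.
suff h m : \forall x \ae leb, x \in (window m : set R) -> f x = 0.
  have : \forall x \ae leb, forall m, x \in (window m : set R) -> f x = 0 by exact/ae_foralln.
  apply: filterS => x /(_ (Num.truncn `|x|).+1); apply.
  rewrite inE /window /= in_itv /= -ler_norml.
  by rewrite ltW // truncnS_gt.
(* A left endpoint in [D] just outside [window m]; the window [m.+1] then contains every interval
   [[a, x]] in use. *)
have [a /andP[am1 am] Da] := ae_dense (ltac:(by rewrite ltrN2 ltr_nat) : - m.+1%:R < - m%:R :> R) Dae.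
pose f1 x := \1_(window m.+1) x * f x.
have h1 : \forall x \ae leb, a < x < m.+1%:R -> \int[leb]_(t in `[a, x]) f1 t = 0.
  apply: filterS Dae => x Dx /andP[ax /ltW xm]; rewrite -(D0 a x Da Dx (ltW ax)).
  apply: eq_Rintegral => t; rewrite inE /= in_itv /= => /andP[ta tx].
  rewrite /f1 indicE mem_set ?mul1r // /window /= in_itv /=.
  by rewrite (le_trans tx xm) (le_trans (ltW am1) ta).
apply: filterS (ae_zero_of_primitive (fi m.+1) h1) => x hx.
rewrite inE /window /= in_itv /= => /andP[x1 x2].
have xm : x <= m.+1%:R by rewrite (le_trans x2) // ler_nat.
have := hx; rewrite /f1 indicE mem_set ?mul1r; last first.
  by rewrite /window /= in_itv /= xm (le_trans _ x1) // lerN2 ler_nat.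
by apply; rewrite (lt_le_trans am x1) (le_lt_trans x2) // ltr_nat.
Qed.

Lemma cintegrable_itv (u : H) (a b : R) : cintegrable leb `[a, b] (L2fun u).
Proof.
pose n := (Num.truncn (`|a| + `|b|)).+1.
have nab : `|a| + `|b| <= n%:R by rewrite ltW // truncnS_gt.
have sub x : (`[a, b]%classic : set R) x -> \1_(window n) x = 1 :> R.
  rewrite /= in_itv /= => /andP[ax xb]; rewrite indicE mem_set // /window /= in_itv /= -ler_norml.
  apply: le_trans nab; rewrite ler_norml; apply/andP; split.
  - apply: le_trans ax; rewrite lerNl (le_trans (ler_norm (- a))) // normrN lerDl.
    exact: normr_ge0.
  - by apply: le_trans xb _; rewrite (le_trans (ler_norm b)) // lerDr.
have mab : measurable (`[a, b]%classic : set R) by exact: measurable_itv.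
have [i1 i2] := cintegrable_chi n u; split.
- have := @integrableS _ _ _ leb setT _ _ measurableT mab (@subsetT _ _) i1.
  apply: eq_integrable => // x; rewrite inE => /sub E.
  by rewrite ReM /= mul0r subr0 E mul1r.
- have := @integrableS _ _ _ leb setT _ _ measurableT mab (@subsetT _ _) i2.
  apply: eq_integrable => // x; rewrite inE => /sub E.
  by rewrite ImM /= mul0r addr0 E mul1r.
Qed.

(** The two primitives agree with [u], hence with each other, on a conull set, so [v] and [w] have
    equal integrals between any of its points. This makes the choice in [momentum] unambiguous. *)
Lemma momentum_unique (u v w : H) : is_momentum u v -> is_momentum u w -> v = w.
Proof.
move=> [g1 [g1u g1P]] [g2 [g2u g2P]].
have Dae : \forall x \ae leb, g1 x = L2fun u x /\ g2 x = L2fun u x.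
  by apply: filterS2 g1u g2u => x -> ->.
have E a b : (g1 a = L2fun u a /\ g2 a = L2fun u a) -> (g1 b = L2fun u b /\ g2 b = L2fun u b) ->
    a <= b -> cintegral leb `[a, b] (L2fun v) = cintegral leb `[a, b] (L2fun w).
  move=> [a1 a2] [b1 b2] ab; have imu0 : (imu : R[i]) != 0.
    by rewrite eq_complex /= oner_eq0 andbF.
  by apply: (mulfI imu0); rewrite -[LHS]g1P // -[RHS]g2P // a1 a2 b1 b2.
have re : \forall x \ae leb, Rez (L2fun v x) - Rez (L2fun w x) = 0.
  apply: (ae_zero_of_integral_itv _ Dae) => [n|a b Da Db ab].
    have [i1 _] := cintegrable_chi n v; have [i2 _] := cintegrable_chi n w.
    have := integrableB measurableT i1 i2; apply: eq_integrable => // x _.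
    by rewrite !ReM /= !mul0r !subr0 -EFinB -mulrBr.
  rewrite RintegralB //; last 2 first.
  - by have [] := cintegrable_itv v a b.
  - by have [] := cintegrable_itv w a b.
  by have := congr1 (@complex.Re R) (E a b Da Db ab) => /= h; rewrite /Rintegral h subrr.
have im : \forall x \ae leb, Imz (L2fun v x) - Imz (L2fun w x) = 0.
  apply: (ae_zero_of_integral_itv _ Dae) => [n|a b Da Db ab].
    have [_ i1] := cintegrable_chi n v; have [_ i2] := cintegrable_chi n w.
    have := integrableB measurableT i1 i2; apply: eq_integrable => // x _.
    by rewrite !ImM /= !mul0r !addr0 -EFinB -mulrBr.
  rewrite RintegralB //; last 2 first.
  - by have [] := cintegrable_itv v a b.
  - by have [] := cintegrable_itv w a b.
  by have := congr1 (@complex.Im R) (E a b Da Db ab) => /= h; rewrite /Rintegral h subrr.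
apply: L2fun_inj; apply: filterS2 re im => x /eqP; rewrite subr_eq0 => /eqP h1 /eqP.
by rewrite subr_eq0 => /eqP h2; rewrite (complexE_ReIm (L2fun v x)) h1 h2 -complexE_ReIm.
Qed.

Lemma momentumE (u v : H) : is_momentum u v -> momentum u = v.
Proof.
move=> uv; have ex : exists w, is_momentum u w by exists v.
exact: momentum_unique (xgetPex 0 ex) uv.
Qed.

(** Multiplying the integral by [imu * k], instead of dividing the right-hand side, includes
    [k = 0]. *)
Lemma cintegral_expi (k a b : R) : a <= b ->
  imu * (k%:C * cintegral leb `[a, b] (fun x => expi (k * x))) = expi (k * b) - expi (k * a).
Proof.
rewrite le_eqVlt => /predU1P[<-|ab].
  rewrite set_itv1 /cintegral !integral_set1 subrr.
  by rewrite (_ : _ +i* _ = 0) ?mulr0.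
have cc : continuous (fun x : R => cos (k * x)).
  move=> x; have : {for x, continuous (cos \o (fun y : R => k * y))}.
    apply: continuous_comp; last exact: continuous_cos.
    by apply: cvgM; [exact: cvg_cst|exact: cvg_id].
  exact.
have cs : continuous (fun x : R => sin (k * x)).
  move=> x; have : {for x, continuous (sin \o (fun y : R => k * y))}.
    apply: continuous_comp; last exact: continuous_sin.
    by apply: cvgM; [exact: cvg_cst|exact: cvg_id].
  exact.
have ci (h : R -> R) : continuous h -> leb.-integrable `[a, b] (EFin \o h).
  move=> ch; apply: continuous_compact_integrable; first exact: segment_compact.
  exact: continuous_subspaceT.
have ftc (F f : R -> R) : continuous f -> continuous F ->
    (forall x : R, is_derive x (1 : R) F (k * f x)) -> k * \int[leb]_(x in `[a, b]) f x = F b - F a.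
  move=> cf cF dF; rewrite -RintegralZl //; last exact: ci.
  rewrite /Rintegral (@continuous_FTC2 _ (fun x => k * f x) F a b ab) //.
  - by apply: continuous_subspaceT => x; apply: cvgM; [exact: cvg_cst|exact: cf].
  - split.
    + by move=> x _; exact: ex_derive.
    + exact/cvg_at_right_filter/cF.
    + exact/cvg_at_left_filter/cF.
  - by move=> x _; rewrite derive1E; exact: derive_val.
have h1 : k * \int[leb]_(x in `[a, b]) cos (k * x) = sin (k * b) - sin (k * a).
  apply: (ftc (fun x => sin (k * x))) => // x.
  by apply: is_derive_eq; rewrite /GRing.scale /=; ring.
have h2 : k * \int[leb]_(x in `[a, b]) sin (k * x) = - (cos (k * b) - cos (k * a)).
  have -> : - (cos (k * b) - cos (k * a)) = (- cos (k * b)) - (- cos (k * a)) by ring.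
  apply: (ftc (fun x => - cos (k * x))) => //.
    by move=> x; apply: cvgN; exact: cc.
  by move=> x; apply: is_derive_eq; rewrite /GRing.scale /=; ring.
rewrite /Rintegral in h1 h2.
apply/eqP; rewrite eq_complex /=.
rewrite !(mul0r, mul1r, addr0, add0r, subr0, sub0r) h1 h2.
by rewrite opprK !eqxx.
Qed.

End ConullPoints.

(** * The momentum of a Sobolev function *)

Section MomentumExistence.
Context {R : realType}.
Notation leb := (@lebesgue_measure R).
Notation H := (L2 leb).
Notation mR := (measurableTypeR R).

Lemma cmeasurable_transform (r : R) (h : mR -> R[i]) : cmeasurable h ->
  cmeasurable (fun k : mR => cintegral leb setT (fun x => expi (r * (k * x)) * h x)).
Proof.
move=> mh; apply: (@cmeasurable_cintegral_snd _ _ mR mR _ leb (fun z : mR * mR =>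
  expi (r * (z.2 * z.1)) * h z.1)).
apply: cmeasurableM; last exact: (@cmeasurable_fst _ _ mR mR _ _ mh).
apply: cmeasurable_expi; apply: measurable_funM => //.
by apply: measurable_funM; [exact: measurable_snd|exact: measurable_fst].
Qed.

Lemma cintegrable_transform (r k : R) (h : mR -> R[i]) : cintegrable leb setT h ->
  cintegrable leb setT (fun x => expi (r * (k * x)) * h x).
Proof.
move=> hi; have mK : cmeasurable (fun x : R => expi (r * (k * x))).
  by apply: cmeasurable_expi; apply: measurable_funM => //; exact: measurable_funM.
by apply: (@cintegrableM_bounded _ _ R leb _ _ 1 mK) => // x; rewrite cnorm_expi.
Qed.

(** By inversion, the increment of [u] over [[a, b]] pairs its transform with
    [expi (k * b) - expi (k * a)]. This difference is [imu * k] times the conjugate transform of the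
    indicator of [[a, b]], and adjunction converts the pairing into the integral of [momentum_vec u]
    over [[a, b]]. *)
Lemma is_momentum_vec (s : R) (u : H) : 1 <= s -> in_sobolev s u ->
  is_momentum u (momentum_vec u).
Proof.
move=> s1 us; have e1 : (1 : R) ^+ 2 = 1 by rewrite expr1n.
have e2 : (- 1 : R) ^+ 2 = 1 by rewrite sqrrN expr1n.
pose c : R[i] := (Num.sqrt (2 * pi))^-1%:C.
have ui := cintegrable_sobolev s1 us.
pose T (x : R) := cintegral leb setT (fun k => expi (1 * (x * k)) * L2fun (fourier u) k).
exists (fun x => c * T x); split.
  have := fourier_sgn_integrable e1 ui; rewrite fourier_sgnK //.
  exact: ae_eq_sym.
move=> a b ab.
have mab : measurable (`[a, b]%classic : set R) by exact: measurable_itv.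
pose I (x : mR) : R[i] := (\1_(`[a, b]%classic : set R) x)%:C.
have mI : cmeasurable I by exact: cmeasurable_indic.
have iI : cintegrable leb setT I by apply: cintegrable_real; exact: integrable_indic_itv.
have sI : sq_integrable leb I.
  split => //; under eq_integral do rewrite abs2_real indicE.
  have -> : (\int[leb]_x (((x \in (`[a, b]%classic : set R))%:R : R) ^+ 2)%:E =
      \int[leb]_x (\1_(`[a, b]%classic : set R) x)%:E)%E.
    by apply: eq_integral => x _; rewrite indicE; case: (_ \in _); rewrite ?expr1n ?expr0n.
  by apply: integrable_lty => //; exact: integrable_indic_itv.
have E1 : cintegral leb `[a, b] (L2fun (momentum_vec u)) = inner (toL2 leb I) (momentum_vec u).
  rewrite (L2fun_ae (toL2E sI) (aeW _ (fun=> erefl)) mI (cmeasurable_L2fun _)).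
  by rewrite [LHS]cintegral_mkcond //; apply: eq_cintegral => x; rewrite conj_real.
pose F (k : mR) := cintegral leb setT (fun x => expi (-1 * (k * x)) * I x).
have mF : cmeasurable (fun k => c * F k).
  exact: cmeasurableM (cmeasurable_cst _) (cmeasurable_transform _ mI).
have iL : cintegrable leb setT (L2fun (toL2 leb I)).
  exact: ae_cintegrable (cmeasurable_L2fun _) (ae_eq_sym (toL2E sI)) iI.
have FI : \forall k \ae leb, L2fun (fourier_sgn (-1) (toL2 leb I)) k = c * F k.
  apply: filterS (fourier_sgn_integrable e2 iL) => k ->; congr (_ * _).
  apply: ae_eq_cintegral.
  - exact: cintegrable_cmeasurable (cintegrable_transform _ _ iL).
  - exact: cintegrable_cmeasurable (cintegrable_transform _ _ iI).
  - by apply: filterS (toL2E sI) => x ->.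
have sy := sq_integrable_momentum s1 us.
rewrite E1 /momentum_vec /fourier_inv fourier_sgn_adj //.
have [my _] := sy.
rewrite (L2fun_ae FI (toL2E sy) mF my).
have E2 k : imu * (k%:C * conjc (F k)) = expi (k * b) - expi (k * a).
  rewrite -(cintegral_expi k ab); congr (_ * (_ * _)).
  rewrite /F -cintegral_conj; last exact: cintegrable_transform.
  rewrite [RHS]cintegral_mkcond //; apply: eq_cintegral => x.
  by rewrite conjcM conj_real -expiN mulrC; congr (_ * expi _); ring.
have iT x : cintegrable leb setT (fun k => expi (1 * (x * k)) * L2fun (fourier u) k).
  exact: cintegrable_transform.
rewrite -mulrBr /T -cintegralB //.
have iB := cintegrableB (iT b) (iT a).
have iP : cintegrable leb setT (fun k => conjc (c * F k) * (k%:C * L2fun (fourier u) k)).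
  apply: ae_cintegrable (sq_integrable_inner (L2fun_sq (fourier_sgn (-1) (toL2 leb I))) sy).
    by apply: cmeasurableM => //; exact: cmeasurable_conj.
  apply: filterS FI => k h.
  exact: (congr1 (fun z => conjc z * (k%:C * L2fun (fourier u) k)) h).
rewrite -cintegralZ //.
rewrite -cintegralZ //.
apply: eq_cintegral => k.
suff : imu * (conjc (c * F k) * (k%:C * L2fun (fourier u) k)) =
   c * (expi (1 * (b * k)) * L2fun (fourier u) k - expi (1 * (a * k)) * L2fun (fourier u) k).
  exact: esym.
rewrite -mulrBl !mul1r (mulrC b) (mulrC a) -E2 conjcM conj_real.
by ring.
Qed.

Lemma momentum_sobolev (s : R) (u : H) : 1 <= s -> in_sobolev s u ->
  inner u (momentum u) = (\int[leb]_k (k * abs2 (L2fun (fourier u) k)))%:C.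
Proof.
by move=> s1 us; rewrite (momentumE (is_momentum_vec s1 us)) (inner_momentum_vec s1 us).
Qed.

End MomentumExistence.

(** * Localization forms along the free evolution *)

Section Decay.
Context {R : realType}.
Notation leb := (@lebesgue_measure R).

Lemma jap_ge1 (x : R) : 1 <= jap x.
Proof. by rewrite /jap -[leLHS]sqrtr1 ler_wsqrtr // lerDl sqr_ge0. Qed.

(** Allows comparison of powers of [jap x] with powers of [x + 1], which have an elementary
    primitive. *)
Lemma jap_geD1 (x : R) : 0 <= x -> x + 1 <= 2 * jap x.
Proof.
move=> x0; have j1 := jap_ge1 x.
have : x <= jap x by rewrite /jap -[leLHS](ger0_norm x0) -sqrtr_sqr ler_wsqrtr // lerDr.
lra.
Qed.

Variable rho : R.
Hypothesis rho1 : 1 < rho.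

Let rho0 : 0 < rho. Proof. exact: lt_trans rho1. Qed.

Let f (x : R) := (x + 1) `^ (- rho).
Let F (x : R) := - ((rho - 1)^-1 * (x + 1) `^ (1 - rho)).

Let Fy : F x @[x --> +oo] --> (0 : R).
Proof.
have c0 : 0 < rho - 1 by rewrite subr_gt0.
rewrite -[X in _ --> X]oppr0; apply: cvgN; rewrite -(mulr0 (rho - 1)^-1).
apply: cvgM; first exact: cvg_cst.
have h : (rho - 1) * ln (x + 1) @[x --> +oo] --> +oo.
  apply/cvgryPge => A; exists (expR (A / (rho - 1))); split; first exact: num_real.
  move=> x hx; rewrite -ler_pdivrMl // mulrC -[leLHS]expRK ler_ln ?posrE ?expR_gt0 //.
    by rewrite (le_trans (ltW hx)) // lerDl.
  by rewrite ltr_wpDl // ltW // (lt_trans (expR_gt0 _) hx).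
apply: (@cvg_trans _ (expR (- ((rho - 1) * ln (x + 1))) @[x --> +oo])).
  apply: near_eq_cvg; exists 0; split; first exact: num_real.
  move=> x x0; rewrite /powR gt_eqF; last by rewrite addr_gt0.
  by congr expR; ring.
by apply: (@cvg_comp _ _ _ _ (fun y => expR (- y)) _ (pinfty_nbhs R) _ h); exact: cvgr_expR.
Qed.

Lemma integral_D1_powR : (\int[leb]_(x in `[0%R, +oo[) ((x + 1) `^ (- rho))%:E = ((rho - 1)^-1)%:E)%E.
Proof.
have c0 : rho - 1 != 0 by rewrite gt_eqF // subr_gt0.
have dF (x : R) : -1 < x -> is_derive x (1 : R) F (f x).
  move=> x1; have x0 : 0 < x + 1 by rewrite -ltrBlDr sub0r.
  have h := is_derive1_powR (1 - rho) x0.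
  have h2 : is_derive x (1 : R) (fun y : R => y + 1) 1.
    by apply: is_derive_eq; rewrite addr0.
  have h3 := @is_derive1_comp _ (fun y : R => y `^ (1 - rho)) (fun y : R => y + 1) x _ _ h h2.
  apply: is_derive_eq; rewrite /GRing.scale /=.
  rewrite (_ : 1 - rho - 1 = - rho); last by ring.
  rewrite /f; field; exact: c0.
have cF (x : R) : -1 < x -> {for x, continuous F}.
  by move=> x1; apply: differentiable_continuous; exact/derivable1_diffP/(@ex_derive _ _ _ _ _ _ _ (dF x x1)).
have F0 : F 0 = - (rho - 1)^-1 by rewrite /F (add0r 1) powR1 mulr1.
apply: etrans (@ge0_continuous_FTC2y _ f F 0 0 _ _ Fy _ _ _) _.
- by move=> x _; exact: powR_ge0.
- apply: continuous_in_subspaceT => x; rewrite inE /= in_itv /= andbT => x0.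
  have x1 : 0 < x + 1 by rewrite ltr_wpDl.
  have h := is_derive1_powR (- rho) x1.
  apply: (@continuous_comp _ _ _ (fun y : R => y + 1) (fun y : R => y `^ (- rho))).
    by apply: cvgD; [exact: cvg_id|exact: cvg_cst].
  by apply: differentiable_continuous; exact/derivable1_diffP/(@ex_derive _ _ _ _ _ _ _ h).
- move=> x x0; apply: (@ex_derive _ _ _ _ _ _ _ (dF x _)); lra.
- by apply: cvg_at_right_filter; apply: cF; lra.
- move=> x; rewrite in_itv /= andbT => x0; rewrite derive1E.
  by apply: (@derive_val _ _ _ _ _ _ _ (dF x _)); lra.
- by rewrite F0 -EFinB sub0r opprK.
Qed.

Lemma measurable_jap_powR : measurable_fun setT (fun x : R => jap x `^ (- rho)).
Proof.
have h := @measurable_jap R (- rho / 2) setT.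
rewrite (_ : 2 * (- rho / 2) = - rho) in h; last by field.
exact/measurable_EFinP.
Qed.

Lemma integrable_jap : leb.-integrable setT (EFin \o (fun x => jap x `^ (- rho))).
Proof.
apply: integrable_ge0P.
- by move=> x; exact: powR_ge0.
- exact: measurable_jap_powR.
have mf : measurable_fun setT f.
  apply: (@measurableT_comp _ _ _ _ _ _ (fun y : R => y `^ (- rho))); first exact: measurable_powR.
  exact: measurable_funD.
rewrite ge0_symfun_integralT //; last 3 first.
- by move=> x; exact: powR_ge0.
- move=> x; have h := is_derive1_powR (- rho) (lt_le_trans ltr01 (jap_ge1 x)).
  apply: (@continuous_comp _ _ _ (@jap R) (fun y : R => y `^ (- rho))).
    apply: (@continuous_comp _ _ _ (fun y : R => 1 + y ^+ 2) Num.sqrt); last exact: sqrt_continuous.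
    apply: cvgD; first exact: cvg_cst.
    by rewrite expr2; under eq_fun do rewrite expr2; apply: cvgM; exact: cvg_id.
  by apply: differentiable_continuous; exact/derivable1_diffP/(@ex_derive _ _ _ _ _ _ _ h).
- by move=> x; rewrite /= /jap sqrrN.
have -> : [set x : R | 0 <= x] = `[0%R, +oo[%classic.
  by apply/seteqP; split => x /=; rewrite in_itv /= andbT.
rewrite lte_mul_pinfty //.
apply: (@le_lt_trans _ _ (\int[leb]_(x in `[0%R, +oo[) ((2 `^ rho)%:E * (f x)%:E))%E).
  apply: ge0_le_integral => //.
  - by move=> x _; rewrite lee_fin powR_ge0.
  - by apply/measurable_EFinP/measurable_funTS; exact: measurable_jap_powR.
  - by apply: measurable_funeM; apply/measurable_EFinP/measurable_funTS.
  - move=> x; rewrite /= in_itv /= andbT => x0; rewrite -EFinM lee_fin /f !powRN.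
    have h : (x + 1) `^ rho <= 2 `^ rho * jap x `^ rho.
      rewrite -powRM ?sqrtr_ge0 //; apply: ge0_ler_powR; rewrite ?nnegrE ?(ltW rho0) //.
      - by rewrite addr_ge0.
      - by rewrite mulr_ge0 // sqrtr_ge0.
      - exact: jap_geD1.
    have p1 : 0 < jap x `^ rho by rewrite powR_gt0 // (lt_le_trans ltr01) // jap_ge1.
    have p2 : 0 < (x + 1) `^ rho by rewrite powR_gt0 // ltr_wpDl.
    by rewrite ler_pdivlMr // mulrC ler_pdivrMr.
rewrite ge0_integralZl //; last 2 first.
- by apply/measurable_EFinP/measurable_funTS.
- by move=> x _; rewrite lee_fin powR_ge0.
by rewrite integral_D1_powR -EFinM ltry.
Qed.

End Decay.

Section Reflection.
Context {R : realType}.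
Notation leb := (@lebesgue_measure R).

Lemma Rintegral_subC (c : R) (f : R -> R) : leb.-integrable setT (EFin \o f) ->
  leb.-integrable setT (EFin \o (fun x => f (c - x))) /\
  \int[leb]_x f (c - x) = \int[leb]_x f x.
Proof.
move=> fi; have [i1 e1] := integral_affine c ltr01 fi.
have [i2 e2] := integral_reflection i1.
have E x : f (1 * - x + c) = f (c - x) by rewrite mul1r addrC.
split; first by move: i2; under eq_fun do rewrite E.
by rewrite e1 mul1r -e2; apply: eq_Rintegral => x _; rewrite E.
Qed.

End Reflection.

Section Heaviside.
Context {R : realType}.
Notation leb := (@lebesgue_measure R).

Definition heaviside (t : R) : R := \1_(`[0, +oo[%classic : set R) t.

Lemma measurable_heaviside : measurable_fun setT heaviside.
Proof. by apply: measurable_indic; exact: measurable_itv. Qed.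

Lemma heaviside01 t : 0 <= heaviside t <= 1.
Proof. by rewrite /heaviside indicE; case: (_ \in _); rewrite ?lexx ?ler01. Qed.

Let heavisideE t : heaviside t = (0 <= t)%R%:R.
Proof.
rewrite /heaviside indicE; congr (nat_of_bool _)%:R.
by apply/idP/idP; rewrite inE /= in_itv /= andbT.
Qed.

(** [A] is the interval between 0 and [l], open on the left and closed on the right, so that the
    identity holds at every [k], endpoints included. *)
Lemma heaviside_sub (l : R) : exists A : set R, [/\ measurable A,
  leb.-integrable setT (EFin \o \1_A), \int[leb]_k \1_A k = `|l|,
  forall k, k \in A -> `|k| <= `|l| &
  forall k, heaviside (l - k) - heaviside (- k) = Num.sg l * \1_A k].
Proof.
have int (a b : R) : a <= b -> \int[leb]_k \1_(`]a, b]%classic : set R) k = b - a.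
  move=> ab; rewrite /Rintegral integral_indic ?setIT; [|exact: measurableT|exact: measurable_itv].
  suff E : leb (`]a, b]%classic : set R) = (b - a)%:E by exact: (congr1 fine E).
  apply: etrans (lebesgue_measure_itv `]a, b]%R) _.
  rewrite /= lte_fin; case: ltP => //= ba.
  by rewrite (le_anti (introT andP (conj ab ba))) subrr.
have [l0|l0|<-] := ltgtP 0 l.
- exists (`]0, l]%classic : set R); split.
  + exact: measurable_itv.
  + exact: integrable_indic_itv.
  + by rewrite int ?ltW // subr0 gtr0_norm.
  + move=> k; rewrite inE /= in_itv /= => /andP[k1 k2].
    by rewrite !gtr0_norm.
  + move=> k; rewrite !heavisideE gtr0_sg // mul1r indicE subr_ge0 oppr_ge0.
    have -> : (k \in (`]0, l]%classic : set R)) = (0 < k <= l).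
      by apply/idP/idP; rewrite inE /= in_itv.
    by case: (leP k l) => h1; case: (leP k 0) => h2 /=; rewrite ?subrr ?subr0 //; lra.
- exists (`]l, 0]%classic : set R); split.
  + exact: measurable_itv.
  + exact: integrable_indic_itv.
  + by rewrite int ?ltW // sub0r ltr0_norm.
  + move=> k; rewrite inE /= in_itv /= => /andP[k1 k2].
    by rewrite ler0_norm // ltr0_norm // lerN2 ltW.
  + move=> k; rewrite !heavisideE ltr0_sg // mulN1r indicE subr_ge0 oppr_ge0.
    have -> : (k \in (`]l, 0]%classic : set R)) = (l < k <= 0).
      by apply/idP/idP; rewrite inE /= in_itv.
    by case: (leP k l) => h1; case: (leP k 0) => h2 /=; rewrite ?subrr ?subr0 ?sub0r ?oppr0 //; lra.
- exists set0; split => //.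
  + by rewrite indic0; exact: integrable0.
  + by rewrite indic0 /Rintegral integral0 normr0.
  + by move=> k; rewrite inE.
  + by move=> k; rewrite sub0r subrr sgr0 mul0r.
Qed.

End Heaviside.

(** * Forms of a symbol and their integrals over time *)

Section Symbol.
Context {R : realType}.
Notation leb := (@lebesgue_measure R).
Notation H := (L2 leb).
Notation mR := (measurableTypeR R).
Variables (g : R -> R) (M delta : R).
Hypothesis mg : measurable_fun setT g.
Hypothesis g0 : forall x, 0 <= g x.
Hypothesis gM : forall x, g x <= M.
Hypothesis gi : leb.-integrable setT (EFin \o g).
Hypothesis delta0 : 0 < delta.
Hypothesis g1 : forall x, - delta < x < delta -> g x = 1.

Notation F u := (fun k => abs2 (L2fun (fourier u) k)).

Lemma form_lipschitz (B : H -> H) (C : R) (U V : H) : (forall w z, B w - B z = B (w - z)) ->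
  (forall w, norm2 (B w) <= C * norm2 w) ->
  cnorm (inner U (B U) - inner V (B V)) <= C * (norm2 U + norm2 V) * norm2 (U - V).
Proof.
move=> BB BC.
have -> : inner U (B U) - inner V (B V) = inner (U - V) (B U) + inner V (B (U - V)).
  by rewrite -BB innerBl innerBr; ring.
apply: le_trans (cnormD _ _) _; rewrite mulrDr mulrDl; apply: lerD.
- apply: le_trans (cauchy_schwarz _ _) _.
  by rewrite mulrC ler_wpM2r ?norm2_ge0.
- apply: le_trans (cauchy_schwarz _ _) _.
  apply: le_trans (ler_wpM2l (norm2_ge0 _) (BC (U - V))) _.
  by rewrite mulrCA mulrA.
Qed.

Definition symbol_form (r : R) (u : H) : R := \int[leb]_k (g (k / r) * abs2 (L2fun (fourier u) k)).

Let M0 : 0 <= M. Proof. exact: le_trans (g0 0) (gM 0). Qed.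

Let mgr (r : R) : measurable_fun setT (fun k : R => g (k / r)).
Proof.
have m : measurable_fun setT (fun k : R => k / r) by exact: measurable_funM.
exact: (measurableT_comp mg m).
Qed.

Let mF (u : H) : measurable_fun setT (F u).
Proof. by apply: measurable_fun_abs2; exact: cmeasurable_L2fun. Qed.

Let iF (u : H) : leb.-integrable setT (EFin \o F u).
Proof. exact: integrable_abs2 (L2fun_sq _). Qed.

Lemma integral_fourier_abs2 (u : H) : \int[leb]_k abs2 (L2fun (fourier u) k) = norm2 u ^+ 2.
Proof.
have s2 : (-1 : R) ^+ 2 = 1 by rewrite sqrrN expr1n.
by rewrite -[in RHS](norm2_fourier_sgn s2) sqr_norm2.
Qed.

Let sq_symbol (r : R) (v : H) : sq_integrable leb (fun k => (g (k / r))%:C * L2fun v k).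
Proof.
have mK : cmeasurable (fun k : R => (g (k / r))%:C) by apply: cmeasurable_real; exact: mgr.
apply: (@sq_integrableM_bounded _ _ R leb _ _ M mK _ (L2fun_sq v)) => k.
by rewrite cnorm_real ger0_norm.
Qed.

(** Dilations preserve null sets, so [f] may be exchanged for [g] at every scale [r]; from here on
    the forms are real. *)
Lemma inner_funP (f : R -> R[i]) (r : R) (u : H) : cmeasurable f ->
  (\forall x \ae leb, f x = (g x)%:C) -> 0 < r ->
  inner u (Defs.funP (fun k => f (k / r)) u) = (symbol_form r u)%:C.
Proof.
move=> mf fg r0; have e1 : (1 : R) ^+ 2 = 1 by rewrite expr1n.
have ri : 0 < r^-1 by rewrite invr_gt0.
have fgr : \forall k \ae leb, f (k / r) = (g (k / r))%:C.
  by apply: filterS (ae_scaling ri fg) => k; rewrite mulrC.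
have mfr : cmeasurable (fun k : R => f (k / r)).
  have m : measurable_fun setT (fun k : R => k / r) by exact: measurable_funM.
  by case: mf => m1 m2; split; [exact: (measurableT_comp m1 m)|exact: (measurableT_comp m2 m)].
have fgL : \forall k \ae leb, f (k / r) * L2fun (fourier u) k = (g (k / r))%:C * L2fun (fourier u) k.
  by apply: filterS fgr => k ->.
have mp := cmeasurableM mfr (cmeasurable_L2fun (fourier u)).
have sg := sq_symbol r (fourier u).
have sf : sq_integrable leb (fun k => f (k / r) * L2fun (fourier u) k).
  split; first exact: mp.
  have [mgg lt] := sg.
  by rewrite (@integral_abs2_ae _ _ R leb _ _ mp mgg fgL).
rewrite /Defs.funP /fourier_inv fourier_sgn_adj // -[fourier_sgn _ u]/(fourier u).
rewrite /mulQ (eq_toL2 sf sg fgL) (L2fun_ae (aeW _ (fun=> erefl)) (toL2E sg)); last 2 first.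
- exact: cmeasurable_L2fun.
- by case: sg.
rewrite -cintegral_real; apply: eq_cintegral => k.
by rewrite mulrCA mul_conj_abs2 -rmorphM.
Qed.

Lemma symbol_form_ge0 r u : 0 <= symbol_form r u.
Proof. by apply: Rintegral_ge0 => k _; rewrite mulr_ge0 ?abs2_ge0. Qed.

(** The operator is multiplication by [g (k / r)] on the Fourier side, bounded by [M] at every
    scale; hence a constant independent of [r]. *)
Lemma symbol_form_lipschitz (r : R) (u v : H) :
  `|symbol_form r u - symbol_form r v| <= M * (norm2 u + norm2 v) * norm2 (u - v).
Proof.
have s2 : (-1 : R) ^+ 2 = 1 by rewrite sqrrN expr1n.
pose B (w : H) : H := toL2 leb (fun k => (g (k / r))%:C * L2fun w k).
have Bae w : \forall k \ae leb, L2fun (B w) k = (g (k / r))%:C * L2fun w k.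
  exact: toL2E (sq_symbol r w).
have B_norm w : norm2 (B w) <= M * norm2 w.
  rewrite -(@ler_pXn2r _ 2) ?nnegrE ?mulr_ge0 ?norm2_ge0 // -lee_fin exprMn [leRHS]EFinM !EFin_sqr_norm2.
  have [mB _] := sq_symbol r w.
  rewrite (@integral_abs2_ae _ _ R leb _ _ (cmeasurable_L2fun _) mB (Bae w)).
  rewrite -ge0_integralZl_EFin ?sqr_ge0 //; last 2 first.
  - by move=> x _; rewrite lee_fin abs2_ge0.
  - exact: (measurable_abs2 (cmeasurable_L2fun w)).
  apply: ge0_le_integral => //.
  - by move=> x _; rewrite lee_fin abs2_ge0.
  - exact/measurable_EFinP/measurable_fun_abs2.
  - by apply: measurable_funeM; exact: (measurable_abs2 (cmeasurable_L2fun w)).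
  - move=> x _; rewrite -EFinM lee_fin abs2M abs2_real ler_wpM2r ?abs2_ge0 //.
    by rewrite lerXn2r ?nnegrE.
have BB w z : B w - B z = B (w - z).
  apply: L2fun_inj; apply: ae_eq_trans (L2funB (B w) (B z)) _.
  apply: ae_eq_sym; apply: ae_eq_trans (Bae (w - z)) _.
  have h1 := Bae w; have h2 := Bae z.
  by apply: filterS3 h1 h2 (L2funB w z) => k -> -> ->; rewrite mulrBr.
have E w : inner (fourier w) (B (fourier w)) = (symbol_form r w)%:C.
  have [mB _] := sq_symbol r (fourier w).
  rewrite (L2fun_ae (aeW _ (fun=> erefl)) (Bae (fourier w)) (cmeasurable_L2fun _) mB).
  rewrite -cintegral_real; apply: eq_cintegral => k.
  by rewrite mulrCA mul_conj_abs2 -rmorphM.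
have lF : fourier u - fourier v = fourier (u - v).
  have := fourier_sgn_linear s2 (-1) v u; rewrite !scaleN1r (addrC _ u).
  by rewrite (addrC _ (fourier_sgn (-1) u)).
have nF (w : H) : norm2 (fourier w) = norm2 w by rewrite /fourier norm2_fourier_sgn.
have h := form_lipschitz (fourier u) (fourier v) BB B_norm.
have key (a b : R) : `|a - b| = cnorm (a%:C - b%:C) by rewrite -rmorphB cnorm_real.
have E2 := etrans (key _ _) (congr2 (fun a b => cnorm (a - b)) (esym (E u)) (esym (E v))).
have N3 (a b c a' b' c' : R) : a = a' -> b = b' -> c = c' -> M * (a + b) * c = M * (a' + b') * c'.
  by move=> -> -> ->.
have N := N3 _ _ _ _ _ _ (nF u) (nF v) (etrans (congr1 (@norm2 _ _ R leb) lF) (nF (u - v))).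
exact: (eq_ind _ (fun x => x <= _) (eq_ind _ (fun y => _ <= y) h _ N) _ (esym E2)).
Qed.

Lemma symbol_cvg1 (r_ : nat -> R) (k : R) : (forall n, 0 < r_ n) -> r_ n @[n --> \oo] --> +oo ->
  \forall n \near \oo, `|k| < delta * r_ n.
Proof.
move=> r0 roo; have /cvgryPgt/(_ (`|k| / delta)) := roo.
by apply: filterS => n; rewrite ltr_pdivrMr // mulrC.
Qed.

Lemma symbol_eq1 (r k : R) : 0 < r -> `|k| < delta * r -> g (k / r) = 1.
Proof.
move=> r0; rewrite ltr_norml => /andP[k1 k2]; apply: g1.
by rewrite ltr_pdivlMr // ltr_pdivrMr // mulNr k1.
Qed.

Lemma symbol_form_cvg (r_ : nat -> R) (u : H) : (forall n, 0 < r_ n) ->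
  r_ n @[n --> \oo] --> +oo -> symbol_form (r_ n) u @[n --> \oo] --> norm2 u ^+ 2.
Proof.
move=> r0 roo; rewrite -integral_fourier_abs2.
apply: (@Rintegral_dominated_cvg _ _ _ leb _ _ (fun k => M * abs2 (L2fun (fourier u) k))).
- by move=> n; apply: measurable_funM; [exact: mgr|exact: mF].
- exact: mF.
- apply: aeW => k; apply: cvg_near_cst.
  apply: filterS (symbol_cvg1 k r0 roo) => n hn.
  by rewrite (symbol_eq1 (r0 n) hn) mul1r.
- by have := integrableZl measurableT M (iF u).
- move=> n k; rewrite ger0_norm ?mulr_ge0 ?abs2_ge0 //.
  by rewrite ler_wpM2r ?abs2_ge0.
Qed.

Lemma symbol_form_exp_itQ (r t : R) (u : H) :
  symbol_form r (exp_itQ t u) = \int[leb]_l (g ((l - t) / r) * abs2 (L2fun (fourier u) l)).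
Proof.
suff E : (\int[leb]_k (g (k / r) * abs2 (L2fun (fourier (exp_itQ t u)) k))%:E =
    \int[leb]_l (g ((l - t) / r) * abs2 (L2fun (fourier u) l))%:E)%E.
  exact: (congr1 fine E).
have mt : measurable_fun setT (fun k : R => abs2 (L2fun (fourier u) (k + t))).
  have m : measurable_fun setT (fun k : R => k + t) by exact: measurable_funD.
  exact: (measurableT_comp (mF u) m).
transitivity (\int[leb]_k (g (k / r) * abs2 (L2fun (fourier u) (k + t)))%:E)%E.
  apply: ge0_ae_eq_integral => //.
  - by apply/measurable_EFinP/measurable_funM; [exact: mgr|exact: mF].
  - by apply/measurable_EFinP/measurable_funM => //; exact: mgr.
  - by move=> k _; rewrite lee_fin mulr_ge0 ?abs2_ge0.
  - by move=> k _; rewrite lee_fin mulr_ge0 ?abs2_ge0.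
  - apply: filterS (fourier_exp_itQ t u) => k h _.
    exact: (congr1 (fun z => (g (k / r) * abs2 z)%:E) h).
rewrite -(ge0_integral_translation (- t)
  (f := fun k => (g (k / r) * abs2 (L2fun (fourier u) (k + t)))%:E)) //.
- by apply: eq_integral => l _; rewrite subrK.
- by apply/measurable_EFinP/measurable_funM => //; exact: mgr.
- by move=> k; rewrite lee_fin mulr_ge0 ?abs2_ge0.
Qed.

Let mgd (r : R) : measurable_fun setT (fun z : mR * mR => g ((z.2 - z.1) / r)).
Proof.
have m : measurable_fun setT (fun z : mR * mR => (z.2 - z.1) / r).
  apply: measurable_funM => //.
  by apply: measurable_funB; [exact: measurable_snd|exact: measurable_fst].
exact: (measurableT_comp mg m).
Qed.

Lemma measurable_symbol_form (r : R) (u : H) :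
  measurable_fun setT (fun t : mR => symbol_form r (exp_itQ t u)).
Proof.
under eq_fun do rewrite symbol_form_exp_itQ.
apply: (@measurable_Rintegral_snd _ _ mR mR R leb
  (fun z : mR * mR => g ((z.1 - z.2) / r) * abs2 (L2fun (fourier u) z.1))).
apply: measurable_funM.
  have m : measurable_fun setT (fun z : mR * mR => (z.1 - z.2) / r).
    apply: measurable_funM => //.
    by apply: measurable_funB; [exact: measurable_fst|exact: measurable_snd].
  exact: (measurableT_comp mg m).
have m : measurable_fun setT (fun z : mR * mR => z.1) by exact: measurable_fst.
exact: (measurableT_comp (mF u) m).
Qed.

Lemma integrable_symbol_shift (r l : R) : 0 < r ->
  leb.-integrable setT (EFin \o (fun t => g ((l - t) / r))) /\
  \int[leb]_t g ((l - t) / r) = r * \int[leb]_x g x.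
Proof.
move=> r0; have ri : 0 < r^-1 by rewrite invr_gt0.
have [i1 e1] := integral_affine 0 ri gi.
have [i2 e2] := Rintegral_subC l i1.
have E t : g (r^-1 * (l - t) + 0) = g ((l - t) / r) by rewrite addr0 mulrC.
split; first by move: i2; under eq_fun do rewrite E.
rewrite e1 mulrA mulfV ?gt_eqF // mul1r -e2.
by apply: eq_Rintegral => t _; rewrite E.
Qed.

Section weight.
Variable p : R -> R.
Hypothesis mp : measurable_fun setT p.
Hypothesis p01 : forall t, 0 <= p t <= 1.

(** The kernel [K_r], for a general weight: the Heaviside function, its complement and the constant
    1 all occur. *)
Definition window_symbol (r l : R) : R := \int[leb]_t (p t * g ((l - t) / r)).

Let p0 t : 0 <= p t. Proof. by have /andP[] := p01 t. Qed.

Let mpg (r l : R) : measurable_fun setT (fun t : R => p t * g ((l - t) / r)).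
Proof.
apply: measurable_funM => //.
have m : measurable_fun setT (fun t : R => (l - t) / r).
  by apply: measurable_funM => //; exact: measurable_funB.
exact: (measurableT_comp mg m).
Qed.

Lemma integrable_window_symbol (r l : R) : 0 < r ->
  leb.-integrable setT (EFin \o (fun t => p t * g ((l - t) / r))).
Proof.
move=> r0; have [h _] := integrable_symbol_shift l r0.
apply: (le_integrable _ _ _ h) => //; first by apply/measurable_EFinP; exact: mpg.
move=> t _ /=; rewrite lee_fin !ger0_norm ?mulr_ge0 // ler_piMl //.
by have /andP[] := p01 t.
Qed.

Lemma window_symbol_bound (r l : R) : 0 < r ->
  0 <= window_symbol r l <= r * \int[leb]_x g x.
Proof.
move=> r0; have [h <-] := integrable_symbol_shift l r0; apply/andP; split.
  by apply: Rintegral_ge0 => t _; rewrite mulr_ge0.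
apply: le_Rintegral => //; first exact: integrable_window_symbol.
by move=> t _; rewrite ler_piMl //; have /andP[] := p01 t.
Qed.

Let mK (r : R) : measurable_fun setT (window_symbol r).
Proof.
apply: (@measurable_Rintegral_snd _ _ mR mR R leb (fun z : mR * mR => p z.1 * g ((z.2 - z.1) / r))).
apply: measurable_funM; last exact: mgd.
have m : measurable_fun setT (fun z : mR * mR => z.1) by exact: measurable_fst.
exact: (measurableT_comp mp m).
Qed.

(** An equality of extended reals, so that finiteness of the right-hand side yields integrability in
    [t]. *)
Lemma tonelli_symbol (r : R) (u : H) : 0 < r ->
  (\int[leb]_t (p t * symbol_form r (exp_itQ t u))%:E =
   \int[leb]_l (window_symbol r l * abs2 (L2fun (fourier u) l))%:E)%E.
Proof.
move=> r0.
pose f (z : mR * mR) := (p z.1 * g ((z.2 - z.1) / r) * abs2 (L2fun (fourier u) z.2))%:E.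
have f0 z : (0 <= f z)%E by rewrite lee_fin !mulr_ge0 ?abs2_ge0.
have mf : measurable_fun setT f.
  apply/measurable_EFinP; apply: measurable_funM.
    apply: measurable_funM; last exact: mgd.
    have m : measurable_fun setT (fun z : mR * mR => z.1) by exact: measurable_fst.
    exact: (measurableT_comp mp m).
  have m : measurable_fun setT (fun z : mR * mR => z.2) by exact: measurable_snd.
  exact: (measurableT_comp (mF u) m).
have := @fubini_tonelli _ _ mR mR R leb leb f mf f0.
have -> : (\int[leb]_t \int[leb]_l f (t, l) =
    \int[leb]_t (p t * symbol_form r (exp_itQ t u))%:E)%E.
  apply: eq_integral => t _; rewrite EFinM symbol_form_exp_itQ.
  have mg1 : measurable_fun setT (fun l : mR => (g ((l - t) / r) * abs2 (L2fun (fourier u) l))%:E).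
    apply/measurable_EFinP; apply: measurable_funM; last exact: mF.
    have m : measurable_fun setT (fun l : R => (l - t) / r).
      by apply: measurable_funM => //; exact: measurable_funB.
    exact: (measurableT_comp mg m).
  have i1 : leb.-integrable setT (EFin \o (fun l => g ((l - t) / r) * abs2 (L2fun (fourier u) l))).
    have h := integrableZl measurableT M (iF u).
    apply: (le_integrable _ _ _ h) => //.
    move=> k _ /=; rewrite lee_fin !ger0_norm ?mulr_ge0 ?abs2_ge0 //.
    by rewrite ler_wpM2r ?abs2_ge0.
  rewrite /Rintegral fineK ?integrable_fin_num // -ge0_integralZl //.
  - by apply: eq_integral => l _; rewrite /f /= -EFinM mulrA.
  - by move=> l _; rewrite lee_fin mulr_ge0 ?abs2_ge0.
  - by rewrite lee_fin.
move=> ->; apply: eq_integral => l _.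
rewrite /window_symbol EFinM /Rintegral fineK; last first.
  by apply: integrable_fin_num => //; exact: integrable_window_symbol.
rewrite -ge0_integralZr //.
- by apply/measurable_EFinP; exact: mpg.
- by move=> t _; rewrite lee_fin mulr_ge0.
- by rewrite lee_fin abs2_ge0.
Qed.

Lemma integrable_window_symbolM (r : R) (u : H) : 0 < r ->
  leb.-integrable setT (EFin \o (fun l => window_symbol r l * abs2 (L2fun (fourier u) l))).
Proof.
move=> r0; have h := integrableZl measurableT (r * \int[leb]_x g x) (iF u).
apply: (le_integrable _ _ _ h) => //.
  by apply/measurable_EFinP/measurable_funM; [exact: mK|exact: mF].
move=> l _ /=; have /andP[h1 h2] := window_symbol_bound l r0.
rewrite lee_fin (ger0_norm (mulr_ge0 h1 (abs2_ge0 _))).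
by rewrite (ger0_norm (mulr_ge0 (le_trans h1 h2) (abs2_ge0 _))) ler_wpM2r ?abs2_ge0.
Qed.

Lemma integrable_symbol_form (r : R) (u : H) : 0 < r ->
  leb.-integrable setT (EFin \o (fun t => p t * symbol_form r (exp_itQ t u))).
Proof.
move=> r0; apply: integrable_ge0P.
- by move=> t; rewrite mulr_ge0 ?symbol_form_ge0.
- by apply: measurable_funM => //; exact: measurable_symbol_form.
- rewrite tonelli_symbol //; apply: integrable_lty => //.
  exact: integrable_window_symbolM.
Qed.

Lemma integral_symbol_form (r : R) (u : H) : 0 < r ->
  \int[leb]_t (p t * symbol_form r (exp_itQ t u)) =
  \int[leb]_l (window_symbol r l * abs2 (L2fun (fourier u) l)).
Proof. by move=> r0; rewrite /Rintegral tonelli_symbol. Qed.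

End weight.

(** The substitution [k = l - t] moves [l] out of the symbol and into the weight. By [heaviside_sub]
    the difference is then an integral of [g (k / r)] over the interval between 0 and [l]. *)
Lemma window_symbol_sub (r l : R) : 0 < r ->
  window_symbol heaviside r l - window_symbol heaviside r 0 =
  \int[leb]_k ((heaviside (l - k) - heaviside (- k)) * g (k / r)).
Proof.
move=> r0.
have h (a : R) : leb.-integrable setT (EFin \o (fun k => heaviside (a - k) * g (k / r))) /\
    window_symbol heaviside r a = \int[leb]_k (heaviside (a - k) * g (k / r)).
  have [i1 e1] := Rintegral_subC a (integrable_window_symbol measurable_heaviside heaviside01 a r0).
  have E k : heaviside (a - k) * g ((a - (a - k)) / r) = heaviside (a - k) * g (k / r) by rewrite subKr.
  split; first by move: i1; under eq_fun do rewrite E.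
  by rewrite /window_symbol -e1; apply: eq_Rintegral => k _; rewrite E.
have [i1 ->] := h l; have [i2 ->] := h 0.
rewrite -RintegralB //; apply: eq_Rintegral => k _.
by rewrite sub0r mulrBl.
Qed.

Lemma window_symbol_sub_le (r l : R) : 0 < r ->
  `|window_symbol heaviside r l - window_symbol heaviside r 0| <= M * `|l|.
Proof.
move=> r0; rewrite window_symbol_sub //.
have [A [mA iA <- _ sE]] := heaviside_sub l.
have mA1 : measurable_fun setT (\1_A : R -> R) by exact: measurable_indic.
under eq_Rintegral do rewrite sE.
have hM : leb.-integrable setT (EFin \o (fun k => M * \1_A k)).
  by have := integrableZl measurableT M iA.
have bd k : `|Num.sg l * \1_A k * g (k / r)| <= M * \1_A k.
  rewrite !normrM (ger0_norm (g0 _)) (ger0_norm (_ : 0 <= \1_A k)) // mulrC.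
  apply: ler_pM => //; rewrite ?mulr_ge0 //.
  by rewrite normr_sg; case: (l != 0); rewrite ?mul1r // mul0r.
have i1 : leb.-integrable setT (EFin \o (fun k => Num.sg l * \1_A k * g (k / r))).
  apply: (le_integrable _ _ _ hM) => //.
    by apply/measurable_EFinP/measurable_funM; [exact: measurable_funM|exact: mgr].
  by move=> k _ /=; rewrite lee_fin (le_trans (bd k)) // ler_norm.
apply: le_trans (le_normr_Rintegral _ i1) _ => //.
rewrite -RintegralZl //; apply: le_Rintegral => //.
  by have := integrable_abse i1.
Qed.

(** For such [r] the whole interval between 0 and [l] lies where [g (k / r) = 1]. The limit is thus
    attained at each fixed [l]. *)
Lemma window_symbol_sub_eq (r l : R) : 0 < r -> `|l| < delta * r ->
  window_symbol heaviside r l - window_symbol heaviside r 0 = l.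
Proof.
move=> r0 lr; rewrite window_symbol_sub //.
have [A [mA iA IA Al sE]] := heaviside_sub l.
rewrite [RHS]numEsg -IA -RintegralZl //; apply: eq_Rintegral => k _.
rewrite sE indicE; case: (boolP (k \in A)) => kA; last by rewrite mulr0 mul0r.
by rewrite (symbol_eq1 r0 (le_lt_trans (Al k kA) lr)) mulr1.
Qed.

Lemma window_symbol_cvg (r_ : nat -> R) (u : H) : (forall n, 0 < r_ n) ->
  r_ n @[n --> \oo] --> +oo ->
  leb.-integrable setT (EFin \o (fun k => k * abs2 (L2fun (fourier u) k))) ->
  \int[leb]_l ((window_symbol heaviside (r_ n) l - window_symbol heaviside (r_ n) 0) *
    abs2 (L2fun (fourier u) l)) @[n --> \oo] -->
  \int[leb]_l (l * abs2 (L2fun (fourier u) l)).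
Proof.
move=> r0 roo iu; have h := integrableZl measurableT M (integrable_abse iu).
have mK (r : R) : measurable_fun setT (window_symbol heaviside r).
  apply: (@measurable_Rintegral_snd _ _ mR mR R leb
    (fun z : mR * mR => heaviside z.1 * g ((z.2 - z.1) / r))).
  apply: measurable_funM; last exact: mgd.
  have m : measurable_fun setT (fun z : mR * mR => z.1) by exact: measurable_fst.
  exact: (measurableT_comp measurable_heaviside m).
apply: (@Rintegral_dominated_cvg _ _ _ leb _ _ (fun l => M * `|l * abs2 (L2fun (fourier u) l)|)).
- by move=> n; apply: measurable_funM; [apply: measurable_funB => //; exact: mK|exact: mF].
- by apply: measurable_funM => //; exact: mF.
- apply: aeW => l; apply: cvg_near_cst.
  apply: filterS (symbol_cvg1 l r0 roo) => n hn.
  by rewrite (window_symbol_sub_eq (r0 n) hn).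
- exact: h.
- move=> n l; rewrite !normrM mulrA ler_wpM2r //.
  exact: window_symbol_sub_le.
Qed.

(** Isolates the term that grows with [r]. It depends on [u] only through its norm and cancels
    between two vectors of equal norm. *)
Lemma integral_window_symbol (r : R) (u : H) : 0 < r ->
  \int[leb]_l (window_symbol heaviside r l * abs2 (L2fun (fourier u) l)) =
  \int[leb]_l ((window_symbol heaviside r l - window_symbol heaviside r 0) *
    abs2 (L2fun (fourier u) l)) + window_symbol heaviside r 0 * norm2 u ^+ 2.
Proof.
move=> r0; set c := window_symbol heaviside r 0.
have i1 := integrable_window_symbolM measurable_heaviside heaviside01 u r0.
have i2 : leb.-integrable setT (EFin \o (fun l => c * abs2 (L2fun (fourier u) l))).
  by have := integrableZl measurableT c (iF u).
have -> : c * norm2 u ^+ 2 = \int[leb]_l (c * abs2 (L2fun (fourier u) l)).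
  by rewrite RintegralZl ?integral_fourier_abs2 //; exact: iF.
under [X in _ = X + _]eq_Rintegral do rewrite mulrBl.
by rewrite RintegralB // subrK.
Qed.

Lemma sojourn_diff_cvg (r_ : nat -> R) (u w : H) : (forall n, 0 < r_ n) ->
  r_ n @[n --> \oo] --> +oo -> norm2 u = norm2 w ->
  leb.-integrable setT (EFin \o (fun k => k * abs2 (L2fun (fourier u) k))) ->
  leb.-integrable setT (EFin \o (fun k => k * abs2 (L2fun (fourier w) k))) ->
  \int[leb]_t (heaviside t * symbol_form (r_ n) (exp_itQ t w)) -
  \int[leb]_t (heaviside t * symbol_form (r_ n) (exp_itQ t u)) @[n --> \oo] -->
  \int[leb]_l (l * abs2 (L2fun (fourier w) l)) - \int[leb]_l (l * abs2 (L2fun (fourier u) l)).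
Proof.
move=> r0 roo uw iu iw.
have -> : (fun n => \int[leb]_t (heaviside t * symbol_form (r_ n) (exp_itQ t w)) -
  \int[leb]_t (heaviside t * symbol_form (r_ n) (exp_itQ t u))) =
  (fun n => \int[leb]_l ((window_symbol heaviside (r_ n) l - window_symbol heaviside (r_ n) 0) *
    abs2 (L2fun (fourier w) l)) -
   \int[leb]_l ((window_symbol heaviside (r_ n) l - window_symbol heaviside (r_ n) 0) *
    abs2 (L2fun (fourier u) l))).
  apply/funext => n.
  have Ew := integral_symbol_form measurable_heaviside heaviside01 w (r0 n).
  have Eu := integral_symbol_form measurable_heaviside heaviside01 u (r0 n).
  apply: etrans (congr2 (fun a b => a - b) Ew Eu) _.
  apply: etrans (congr2 (fun a b => a - b) (integral_window_symbol w (r0 n))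
    (integral_window_symbol u (r0 n))) _.
  have alg (a b c x y : R) : x = y -> a + c * x - (b + c * y) = a - b by move=> ->; ring.
  exact: alg (congr1 (fun z => z ^+ 2) (esym uw)).
by apply: cvgB; exact: window_symbol_cvg.
Qed.

End Symbol.

(** * The sojourn time excess *)

Section PhaseContinuity.
Context {R : realType}.
Notation leb := (@lebesgue_measure R).
Notation H := (L2 leb).

Lemma exp_itQ_cvg (u : H) (t_ : nat -> R) (t : R) : t_ n @[n --> \oo] --> t ->
  norm2 (exp_itQ (t_ n) u - exp_itQ t u) @[n --> \oo] --> (0 : R).
Proof.
move=> tn.
pose d n x : R[i] := expi (- (t_ n * x)) - expi (- (t * x)).
have ae n : \forall x \ae leb, L2fun (exp_itQ (t_ n) u - exp_itQ t u) x = d n x * L2fun u x.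
  apply: ae_eq_trans (L2funB (exp_itQ (t_ n) u) (exp_itQ t u)) _.
  have h1 := exp_itQ_ae (t_ n) u; have h2 := exp_itQ_ae t u.
  by apply: filterS2 h1 h2 => x -> ->; rewrite -mulrBl.
have md n : cmeasurable (d n) by exact: cmeasurableB (cmeasurable_phase _) (cmeasurable_phase _).
have mD n := cmeasurableM (md n) (cmeasurable_L2fun u).
have sq n : norm2 (exp_itQ (t_ n) u - exp_itQ t u) ^+ 2 = \int[leb]_x (abs2 (d n x) * abs2 (L2fun u x)).
  rewrite sqr_norm2 /Rintegral; congr fine.
  rewrite (@integral_abs2_ae _ _ R leb _ _ (cmeasurable_L2fun _) (mD n) (ae n)).
  by apply: eq_integral => x _; rewrite abs2M.
have d4 n x : abs2 (d n x) <= 4.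
  apply: le_trans (abs2D_le _ _) _; rewrite abs2N !abs2_expi; lra.
have lim : \int[leb]_x (abs2 (d n x) * abs2 (L2fun u x)) @[n --> \oo] --> (0 : R).
  have -> : (0 : R) = \int[leb]_x (0 : R) by rewrite /Rintegral integral0.
  apply: (@Rintegral_dominated_cvg _ _ _ leb _ (fun=> 0) (fun x => 4 * abs2 (L2fun u x))) => //.
  - move=> n; apply: measurable_funM; first exact: (measurable_fun_abs2 (md n)).
    exact: (measurable_fun_abs2 (cmeasurable_L2fun u)).
  - apply: aeW => x; rewrite -(mul0r (abs2 (L2fun u x))); apply: cvgM; last exact: cvg_cst.
    rewrite -(@abs2_0 R) -(subrr (expi (- (t * x)))).
    have tx : - (t_ n * x) @[n --> \oo] --> - (t * x) by apply: cvgN; apply: cvgM => //; exact: cvg_cst.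
    apply: cvg_abs2; rewrite ?ReD ?ReN ?ImD ?ImN; under eq_fun do rewrite ?ReD ?ReN ?ImD ?ImN.
    + apply: cvgB; last exact: cvg_cst.
      by apply: (@cvg_comp _ _ _ _ cos _ (nbhs (- (t * x))) _ tx); exact: continuous_cos.
    + apply: cvgB; last exact: cvg_cst.
      by apply: (@cvg_comp _ _ _ _ sin _ (nbhs (- (t * x))) _ tx); exact: continuous_sin.
  - by have := integrableZl measurableT 4 (integrable_abs2 (L2fun_sq u)).
  - move=> n x; have h : 0 <= abs2 (d n x) * abs2 (L2fun u x) by rewrite mulr_ge0 ?abs2_ge0.
    by rewrite (ger0_norm h) ler_wpM2r ?abs2_ge0.
have -> : (fun n => norm2 (exp_itQ (t_ n) u - exp_itQ t u)) =
    (fun n => Num.sqrt (norm2 (exp_itQ (t_ n) u - exp_itQ t u) ^+ 2)).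
  by apply/funext => n; rewrite sqrtr_sqr ger0_norm ?norm2_ge0.
under eq_fun do rewrite sq.
rewrite -sqrtr0; apply: (@cvg_comp _ _ _ _ Num.sqrt _ (nbhs (0 : R))); first exact: lim.
exact: sqrt_continuous.
Qed.

(** The source of measurability in [t] for the full evolution: quantities controlled by the
    increments of free evolutions inherit their strong continuity. Two vectors are allowed because
    [V t] is compared with the free evolutions of both [u] and [w]. *)
Lemma continuous_of_phase_lipschitz (h : R -> R) (C : R) (u v : H) :
  (forall s t, `|h s - h t| <= C * (norm2 (exp_itQ s u - exp_itQ t u) +
                                   norm2 (exp_itQ s v - exp_itQ t v))) ->
  continuous h.
Proof.
move=> hC t; have sq (t_ : nat -> R) : t_ n @[n --> \oo] --> t -> h (t_ n) @[n --> \oo] --> h t.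
  move=> tn; apply: squeeze_dist (fun n => hC (t_ n) t) _.
  rewrite -(mulr0 C); apply: cvgM; first exact: cvg_cst.
  by rewrite -(addr0 (0 : R)); apply: cvgD; exact: exp_itQ_cvg.
by apply/left_right_continuousP; split; [apply/cvg_at_leftP|apply/cvg_at_rightP] => t_ [_ tn]; exact: sq.
Qed.

End PhaseContinuity.

(** * Comparison of an evolution [V] with its past and future free evolutions *)

Section Excess.
Context {R : realType}.
Notation leb := (@lebesgue_measure R).
Notation H := (L2 leb).
Variables (g : R -> R) (M delta : R).
Hypothesis mg : measurable_fun setT g.
Hypothesis g0 : forall x, 0 <= g x.
Hypothesis gM : forall x, g x <= M.
Hypothesis gi : leb.-integrable setT (EFin \o g).
Hypothesis delta0 : 0 < delta.
Hypothesis g1 : forall x, - delta < x < delta -> g x = 1.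
Variables (V : R -> H) (u w : H).
Hypothesis uw : norm2 u = norm2 w.
Hypothesis V_norm : forall t, norm2 (V t) = norm2 u.
Hypothesis V_sub : forall s t, norm2 (V s - V t) = norm2 (exp_itQ s u - exp_itQ t u).
Hypothesis past : (\int[leb]_(t in `]-oo, 0%R]) (norm2 (V t - exp_itQ t u))%:E < +oo)%E.
Hypothesis future : (\int[leb]_(t in `[0%R, +oo[) (norm2 (V t - exp_itQ t w))%:E < +oo)%E.

Let M0 : 0 <= M. Proof. exact: le_trans (g0 0) (gM 0). Qed.

Let sf := symbol_form g.

Let measurable_dist (v : H) : measurable_fun setT (fun t : R => norm2 (V t - exp_itQ t v)).
Proof.
apply: continuous_measurable_fun; apply: (@continuous_of_phase_lipschitz _ _ 1 u v) => s t.
rewrite mul1r -V_sub; apply: le_trans (norm2_lipschitz _ _) _.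
have -> : V s - exp_itQ s v - (V t - exp_itQ t v) = (V s - V t) - (exp_itQ s v - exp_itQ t v).
  by rewrite !opprB addrACA [RHS]addrACA; congr (_ + _); rewrite addrC.
by apply: le_trans (norm2D _ _) _; rewrite norm2N.
Qed.

Lemma measurable_symbol_evolution (r : R) : measurable_fun setT (fun t : R => sf r (V t)).
Proof.
apply: continuous_measurable_fun.
apply: (@continuous_of_phase_lipschitz _ _ (M * (norm2 u + norm2 u)) u u) => s t.
have h := symbol_form_lipschitz mg g0 gM r (V s) (V t).
apply: le_trans h _; rewrite !V_norm V_sub ler_wpM2l ?lerDl ?norm2_ge0 //.
by rewrite mulr_ge0 // addr_ge0 ?norm2_ge0.
Qed.

Let past_weight (t : R) := 1 - heaviside t.

Let past_weight01 t : 0 <= past_weight t <= 1.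
Proof.
have /andP[h1 h2] := @heaviside01 R t.
by rewrite /past_weight subr_ge0 h2 lerBlDr lerDl.
Qed.

Let measurable_past_weight : measurable_fun setT past_weight.
Proof. by apply: measurable_funB => //; exact: measurable_heaviside. Qed.

(** Up to a constant, the function that dominates the error of replacing [V t] by free evolutions,
    uniformly in [r]. The hypotheses [past] and [future] make it integrable. *)
Let beta (t : R) := past_weight t * norm2 (V t - exp_itQ t u) + heaviside t * norm2 (V t - exp_itQ t w).

Let integrable_weight (p : R -> R) (A : set R) (v : H) : measurable A -> measurable_fun setT p ->
  (forall t, 0 <= p t <= \1_A t) ->
  (\int[leb]_(t in A) (norm2 (V t - exp_itQ t v))%:E < +oo)%E ->
  leb.-integrable setT (EFin \o (fun t => p t * norm2 (V t - exp_itQ t v))).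
Proof.
move=> mA mp pA fin; have md := measurable_dist v.
apply: integrable_ge0P.
- by move=> t; have /andP[h _] := pA t; rewrite mulr_ge0 ?norm2_ge0.
- exact: measurable_funM.
apply: le_lt_trans fin; rewrite [leRHS]integral_mkcond; apply: ge0_le_integral => //.
- by move=> t _; have /andP[h _] := pA t; rewrite lee_fin mulr_ge0 ?norm2_ge0.
- by apply/measurable_EFinP; exact: measurable_funM.
- apply/(measurable_restrictT _ mA); apply: measurable_funTS; exact/measurable_EFinP.
- move=> t _; have /andP[_] := pA t; rewrite indicE /patch; case: ifPn => _ h.
    by rewrite lee_fin ler_piMl ?norm2_ge0.
  have -> : p t = 0 by apply/eqP; rewrite eq_le h; have /andP[-> _] := pA t.
  by rewrite mul0r.
Qed.

Let integrable_beta : leb.-integrable setT (EFin \o beta).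
Proof.
have i1 : leb.-integrable setT (EFin \o (fun t => past_weight t * norm2 (V t - exp_itQ t u))).
  apply: (@integrable_weight _ `]-oo, 0%R]%classic) => //.
  move=> t; have /andP[-> _] := past_weight01 t.
  rewrite /past_weight /heaviside !indicE.
  have -> : (t \in (`[0, +oo[%classic : set R)) = (0 <= t) by apply/idP/idP; rewrite inE /= in_itv /= andbT.
  have -> : (t \in (`]-oo, 0]%classic : set R)) = (t <= 0) by apply/idP/idP; rewrite inE /= in_itv.
  case: (lerP 0 t) => h1 /=; first by rewrite subrr ler0n.
  by rewrite subr0 (ltW h1).
have i2 : leb.-integrable setT (EFin \o (fun t => heaviside t * norm2 (V t - exp_itQ t w))).
  apply: (@integrable_weight _ `[0%R, +oo[%classic) => //.
    exact: measurable_heaviside.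
  by move=> t; have /andP[-> _] := @heaviside01 R t; rewrite lexx.
exact: (integrableD measurableT i1 i2).
Qed.

Let free (r t : R) := past_weight t * sf r (exp_itQ t u) + heaviside t * sf r (exp_itQ t w).

Let symbol_free_le (r t : R) : `|sf r (V t) - free r t| <= M * (norm2 u + norm2 u) * beta t.
Proof.
have h1 := symbol_form_lipschitz mg g0 gM r (V t) (exp_itQ t u).
have h2 := symbol_form_lipschitz mg g0 gM r (V t) (exp_itQ t w).
rewrite V_norm norm2_exp_itQ in h1; rewrite V_norm norm2_exp_itQ -uw in h2.
rewrite -/(sf _ _) -/(sf _ _) in h1 h2.
have a1 (x y : R) : (1 - 1) * x + 1 * y = y by ring.
have a0 (x y : R) : (1 - 0) * x + 0 * y = x by ring.
have [E|E] : heaviside t = 1 \/ heaviside t = 0.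
- by rewrite /heaviside indicE; case: (t \in _); [left|right].
- have F1 : free r t = sf r (exp_itQ t w) by rewrite /free /past_weight E; exact: a1.
  have B1 : beta t = norm2 (V t - exp_itQ t w) by rewrite /beta /past_weight E; exact: a1.
  rewrite F1 B1; exact: h2.
- have F1 : free r t = sf r (exp_itQ t u) by rewrite /free /past_weight E; exact: a0.
  have B1 : beta t = norm2 (V t - exp_itQ t u) by rewrite /beta /past_weight E; exact: a0.
  rewrite F1 B1; exact: h1.
Qed.

Let integrable_free (r : R) : 0 < r -> leb.-integrable setT (EFin \o free r).
Proof.
move=> r0.
have i1 := integrable_symbol_form mg g0 gM gi measurable_past_weight past_weight01 u r0.
have i2 := integrable_symbol_form mg g0 gM gi (@measurable_heaviside R) (@heaviside01 R) w r0.
exact: (integrableD measurableT i1 i2).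
Qed.

Let integrable_excess (r : R) : 0 < r ->
  leb.-integrable setT (EFin \o (fun t => sf r (V t) - free r t)).
Proof.
move=> r0; have h := integrableZl measurableT (M * (norm2 u + norm2 u)) integrable_beta.
have [/measurable_EFinP mf _] := integrableP _ _ _ (integrable_free r0).
apply: (le_integrable _ _ _ h) => //.
  by apply/measurable_EFinP; apply: measurable_funB => //; exact: measurable_symbol_evolution.
by move=> t _; rewrite /= lee_fin (le_trans (symbol_free_le r t)) // ler_norm.
Qed.

(** Obtained by comparison: the error is dominated by [beta], and the free part is integrable by
    Tonelli. *)
Lemma integrable_symbol_evolution (r : R) : 0 < r ->
  leb.-integrable setT (EFin \o (fun t => sf r (V t))).
Proof.
move=> r0; have := integrableD measurableT (integrable_excess r0) (integrable_free r0).
by apply: eq_integrable => // t _; rewrite /= -EFinD subrK.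
Qed.

Lemma integrable_symbol_free (r : R) (v : H) : 0 < r ->
  leb.-integrable setT (EFin \o (fun t => sf r (exp_itQ t v))).
Proof.
move=> r0; have m1 : measurable_fun setT (fun _ : R => 1 : R) by exact: measurable_cst.
have h : forall t : R, 0 <= (fun=> 1 : R) t <= 1 by move=> t; rewrite ler01 lexx.
have := integrable_symbol_form mg g0 gM gi m1 h v r0.
by apply: eq_integrable => // t _; rewrite /= mul1r.
Qed.

Lemma excess_cvg (r_ : nat -> R) : (forall n, 0 < r_ n) -> r_ n @[n --> \oo] --> +oo ->
  leb.-integrable setT (EFin \o (fun k => k * abs2 (L2fun (fourier u) k))) ->
  leb.-integrable setT (EFin \o (fun k => k * abs2 (L2fun (fourier w) k))) ->
  \int[leb]_t sf (r_ n) (V t) - \int[leb]_t sf (r_ n) (exp_itQ t u) @[n --> \oo] -->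
  \int[leb]_l (l * abs2 (L2fun (fourier w) l)) - \int[leb]_l (l * abs2 (L2fun (fourier u) l)).
Proof.
move=> r0 roo iu iw.
(* In the past the reference evolution of [free] is that of [u], which is also the one subtracted in
   the excess; beyond the error term only the future difference between [w] and [u] remains. *)
have telescope_ (a p b c : R) : a - ((1 - p) * b + p * c) + (p * c - p * b) = a - b by ring.
have lim0 : \int[leb]_t (sf (r_ n) (V t) - free (r_ n) t) @[n --> \oo] --> (0 : R).
  have -> : (0 : R) = \int[leb]_t (0 : R) by rewrite /Rintegral integral0.
  apply: (@Rintegral_dominated_cvg _ _ _ leb _ (fun=> 0)
    (fun t => M * (norm2 u + norm2 u) * beta t)) => //.
  - move=> n; have [/measurable_EFinP mf _] := integrableP _ _ _ (integrable_free (r0 n)).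
    by apply: measurable_funB => //; exact: measurable_symbol_evolution.
  - apply: aeW => t.
    have c1 : sf (r_ n) (V t) @[n --> \oo] --> norm2 (V t) ^+ 2.
      exact: (symbol_form_cvg mg g0 gM delta0 g1 r0 roo).
    have c2 : sf (r_ n) (exp_itQ t u) @[n --> \oo] --> norm2 (exp_itQ t u) ^+ 2.
      exact: (symbol_form_cvg mg g0 gM delta0 g1 r0 roo).
    have c3 : sf (r_ n) (exp_itQ t w) @[n --> \oo] --> norm2 (exp_itQ t w) ^+ 2.
      exact: (symbol_form_cvg mg g0 gM delta0 g1 r0 roo).
    rewrite V_norm in c1; rewrite norm2_exp_itQ in c2; rewrite norm2_exp_itQ -uw in c3.
    (* All three forms tend to [norm2 u ^+ 2], and the two weights add up to 1. *)
    have -> : (0 : R) = norm2 u ^+ 2 - (past_weight t * norm2 u ^+ 2 + heaviside t * norm2 u ^+ 2).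
      by rewrite /past_weight; ring.
    apply: cvgB c1 _; rewrite /free; apply: cvgD.
      by apply: cvgM; [exact: cvg_cst|exact: c2].
    by apply: cvgM; [exact: cvg_cst|exact: c3].
  - by have := integrableZl measurableT (M * (norm2 u + norm2 u)) integrable_beta.
have lim1 := sojourn_diff_cvg mg g0 gM gi delta0 g1 r0 roo uw iu iw.
rewrite -[X in _ --> X]add0r; apply: cvg_trans (cvgD lim0 lim1).
apply: near_eq_cvg; apply: nearW => n; rewrite /= -/sf.
transitivity (\int[leb]_t (sf (r_ n) (V t) - free (r_ n) t) +
  (\int[leb]_t (heaviside t * sf (r_ n) (exp_itQ t w)) -
   \int[leb]_t (heaviside t * sf (r_ n) (exp_itQ t u)))); first by [].
have i1 := integrable_symbol_form mg g0 gM gi (@measurable_heaviside R) (@heaviside01 R) w (r0 n).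
have i2 := integrable_symbol_form mg g0 gM gi (@measurable_heaviside R) (@heaviside01 R) u (r0 n).
have i3 := integrable_excess (r0 n).
have i4 := integrableB measurableT i1 i2.
apply: etrans (congr2 +%R erefl (esym (RintegralB measurableT i1 i2))) _.
apply: etrans (esym (RintegralD measurableT i3 i4)) _.
have h := RintegralB measurableT (integrable_symbol_evolution (r0 n)) (integrable_symbol_free u (r0 n)).
apply: etrans h.
by apply: eq_Rintegral => t _; exact: telescope_.
Qed.

End Excess.

(** * Choice of a good representative of the symbol *)

Section NiceSymbol.
Context {R : realType}.
Notation leb := (@lebesgue_measure R).

(** [g] is 1 on the interval around 0 and elsewhere the real part of [f] clipped between 0 and the
    decaying bound. The clipping acts only on a null set, yet makes the bounds hold at every point,
    as the preceding sections require; [rho > 1] gives integrability. *)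
Lemma nice_symbol (f : R -> R[i]) (rho C delta : R) : cmeasurable f ->
  (\forall x \ae leb, 0 <= f x) -> 1 < rho -> 0 < C ->
  (\forall x \ae leb, `|f x| <= (C * jap x `^ (- rho))%:C) -> 0 < delta ->
  (\forall x \ae leb, - delta < x < delta -> f x = 1) ->
  exists (g : R -> R) (M : R), [/\ measurable_fun setT g, forall x : R, 0 <= g x <= M,
    leb.-integrable setT (EFin \o g), forall x, - delta < x < delta -> g x = 1 &
    \forall x \ae leb, f x = (g x)%:C].
Proof.
move=> [mf _] f0 rho1 C0 fC d0 f1.
pose I (x : R) : R := \1_(`]- delta, delta[%classic : set R) x.
have IE x : I x = (- delta < x < delta)%R%:R.
  by rewrite /I indicE; congr (nat_of_bool _)%:R; apply/idP/idP; rewrite inE /= in_itv.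
have mI : measurable_fun setT I by apply: measurable_indic; exact: measurable_itv.
pose h (x : R) := Num.min (Num.max (Rez (f x)) 0) (C * jap x `^ (- rho)).
have mj : measurable_fun setT (fun x : R => C * jap x `^ (- rho)).
  by apply: measurable_funM => //; exact: measurable_jap_powR.
have mh : measurable_fun setT h by apply: measurable_minr => //; exact: measurable_maxr.
have J0 x : 0 <= C * jap x `^ (- rho) by rewrite mulr_ge0 ?powR_ge0 ?ltW.
have h0 x : 0 <= h x by rewrite /h le_min J0 le_max lexx orbT.
have hJ x : h x <= C * jap x `^ (- rho) by rewrite /h ge_min lexx orbT.
have J1 x : C * jap x `^ (- rho) <= C.
  rewrite ler_piMr ?(ltW C0) // powRN invf_le1; last first.
    by rewrite powR_gt0 // (lt_le_trans ltr01) // jap_ge1.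
  by rewrite -[leLHS](powRr0 (jap x)) ler_powR ?jap_ge1 // ltW // (lt_trans ltr01).
pose g x := I x + (1 - I x) * h x.
have gb x : 0 <= g x <= I x + C * jap x `^ (- rho).
  rewrite /g !IE; case: (- delta < x < delta) => /=; first by rewrite subrr mul0r addr0 ler01 lerDl J0.
  by rewrite subr0 mul1r !add0r h0 hJ.
have mgx : measurable_fun setT g.
  by apply: measurable_funD => //; apply: measurable_funM => //; exact: measurable_funB.
exists g, (1 + C); split => //.
- move=> x; have /andP[g0 gJ] := gb x; rewrite g0 (le_trans gJ) // lerD // IE.
  by case: (- delta < x < delta) => /=; rewrite ?ler01.
- have i1 : leb.-integrable setT (EFin \o I) by exact: integrable_indic_itv.
  have i2 := integrableZl measurableT C (integrable_jap rho1).
  apply: (le_integrable _ _ _ (integrableD measurableT i1 i2)) => //.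
    exact/measurable_EFinP.
  move=> x _; have /andP[g0 gJ] := gb x.
  by rewrite /= lee_fin (ger0_norm g0) (le_trans gJ) // ler_norm.
- by move=> x dx; rewrite /g IE dx /= subrr mul0r addr0.
(* In the order of [R[i]], [0 <= f x] also says that [f x] is real. *)
apply: filterS3 f0 fC f1 => x; rewrite lecE => /andP[/eqP im re] fx fx1.
rewrite /g IE; case: (boolP (- delta < x < delta)) => dx /=.
  by rewrite subrr mul0r addr0 fx1.
rewrite subr0 mul1r add0r /h.
rewrite normcE_cnorm lecR in fx.
have -> : Num.max (Rez (f x)) 0 = Rez (f x) by rewrite max_l.
rewrite min_l; last by rewrite (le_trans _ fx) // (le_trans (ler_norm _)) // Re_le_cnorm.
by move: im; case: (f x) => a b /= ->.
Qed.

End NiceSymbol.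

Theorem theorem3p4 (R : realType)
  (* the localization function f *)
  (f : R -> R[i])
  (f_meas : cmeasurable f)
  (f_bounded : exists M : R, \forall x \ae (@lebesgue_measure R), `|f x| <= M%:C)
  (f_ge0 : \forall x \ae (@lebesgue_measure R), 0 <= f x)
  (f_even : \forall x \ae (@lebesgue_measure R), f x = f `|x|)
  (f_decay : exists rho C : R, [/\ 1 < rho, 0 < C &
     \forall x \ae (@lebesgue_measure R), `|f x| <= (C * jap x `^ (- rho))%:C])
  (f_one : exists2 delta : R, 0 < delta &
     \forall x \ae (@lebesgue_measure R), - delta < x < delta -> f x = 1)
  (* the selfadjoint operator A (= H), its spectral measure E and U t = e^{-itH} *)
  (A : operator (R := R))
  (A_sa : selfadjoint A)
  (E : set R -> {linear L2 (@lebesgue_measure R) -> L2 (@lebesgue_measure R)})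
  (A_E : spectral_measure_of A E)
  (U : R -> {linear L2 (@lebesgue_measure R) -> L2 (@lebesgue_measure R)})
  (A_U : is_propagator E U)
  (* existence and completeness of the wave operators, with free operator Q *)
  (Wp Wm : L2 (@lebesgue_measure R) -> L2 (@lebesgue_measure R))
  (Wp_lim : is_wave_operator U (pinfty_nbhs R) Wp)
  (Wm_lim : is_wave_operator U (ninfty_nbhs R) Wm)
  (Wp_complete : range Wp = ac_subspace E)
  (Wm_complete : range Wm = ac_subspace E)
  (A_smooth : forall (s' : R)
     (T : {linear sobolev (- s') -> L2 (@lebesgue_measure R)}),
     2^-1 < s' -> bounded_op T ->
     locally_smooth E U (T \o to_sobolev (- s')) (~` eigenvalues A))
  (s : R) (s_gt1 : 1 < s)
  (phi : L2 (@lebesgue_measure R)) :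
  let S := scattering Wp Wm in
  DD A s phi ->
  DD A s (S phi) ->
  (\int[@lebesgue_measure R]_(t in `]-oo, 0%R])
     (norm2 (Wm (exp_itQ t phi) - exp_itQ t phi))%:E < +oo)%E ->
  (\int[@lebesgue_measure R]_(t in `[0%R, +oo[)
     (norm2 (Wp (exp_itQ t (S phi)) - exp_itQ t (S phi)))%:E < +oo)%E ->
  (* the integrals T_r(phi) and T^0_r(phi) converge *)
  (forall r : R, 0 < r ->
     cintegrable (@lebesgue_measure R) setT
       (localization f r (full_evolution U Wm) phi) /\
     cintegrable (@lebesgue_measure R) setT
       (localization f r exp_itQ phi)) /\
  (tau_in f U Wm r phi : R[i]^o) @[r --> +oo] -->
    (inner phi (adj S (commutator momentum S phi)) : R[i]^o).
Proof.
move=> S [phis _] [wS _] past future.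
have EP : projection_valued_measure E by case: A_E.
have WpWm : range Wp = range Wm by rewrite Wp_complete Wm_complete.
have [rho [C [rho1 C0 fC]]] := f_decay; have [delta d0 f1] := f_one.
have [g [M [mg gb gi g1 fg]]] := nice_symbol f_meas f_ge0 rho1 C0 fC d0 f1.
have g0 x : 0 <= g x by have /andP[] := gb x.
have gM x : g x <= M by have /andP[] := gb x.
have V_Wm t : U t (Wm phi) = Wm (exp_itQ t phi).
  exact: (wave_intertwining EP A_U (@ninfty_shift R) Wm_lim).
have WpS : Wp (S phi) = Wm phi by exact: (wave_scattering EP A_U Wp_lim WpWm).
have V_Wp t : U t (Wm phi) = Wp (exp_itQ t (S phi)).
  by rewrite -(wave_intertwining EP A_U (@pinfty_shift R) Wp_lim) WpS.
have V_norm t : norm2 (U t (Wm phi)) = norm2 phi.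
  by rewrite V_Wm (wave_norm EP A_U Wm_lim) norm2_exp_itQ.
have V_sub t1 t2 : norm2 (U t1 (Wm phi) - U t2 (Wm phi)) = norm2 (exp_itQ t1 phi - exp_itQ t2 phi).
  have WB u v : Wm (u - v) = Wm u - Wm v.
    by rewrite addrC -scaleN1r (wave_linear Wm_lim) scaleN1r addrC.
  by rewrite !V_Wm -WB (wave_norm EP A_U Wm_lim).
have S_norm : norm2 phi = norm2 (S phi).
  by rewrite (scattering_norm EP A_U Wp_lim Wm_lim WpWm).
have fin_ext (D : set R) (h1 h2 : R -> R) : h1 =1 h2 ->
    (\int[@lebesgue_measure R]_(t in D) (h1 t)%:E < +oo)%E ->
    (\int[@lebesgue_measure R]_(t in D) (h2 t)%:E < +oo)%E by move=> /funext ->.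
have past' : (\int[@lebesgue_measure R]_(t in `]-oo, 0%R])
    (norm2 (U t (Wm phi) - exp_itQ t phi))%:E < +oo)%E.
  apply: fin_ext past => t; exact: (congr1 (fun v => norm2 (v - exp_itQ t phi)) (esym (V_Wm t))).
have future' : (\int[@lebesgue_measure R]_(t in `[0%R, +oo[)
    (norm2 (U t (Wm phi) - exp_itQ t (S phi)))%:E < +oo)%E.
  apply: fin_ext future => t.
  exact: (congr1 (fun v => norm2 (v - exp_itQ t (S phi))) (esym (V_Wp t))).
have locE (r : R) (V : R -> L2 (@lebesgue_measure R) -> L2 (@lebesgue_measure R)) : 0 < r ->
    localization f r V phi = fun t => (symbol_form g r (V t phi))%:C.
  by move=> r0; apply/funext => t; exact: (inner_funP mg g0 gM _ f_meas fg r0).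
have i1 (r : R) (r0 : 0 < r) := integrable_symbol_evolution mg g0 gM gi S_norm V_norm V_sub past' future' r0.
have i2 (r : R) (r0 : 0 < r) := integrable_symbol_free mg g0 gM gi phi r0.
split.
  by move=> r r0; rewrite !locE //; split; apply: cintegrable_real; [exact: i1|exact: i2].
have iu := integrable_momentum (ltW s_gt1) phis.
have iw := integrable_momentum (ltW s_gt1) wS.
have sojournE (r : R) V : 0 < r ->
    sojourn f r V phi = (\int[@lebesgue_measure R]_t symbol_form g r (V t phi))%:C.
  move=> r0; apply: etrans (congr1 (cintegral (@lebesgue_measure R) setT) (locE r V r0)) _.
  exact: cintegral_real.
have realB (z1 z2 : R[i]) (x y : R) : z1 = x%:C -> z2 = y%:C -> z1 - z2 = (x - y)%:C.
  by move=> -> ->; rewrite rmorphB.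
have tauE (r : R) : 0 < r -> tau_in f U Wm r phi =
    (\int[@lebesgue_measure R]_t symbol_form g r (U t (Wm phi)) -
     \int[@lebesgue_measure R]_t symbol_form g r (exp_itQ t phi))%:C.
  move=> r0; have e1 := sojournE r (full_evolution U Wm) r0; have e2 := sojournE r (@exp_itQ R) r0.
  exact: realB e1 e2.
have limE : inner phi (adj S (commutator momentum S phi)) =
    (\int[@lebesgue_measure R]_k (k * abs2 (L2fun (fourier (S phi)) k)) -
     \int[@lebesgue_measure R]_k (k * abs2 (L2fun (fourier phi) k)))%:C.
  rewrite (inner_adj_scattering EP A_U Wp_lim Wm_lim WpWm) /commutator innerBr.
  rewrite (scattering_inner EP A_U Wp_lim Wm_lim WpWm).
  by apply: realB; [exact: (momentum_sobolev (ltW s_gt1) wS)|exact: (momentum_sobolev (ltW s_gt1) phis)].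
apply/cvg_cnormP/cvg_pinftyP => r_ r_oo.
(* The limit in [r] is tested on sequences, since it rests on dominated convergence. [excess_cvg]
   asks for positivity at every index, which the maximum with 1 ensures without changing the
   tail. *)
pose r1 n := Num.max (r_ n) 1.
have r1_0 n : 0 < r1 n by rewrite /r1 lt_max ltr01 orbT.
have r_ge1 : \forall n \near \oo, 1 <= r_ n by exact: (r_oo [set x | 1 <= x] (nbhs_pinfty_ge (num_real 1))).
have r1_oo : r1 n @[n --> \oo] --> +oo.
  apply: cvg_trans r_oo; apply: near_eq_cvg.
  by apply: filterS r_ge1 => n h; rewrite /r1 max_l.
have h := excess_cvg mg g0 gM gi d0 g1 S_norm V_norm V_sub past' future' r1_0 r1_oo iu iw.
have dist0 (D : nat -> R) (L : R) : D n @[n --> \oo] --> L -> `|D n - L| @[n --> \oo] --> (0 : R).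
  move=> DL; rewrite -(@normr0 _ R) -(subrr L).
  by apply: cvg_norm; apply: cvgB DL _; exact: cvg_cst.
have cnormB (z1 z2 : R[i]) (x y : R) : z1 = x%:C -> z2 = y%:C -> cnorm (z1 - z2) = `|x - y|.
  by move=> e1 e2; rewrite (realB _ _ _ _ e1 e2) cnorm_real.
apply: cvg_trans (dist0 _ _ h); apply: near_eq_cvg; apply: filterS r_ge1 => n rn.
have e : r1 n = r_ n by rewrite /r1 max_l.
apply: esym; move: (cnormB _ _ _ _ (tauE _ (r1_0 n)) limE); rewrite e; exact.
Qed.
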